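(* Let $g\geq 2$ and let $\Gamma=\pi_1(\Sigma_g)$ be the fundamental group of the closed orientable surface $\Sigma_g$ of genus $g$. Then there exists a dense subgroup of $S_\infty$ which is isomorphic to $\Gamma$.
   Context: $S_\infty=\mathrm{Sym}(\mathbb{Z})$ is the group of all permutations of $\mathbb{Z}$. It carries the group topology with basis the sets $U(\varphi,[n])=\{\psi\in S_\infty : \psi|_{[n]}=\varphi|_{[n]}\}$ for $\varphi\in S_\infty$, $n\in\mathbb{N}$, where $[n]=\{-n,\dots,n\}\subseteq\mathbb{Z}$ (the topology of pointwise convergence). Surfaces are connected and without boundary. *)

(* Defs.v *)
From HB Require Import structures.
From Stdlib Require Import Relation_Operators.
From mathcomp Require Import all_boot all_order all_algebra.
From mathcomp Require Import all_classical all_reals all_analysis.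
From mathcomp Require Import homotopy lra.

Set Implicit Arguments.
Unset Strict Implicit.
Unset Printing Implicit Defensive.

Import Order.TTheory GRing.Theory Num.Theory.
Import numFieldNormedType.Exports.

Local Open Scope classical_set_scope.
Local Open Scope ring_scope.
Local Open Scope quotient_scope.

Definition unitI (R : realType) : Type := set_type `[0 : R, 1]%classic.

HB.instance Definition _ (R : realType) :=
  Topological.copy (unitI R) (set_type `[0 : R, 1]%classic).

Section UnitInterval.
Context {R : realType}.

Definition uval (s : unitI R) : R := \val s.

Lemma uvalP (s : unitI R) : 0 <= uval s <= 1.
Proof. by have := set_valP s; rewrite /= in_itv. Qed.

Lemma uval_inj : injective uval.
Proof. exact: val_inj. Qed.

Lemma uval_continuous : continuous uval.
Proof. exact: initial_continuous. Qed.

Lemma clamp_subproof (r : R) : Num.max 0 (Num.min 1 r) \in `[0 : R, 1]%classic.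
Proof.
rewrite inE /= in_itv /=; apply/andP; split; first by rewrite le_max lexx.
by rewrite ge_max ler01 ge_min lexx.
Qed.

(* The retraction of the line onto the unit interval. It lets paths be
   reparametrized by arbitrary real-valued expressions. *)
Definition clamp (r : R) : unitI R := 
  exist (fun x => x \in `[0 : R, 1]%classic) _ (clamp_subproof r).

Lemma uval_clamp r : uval (clamp r) = Num.max 0 (Num.min 1 r).
Proof. by []. Qed.

Lemma clamp_id r : 0 <= r <= 1 -> uval (clamp r) = r.
Proof.
by move=> /andP[r0 r1]; rewrite uval_clamp (min_idPr r1) (max_idPr r0).
Qed.

Lemma clampK s : clamp (uval s) = s.
Proof. by apply: uval_inj; rewrite clamp_id ?uvalP. Qed.

Lemma clamp_le0 r : r <= 0 -> clamp r = clamp 0.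
Proof.
move=> r0; apply: uval_inj; rewrite !uval_clamp (min_idPr ler01) maxxx.
by rewrite (min_idPr (le_trans r0 ler01)) (max_idPl r0).
Qed.

Lemma clamp_ge1 r : 1 <= r -> clamp r = clamp 1.
Proof. by move=> r1; apply: uval_inj; rewrite !uval_clamp (min_idPl r1) minxx. Qed.

Lemma clamp_continuous : continuous clamp.
Proof.
apply: continuous_comp_initial => r.
apply: (@continuous_max R R (fun=> 0) (fun r => Num.min 1 r) r).
  exact: cst_continuous.
apply: (@continuous_min R R (fun=> 1) id r) => //; exact: cst_continuous.
Qed.

Lemma clamp0_neq1 : clamp 0 != clamp 1.
Proof.
apply/eqP => /(congr1 uval).
by rewrite !clamp_id ?lexx ?ler01 // => /eqP; rewrite eq_sym oner_eq0.
Qed.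

End UnitInterval.

HB.instance Definition _ (R : realType) :=
  @isBiPointed.Build (unitI R) (clamp 0) (clamp 1) clamp0_neq1.


Lemma unitI_zero (R : realType) : uval (zero : unitI R) = 0.
Proof. by rewrite clamp_id ?lexx ?ler01. Qed.

Lemma unitI_one (R : realType) : uval (one : unitI R) = 1.
Proof. by rewrite clamp_id ?lexx ?ler01. Qed.

Section Homotopy.
Context {R : realType} {X : topologicalType}.
Local Notation I := (unitI R).

(* Homotopy relative to the endpoints: the first coordinate of [H] is the path
   parameter and the second one is the time. *)
Definition homotopic (x y : X) (p q : {path I from x to y}) : Prop :=
  exists H : I * I -> X, [/\ continuous H,
    forall s, H (s, zero) = p s, forall s, H (s, one) = q s,
    forall t, H (zero, t) = x & forall t, H (one, t) = y].

Lemma continuous_if_le (T Y : topologicalType) (h : T -> R) (c : R)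
    (f g : T -> Y) : continuous h -> continuous f -> continuous g ->
  (forall x, h x = c -> f x = g x) ->
  continuous (fun x => if h x <= c then f x else g x).
Proof.
move=> ch cf cg fg; apply/continuous_closedP => C cC.
have -> : (fun x => if h x <= c then f x else g x) @^-1` C =
    (h @^-1` [set r | r <= c] `&` f @^-1` C) `|`
    (h @^-1` [set r | c <= r] `&` g @^-1` C).
  apply/seteqP; split=> x /=; case: (leP (h x) c) => hx.
  - by left.
  - by right; split=> //; exact: ltW.
  - move=> [[]//|[hx' Cx]]; rewrite fg //.
    by apply/eqP; rewrite eq_le hx hx'.
  - by move=> [[]|[]].
apply: closedU; apply: closedI.
- by move/continuous_closedP : ch; apply; exact: closed_le.
- by move/continuous_closedP : cf; apply.
- by move/continuous_closedP : ch; apply; exact: closed_ge.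
- by move/continuous_closedP : cg; apply.
Qed.

Lemma path_cts (x y : X) (p : {path I from x to y}) : continuous p.
Proof. exact: cts_fun. Qed.
Arguments path_cts {x y} p.

Lemma comp_cts (S T U : topologicalType) (f : S -> T) (g : T -> U) :
  continuous f -> continuous g -> continuous (g \o f).
Proof. by move=> cf cg s; apply: continuous_comp; [exact: cf|exact: cg]. Qed.

Lemma pair_cts (S T U : topologicalType) (f : S -> T) (g : S -> U) :
  continuous f -> continuous g -> continuous (fun s => (f s, g s)).
Proof. by move=> cf cg s; apply: cvg_pair; [exact: cf|exact: cg]. Qed.

Lemma fst_cts (S T : topologicalType) : continuous (@fst S T).
Proof. by move=> ?; exact: cvg_fst. Qed.

Lemma snd_cts (S T : topologicalType) : continuous (@snd S T).
Proof. by move=> ?; exact: cvg_snd. Qed.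

Lemma scale_cts (T : topologicalType) (h : T -> R) (a : R) : continuous h ->
  continuous (fun t => a * h t).
Proof. by move=> ch t; apply: cvgM; [exact: cvg_cst|exact: ch]. Qed.

Lemma shift_cts (T : topologicalType) (h : T -> R) (a : R) : continuous h ->
  continuous (fun t => h t + a).
Proof. by move=> ch t; apply: cvgD; [exact: ch|exact: cvg_cst]. Qed.

Lemma sub_cts (T : topologicalType) (h : T -> R) (a : R) : continuous h ->
  continuous (fun t => a - h t).
Proof. by move=> ch t; apply: cvgB; [exact: cvg_cst|exact: ch]. Qed.

Lemma homotopic_reparam (f : I -> X) (phi psi : I -> R) (x y : X)
    (p q : {path I from x to y}) :
  continuous f -> continuous phi -> continuous psi ->
  phi zero = psi zero -> phi one = psi one ->
  (forall s, p s = f (clamp (phi s))) -> (forall s, q s = f (clamp (psi s))) ->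
  homotopic p q.
Proof.
move=> cf cphi cpsi e0 e1 pE qE.
exists (fun st => f (clamp ((1 - uval st.2) * phi st.1 + uval st.2 * psi st.1))).
have cu : continuous (fun st : I * I => uval st.2).
  exact: (comp_cts (@snd_cts I I) uval_continuous).
split.
- apply: (comp_cts _ cf); apply: (comp_cts _ clamp_continuous) => st.
  apply: cvgD; apply: cvgM.
  + by apply: cvgB; [exact: cvg_cst|exact: cu].
  + exact: (comp_cts (@fst_cts I I) cphi).
  + exact: cu.
  + exact: (comp_cts (@fst_cts I I) cpsi).
- by move=> s /=; rewrite pE unitI_zero subr0 mul1r mul0r addr0.
- by move=> s /=; rewrite qE unitI_one subrr mul1r mul0r add0r.
- by move=> t /=; rewrite -e0 -mulrDl subrK mul1r -pE path_zero.
- by move=> t /=; rewrite -e1 -mulrDl subrK mul1r -pE path_one.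
Qed.

Lemma homotopic_refl (x y : X) (p : {path I from x to y}) : homotopic p p.
Proof.
apply: (@homotopic_reparam p uval uval) => //; first exact: path_cts.
- exact: uval_continuous.
- exact: uval_continuous.
- by move=> s; rewrite clampK.
- by move=> s; rewrite clampK.
Qed.

Lemma clamp_opp_zero : clamp (1 - uval (zero : I)) = one :> I.
Proof. by rewrite unitI_zero subr0. Qed.

Lemma clamp_opp_one : clamp (1 - uval (one : I)) = zero :> I.
Proof. by rewrite unitI_one subrr. Qed.

Lemma opp_cts : continuous (fun s : I => clamp (1 - uval s)).
Proof.
apply: (comp_cts _ clamp_continuous); apply: sub_cts; exact: uval_continuous.
Qed.

Lemma homotopic_sym (x y : X) (p q : {path I from x to y}) :
  homotopic p q -> homotopic q p.
Proof.
move=> [H [cH H0 H1 Hx Hy]]; exists (fun st => H (st.1, clamp (1 - uval st.2))).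
split.
- apply: comp_cts cH; apply: pair_cts; first exact: fst_cts.
  exact: (comp_cts (@snd_cts I I) opp_cts).
- by move=> s; rewrite clamp_opp_zero H1.
- by move=> s; rewrite clamp_opp_one H0.
- by move=> t; rewrite Hx.
- by move=> t; rewrite Hy.
Qed.

Definition half1 (s : I) : I := clamp (2 * uval s).
Definition half2 (s : I) : I := clamp (2 * uval s - 1).

Lemma half1_cts : continuous half1.
Proof.
by apply: (comp_cts _ clamp_continuous); apply: scale_cts; exact: uval_continuous.
Qed.

Lemma half2_cts : continuous half2.
Proof.
apply: (comp_cts _ clamp_continuous); apply: shift_cts; apply: scale_cts.
exact: uval_continuous.
Qed.

Lemma half1_zero : half1 zero = zero.
Proof. by rewrite /half1 unitI_zero mulr0. Qed.

Lemma half2_one : half2 one = one.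
Proof. by rewrite /half2 unitI_one; congr clamp; lra. Qed.

Lemma half1_mid s : uval s = 2^-1 -> half1 s = one.
Proof. by rewrite /half1 => ->; rewrite divff. Qed.

Lemma half2_mid s : uval s = 2^-1 -> half2 s = zero.
Proof. by rewrite /half2 => ->; rewrite divff // subrr. Qed.

Lemma half_zero : (uval (zero : I) <= 2^-1) = true.
Proof. by rewrite unitI_zero invr_ge0 ler0n. Qed.

Lemma half_one : (uval (one : I) <= 2^-1) = false.
Proof. by rewrite unitI_one; apply/negbTE; rewrite -ltNge; lra. Qed.

Lemma homotopic_trans (x y : X) (p q r : {path I from x to y}) :
  homotopic p q -> homotopic q r -> homotopic p r.
Proof.
move=> [H [cH H0 H1 Hx Hy]] [K [cK K0 K1 Kx Ky]].
exists (fun st => if uval st.2 <= 2^-1 then H (st.1, half1 st.2)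
                  else K (st.1, half2 st.2)); split.
- apply: continuous_if_le.
  + exact: (comp_cts (@snd_cts I I) uval_continuous).
  + apply: comp_cts cH; apply: pair_cts; first exact: fst_cts.
    exact: (comp_cts (@snd_cts I I) half1_cts).
  + apply: comp_cts cK; apply: pair_cts; first exact: fst_cts.
    exact: (comp_cts (@snd_cts I I) half2_cts).
  + by move=> [s t] /= tE; rewrite half1_mid // half2_mid // H1 K0.
- by move=> s /=; rewrite half_zero half1_zero H0.
- by move=> s /=; rewrite half_one half2_one K1.
- by move=> t /=; rewrite Hx Kx if_same.
- by move=> t /=; rewrite Hy Ky if_same.
Qed.

Section Concatenation.
Context {x y z : X} (p : {path I from x to y}) (q : {path I from y to z}).

Definition path_cat_fun (s : I) : X :=
  if uval s <= 2^-1 then p (clamp (2 * uval s)) else q (clamp (2 * uval s - 1)).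

Lemma path_cat_cts : continuous path_cat_fun.
Proof.
apply: continuous_if_le; first exact: uval_continuous.
- exact: (comp_cts half1_cts (path_cts p)).
- exact: (comp_cts half2_cts (path_cts q)).
- move=> s sE; rewrite -/(half1 s) -/(half2 s) half1_mid // half2_mid //.
  by rewrite path_zero path_one.
Qed.

Lemma path_cat_zero : path_cat_fun zero = x.
Proof. by rewrite /path_cat_fun half_zero -/(half1 _) half1_zero path_zero. Qed.

Lemma path_cat_one : path_cat_fun one = z.
Proof. by rewrite /path_cat_fun half_one -/(half2 _) half2_one path_one. Qed.

Definition path_cat : {path I from x to z} := mk_path path_cat_cts path_cat_zero path_cat_one.

Lemma path_catE s : path_cat s = if uval s <= 2^-1 then p (clamp (2 * uval s))
                         else q (clamp (2 * uval s - 1)).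
Proof. by []. Qed.

End Concatenation.

Section Reversal.
Context {x y : X} (p : {path I from x to y}).

Definition path_rev_fun (s : I) : X := p (clamp (1 - uval s)).

Lemma path_rev_cts : continuous path_rev_fun.
Proof. exact: (comp_cts opp_cts (path_cts p)). Qed.

Lemma path_rev_zero : path_rev_fun zero = y.
Proof. by rewrite /path_rev_fun clamp_opp_zero path_one. Qed.

Lemma path_rev_one : path_rev_fun one = x.
Proof. by rewrite /path_rev_fun clamp_opp_one path_zero. Qed.

Definition path_rev : {path I from y to x} := mk_path path_rev_cts path_rev_zero path_rev_one.

Lemma path_revE s : path_rev s = p (clamp (1 - uval s)).
Proof. by []. Qed.

End Reversal.

Definition path_cst (x : X) : {path I from x to x} := (cst x : I -> X).

Lemma path_cstE x s : path_cst x s = x.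
Proof. by []. Qed.

Lemma homotopic_cat (x y z : X) (p p' : {path I from x to y})
    (q q' : {path I from y to z}) :
  homotopic p p' -> homotopic q q' -> homotopic (path_cat p q) (path_cat p' q').
Proof.
move=> [H [cH H0 H1 Hx Hy]] [K [cK K0 K1 Kx Ky]].
exists (fun st => if uval st.1 <= 2^-1 then H (half1 st.1, st.2)
                  else K (half2 st.1, st.2)); split.
- apply: continuous_if_le.
  + exact: (comp_cts (@fst_cts I I) uval_continuous).
  + apply: comp_cts cH; apply: pair_cts; last exact: snd_cts.
    exact: (comp_cts (@fst_cts I I) half1_cts).
  + apply: comp_cts cK; apply: pair_cts; last exact: snd_cts.
    exact: (comp_cts (@fst_cts I I) half2_cts).
  + by move=> [s t] /= sE; rewrite half1_mid // half2_mid // Hy Kx.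
- by move=> s; rewrite path_catE /= H0 K0.
- by move=> s; rewrite path_catE /= H1 K1.
- by move=> t /=; rewrite half_zero half1_zero Hx.
- by move=> t /=; rewrite half_one half2_one Ky.
Qed.

Lemma homotopic_rev (x y : X) (p q : {path I from x to y}) :
  homotopic p q -> homotopic (path_rev p) (path_rev q).
Proof.
move=> [H [cH H0 H1 Hx Hy]]; exists (fun st => H (clamp (1 - uval st.1), st.2)).
split.
- apply: comp_cts cH; apply: pair_cts; last exact: snd_cts.
  exact: (comp_cts (@fst_cts I I) opp_cts).
- by move=> s; rewrite path_revE H0.
- by move=> s; rewrite path_revE H1.
- by move=> t; rewrite clamp_opp_zero Hy.
- by move=> t; rewrite clamp_opp_one Hx.
Qed.

Lemma min_cts (T : topologicalType) (f g : T -> R) :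
  continuous f -> continuous g -> continuous (fun t => Num.min (f t) (g t)).
Proof. by move=> cf cg t; apply: continuous_min; [exact: cf|exact: cg]. Qed.

Lemma max_cts (T : topologicalType) (f g : T -> R) :
  continuous f -> continuous g -> continuous (fun t => Num.max (f t) (g t)).
Proof. by move=> cf cg t; apply: continuous_max; [exact: cf|exact: cg]. Qed.

Lemma homotopic_catA (x y z w : X) (p : {path I from x to y})
    (q : {path I from y to z}) (r : {path I from z to w}) :
  homotopic (path_cat p (path_cat q r)) (path_cat (path_cat p q) r).
Proof.
pose phi (s : I) : R :=
  Num.min (2 * uval s) (Num.min (uval s + 4^-1) (2^-1 * uval s + 2^-1)).
apply: (@homotopic_reparam (path_cat p (path_cat q r)) uval phi).
- exact: path_cts.
- exact: uval_continuous.
- apply: min_cts; first by apply: scale_cts; exact: uval_continuous.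
  apply: min_cts; apply: shift_cts; first exact: uval_continuous.
  by apply: scale_cts; exact: uval_continuous.
- rewrite /phi unitI_zero (min_idPl _); first lra.
  by rewrite le_min; apply/andP; split; lra.
- rewrite /phi unitI_one (@min_idPr _ _ (1 + 4^-1) _ _); last lra.
  by rewrite (min_idPr _); lra.
- by move=> s; rewrite clampK.
- move=> s; have /andP[s0 s1] := uvalP s.
  have phi01 : 0 <= phi s <= 1.
    rewrite /phi !le_min !ge_min; have -> : 2^-1 * uval s + 2^-1 <= 1 by lra.
    by rewrite !orbT andbT; do 2?[apply/andP; split]; lra.
  rewrite !path_catE (clamp_id phi01); case: (leP (uval s) 2^-1) => s2.
    have h1 : 0 <= 2 * uval s <= 1 by lra.
    rewrite (clamp_id h1); case: (leP (2 * uval s) 2^-1) => s4.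
      have -> : phi s = 2 * uval s.
        by apply: min_idPl; rewrite le_min; apply/andP; split; lra.
      by rewrite s4.
    have -> : phi s = uval s + 4^-1.
      rewrite /phi (@min_idPl _ _ (uval s + 4^-1) _ _); last lra.
      by apply: min_idPr; lra.
    rewrite ifF; last by apply/negbTE; rewrite -ltNge; lra.
    rewrite clamp_id; last lra.
    rewrite ifT; last lra.
    by congr (q (clamp _)); lra.
  have -> : phi s = 2^-1 * uval s + 2^-1.
    rewrite /phi (@min_idPr _ _ (uval s + 4^-1) _ _); last lra.
    by apply: min_idPr; lra.
  rewrite ifF; last by apply/negbTE; rewrite -ltNge; lra.
  rewrite clamp_id; last lra.
  rewrite ifF; last by apply/negbTE; rewrite -ltNge; lra.
  by congr (r (clamp _)); lra.
Qed.

Lemma homotopic_cat1p (x y : X) (p : {path I from x to y}) :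
  homotopic (path_cat (path_cst x) p) p.
Proof.
apply: (@homotopic_reparam p (fun s => Num.max 0 (2 * uval s - 1)) uval).
- exact: path_cts.
- apply: max_cts; first by move=> ?; exact: cst_continuous.
  by apply: shift_cts; apply: scale_cts; exact: uval_continuous.
- exact: uval_continuous.
- by rewrite unitI_zero; case: leP; lra.
- by rewrite unitI_one; case: leP; lra.
- move=> s; rewrite path_catE; case: (leP (uval s) 2^-1) => s2.
    by rewrite path_cstE (max_idPl _) ?path_zero //; lra.
  by rewrite (max_idPr _) //; lra.
- by move=> s; rewrite clampK.
Qed.

Lemma homotopic_catp1 (x y : X) (p : {path I from x to y}) :
  homotopic (path_cat p (path_cst y)) p.
Proof.
apply: (@homotopic_reparam p (fun s => Num.min (2 * uval s) 1) uval).
- exact: path_cts.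
- apply: min_cts; last by move=> ?; exact: cst_continuous.
  by apply: scale_cts; exact: uval_continuous.
- exact: uval_continuous.
- by rewrite unitI_zero; case: leP; lra.
- by rewrite unitI_one; case: leP; lra.
- move=> s; rewrite path_catE; case: (leP (uval s) 2^-1) => s2.
    by rewrite (min_idPl _) //; lra.
  by rewrite path_cstE (min_idPr _) ?path_one //; lra.
- by move=> s; rewrite clampK.
Qed.

Lemma homotopic_catpV (x y : X) (p : {path I from x to y}) :
  homotopic (path_cat p (path_rev p)) (path_cst x).
Proof.
apply: (@homotopic_reparam p
  (fun s => Num.min (2 * uval s) (2 - 2 * uval s)) (fun=> 0)).
- exact: path_cts.
- apply: min_cts; first by apply: scale_cts; exact: uval_continuous.
  by apply: sub_cts; apply: scale_cts; exact: uval_continuous.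
- by move=> ?; exact: cst_continuous.
- by rewrite unitI_zero; case: leP; lra.
- by rewrite unitI_one; case: leP; lra.
- move=> s; have /andP[s0 s1] := uvalP s.
  rewrite path_catE; case: (leP (uval s) 2^-1) => s2.
    by rewrite (min_idPl _) //; lra.
  rewrite path_revE clamp_id; last lra.
  rewrite (min_idPr _); last lra.
  by congr (p (clamp _)); lra.
- by move=> s; rewrite path_cstE path_zero.
Qed.

Lemma homotopic_catVp (x y : X) (p : {path I from x to y}) :
  homotopic (path_cat (path_rev p) p) (path_cst y).
Proof.
apply: (@homotopic_reparam p
  (fun s => Num.max (1 - 2 * uval s) (2 * uval s - 1)) (fun=> 1)).
- exact: path_cts.
- apply: max_cts.
    by apply: sub_cts; apply: scale_cts; exact: uval_continuous.
  by apply: shift_cts; apply: scale_cts; exact: uval_continuous.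
- by move=> ?; exact: cst_continuous.
- by rewrite unitI_zero; case: leP; lra.
- by rewrite unitI_one; case: leP; lra.
- move=> s; have /andP[s0 s1] := uvalP s.
  rewrite path_catE; case: (leP (uval s) 2^-1) => s2.
    rewrite path_revE clamp_id; last lra.
    by rewrite (max_idPl _) //; lra.
  by rewrite (max_idPr _) //; lra.
- by move=> s; rewrite path_cstE path_one.
Qed.

End Homotopy.

Section FundamentalGroup.
Context {R : realType} {X : topologicalType} (x : X).
Local Notation loop := {path (unitI R) from x to x}.

Definition homotopic_rel : rel loop := fun p q => `[< homotopic p q >].

Lemma homotopic_rel_refl : reflexive homotopic_rel.
Proof. by move=> p; apply/asboolP; exact: homotopic_refl. Qed.

Lemma homotopic_rel_sym : symmetric homotopic_rel.
Proof. by move=> p q; apply/asbool_equiv_eq; split; exact: homotopic_sym. Qed.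

Lemma homotopic_rel_trans : transitive homotopic_rel.
Proof.
move=> q p r /asboolP pq /asboolP qr; apply/asboolP.
exact: homotopic_trans pq qr.
Qed.

Canonical homotopic_equiv :=
  EquivRel homotopic_rel homotopic_rel_refl homotopic_rel_sym homotopic_rel_trans.

Definition pi1 : Type := {eq_quot homotopic_equiv}.

HB.instance Definition _ := Quotient.copy pi1 {eq_quot homotopic_equiv}.
HB.instance Definition _ := Choice.copy pi1 {eq_quot homotopic_equiv}.

Definition loop_class (p : loop) : pi1 := \pi_pi1 p.

Lemma loop_classP (p q : loop) : loop_class p = loop_class q <-> homotopic p q.
Proof.
split=> [/(@eqmodP _ homotopic_equiv)|pq]; first by move/asboolP.
by apply/(@eqmodP _ homotopic_equiv); exact/asboolP.
Qed.

Lemma loop_class_repr (u : pi1) : loop_class (repr u) = u.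
Proof. exact: reprK. Qed.

Lemma repr_loop_class (p : loop) : homotopic (repr (loop_class p)) p.
Proof. by apply/loop_classP; rewrite loop_class_repr. Qed.

Definition pi1_one : pi1 := loop_class (path_cst x).
Definition pi1_mul (u v : pi1) : pi1 := loop_class (path_cat (repr u) (repr v)).
Definition pi1_inv (u : pi1) : pi1 := loop_class (path_rev (repr u)).

Lemma pi1_mulE (p q : loop) :
  pi1_mul (loop_class p) (loop_class q) = loop_class (path_cat p q).
Proof.
by apply/loop_classP; apply: homotopic_cat; exact: repr_loop_class.
Qed.

Lemma pi1_invE (p : loop) : pi1_inv (loop_class p) = loop_class (path_rev p).
Proof. by apply/loop_classP; apply: homotopic_rev; exact: repr_loop_class. Qed.

Lemma pi1_mulA : associative pi1_mul.
Proof.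
move=> u v w; rewrite -(loop_class_repr u) -(loop_class_repr v).
rewrite -(loop_class_repr w) !pi1_mulE; apply/loop_classP.
exact: homotopic_catA.
Qed.

Lemma pi1_mul1u : left_id pi1_one pi1_mul.
Proof.
move=> u; rewrite -(loop_class_repr u) pi1_mulE; apply/loop_classP.
exact: homotopic_cat1p.
Qed.

Lemma pi1_mulu1 : right_id pi1_one pi1_mul.
Proof.
move=> u; rewrite -(loop_class_repr u) pi1_mulE; apply/loop_classP.
exact: homotopic_catp1.
Qed.

Lemma pi1_mulVu : left_inverse pi1_one pi1_inv pi1_mul.
Proof.
move=> u; rewrite -(loop_class_repr u) pi1_invE pi1_mulE; apply/loop_classP.
exact: homotopic_catVp.
Qed.

Lemma pi1_muluV : right_inverse pi1_one pi1_inv pi1_mul.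
Proof.
move=> u; rewrite -(loop_class_repr u) pi1_invE pi1_mulE; apply/loop_classP.
exact: homotopic_catpV.
Qed.

HB.instance Definition _ :=
  isGroup.Build pi1 pi1_mulA pi1_mul1u pi1_mulu1 pi1_mulVu pi1_muluV.

End FundamentalGroup.

Arguments pi1 R {X} x.

Section Surface.
Context (R : realType) (g : nat).

Definition disc : Type := set_type [set p : R * R | p.1 ^+ 2 + p.2 ^+ 2 <= 1].

HB.instance Definition _ := Topological.copy disc
  (set_type [set p : R * R | p.1 ^+ 2 + p.2 ^+ 2 <= 1]).

Definition disc_val (p : disc) : R * R := \val p.

(* The disc is seen as a polygon with [4 * g] sides: the [k]-th side is the
   [k]-th of the [4 * g] arcs of equal length that divide the unit circle,
   parametrized counterclockwise by [t] in [0, 1]. *)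
Definition side (k : nat) (t : R) : R * R :=
  let theta := 2 * pi * (k%:R + t) / (4 * g)%N%:R in (cos theta, sin theta).

(* Reading the labels of the sides counterclockwise gives the product of the
   commutators a_i b_i a_i^-1 b_i^-1 for i < g: a side with an inverse label is
   glued with the orientation reversed. *)
Inductive side_pairing (p q : disc) : Prop :=
| Pair_a (i : nat) (t : R) of (i < g)%N & 0 <= t <= 1 &
    disc_val p = side (4 * i)%N t & disc_val q = side (4 * i + 2)%N (1 - t)
| Pair_b (i : nat) (t : R) of (i < g)%N & 0 <= t <= 1 &
    disc_val p = side (4 * i + 1)%N t & disc_val q = side (4 * i + 3)%N (1 - t).

Definition glued : rel disc :=
  fun p q => `[< clos_refl_sym_trans disc side_pairing p q >].

Lemma glued_refl : reflexive glued.
Proof. by move=> p; apply/asboolP; exact: rst_refl. Qed.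

Lemma glued_sym : symmetric glued.
Proof. by move=> p q; apply/asbool_equiv_eq; split; exact: rst_sym. Qed.

Lemma glued_trans : transitive glued.
Proof.
move=> q p r /asboolP pq /asboolP qr; apply/asboolP.
exact: rst_trans pq qr.
Qed.

Canonical glued_equiv := EquivRel glued glued_refl glued_sym glued_trans.

(* The closed orientable surface of genus [g], for [g >= 1] (without any side
   to glue, [g = 0] gives a disc instead of a sphere) *)
Definition surface : Type := quotient_topology {eq_quot glued_equiv}.

HB.instance Definition _ := Quotient.copy surface {eq_quot glued_equiv}.
HB.instance Definition _ := Topological.copy surface
  (quotient_topology {eq_quot glued_equiv}).

End Surface.

Record Sinf := MkSinf { Sinf_fun :> int -> int; Sinf_bij : bijective Sinf_fun }.

HB.instance Definition _ := gen_eqMixin Sinf.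
HB.instance Definition _ := gen_choiceMixin Sinf.

Lemma SinfP (u v : Sinf) : u =1 v -> u = v.
Proof.
case: u v => [f bf] [h bh] /= /funext fh; rewrite fh in bf *.
by rewrite (Prop_irrelevance bf bh).
Qed.

Lemma id_bij : bijective (@id int).
Proof. by exists id. Qed.

Definition Sinf_one : Sinf := MkSinf id_bij.
Definition Sinf_mul (u v : Sinf) : Sinf :=
  MkSinf (bij_comp (Sinf_bij u) (Sinf_bij v)).

Lemma Sinf_inv_ex (u : Sinf) : exists v : Sinf, cancel u v /\ cancel v u.
Proof.
have [h uK hK] := Sinf_bij u; have bh : bijective h by exists u.
by exists (MkSinf bh).
Qed.

Definition Sinf_inv (u : Sinf) : Sinf := projT1 (cid (Sinf_inv_ex u)).

Lemma Sinf_invK (u : Sinf) : cancel u (Sinf_inv u).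
Proof. by case: (projT2 (cid (Sinf_inv_ex u))). Qed.

Lemma Sinf_invVK (u : Sinf) : cancel (Sinf_inv u) u.
Proof. by case: (projT2 (cid (Sinf_inv_ex u))). Qed.

Lemma Sinf_mulA : associative Sinf_mul.
Proof. by move=> u v w; apply: SinfP. Qed.

Lemma Sinf_mul1u : left_id Sinf_one Sinf_mul.
Proof. by move=> u; apply: SinfP. Qed.

Lemma Sinf_mulu1 : right_id Sinf_one Sinf_mul.
Proof. by move=> u; apply: SinfP. Qed.

Lemma Sinf_mulVu : left_inverse Sinf_one Sinf_inv Sinf_mul.
Proof. by move=> u; apply: SinfP => k /=; exact: Sinf_invK. Qed.

Lemma Sinf_muluV : right_inverse Sinf_one Sinf_inv Sinf_mul.
Proof. by move=> u; apply: SinfP => k /=; exact: Sinf_invVK. Qed.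

HB.instance Definition _ :=
  isGroup.Build Sinf Sinf_mulA Sinf_mul1u Sinf_mulu1 Sinf_mulVu Sinf_muluV.

HB.instance Definition _ := isPointed.Build Sinf Sinf_one.

Definition Sinf_basic (un : Sinf * nat) : set Sinf :=
  [set v | forall k : int, `|k| <= un.2%:Z -> v k = un.1 k].

Lemma Sinf_basic_cover : \bigcup_(un in [set: Sinf * nat]) Sinf_basic un = setT.
Proof. by apply/seteqP; split=> // u _; exists (u, 0%N). Qed.

Lemma Sinf_basic_join (un vm : Sinf * nat) (w : Sinf) :
  setT un -> setT vm -> Sinf_basic un w -> Sinf_basic vm w ->
  exists wl, [/\ setT wl, Sinf_basic wl w &
    Sinf_basic wl `<=` Sinf_basic un `&` Sinf_basic vm].
Proof.
move=> _ _ unw vmw; exists (w, maxn un.2 vm.2); split=> // w' w'E.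
split=> k km.
- rewrite -unw // w'E //= (le_trans km) // lez_nat leq_maxl //.
- rewrite -vmw // w'E //= (le_trans km) // lez_nat leq_maxr //.
Qed.

HB.instance Definition _ :=
  isBaseTopological.Build Sinf Sinf_basic_cover Sinf_basic_join.

Definition is_subgroup (G : groupType) (H : set G) : Prop :=
  group_closed (mem H).

Definition isomorphic_onto (G K : groupType) (H : set K) : Prop :=
  exists f : {multiplicative G -> K}, set_bij [set: G] H f.

(* Main.v *)
Require Import Defs.
From HB Require Import structures.
From Stdlib Require Import Relation_Operators.
From mathcomp Require Import all_boot all_order all_algebra.
From mathcomp Require Import all_classical all_reals all_analysis.
From mathcomp Require Import homotopy lra zify ring.

(* The surface is covered by the open disc and by the stars of the vertex and
   of the midpoints of the edges. Each of these charts contracts inside itself,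
   so that every path is locally homotopic to the image of a path of the disc:
   the fundamental group is generated by the loops that cross one side, and
   turning around the vertex gives the relation between them. Conversely,
   elements of a group G that satisfy the relation define a G-covering of the
   surface, whose monodromy is the required morphism to G.

   Let t be the inverse of the first b and H the subgroup generated by the other
   generators, so that t conjugates a (the first a) to some c in H. Let H act by
   translations on the union of countably many copies of the whole group. Any
   bijection of this set that carries the action of a to that of c extends the
   action of H to the surface group. Such a bijection is built by back and
   forth, one a-line to one c-line at a time. Given two tuples of distinct
   points, a large power of d = b_1 moves them to distinct lines on which
   nothing is prescribed yet (this is seen in a Heisenberg quotient of the
   group), so that the first tuple can be sent to the second; a reduced word
   can be made to move a point by following its trajectory through unused
   copies. The resulting action is highly transitive and faithful. *)

(** Both [a] and [c] have infinite order, so one value of the bijection at a point of an [a]-line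
    fixes it on the whole line, and any [a]-line may be sent onto any [c]-line. Values can be
    prescribed freely only at points on distinct lines, hence the preliminary displacement by a
    power of [d]. An abelian quotient could not certify it: there the images of [d ^ m * u] and
    [d ^ m * a ^ j * u] always stay on one line. In the Heisenberg group the commutator of [a] and
    [d] adds a central coordinate that grows with [m] and separates them. This requires [a] and [c]
    to map to one generator and [d] to the other; the second handle, present since g >= 2, provides
    such a [d] inside H. The topology reaches the group theory through three facts only: the
    relation, generation, and the extension to a morphism of any assignment of the generators that
    satisfies the relation. That a nonempty reduced word is not the identity is not presupposed: it
    is a consequence of the action. *)

Set Implicit Arguments.
Unset Strict Implicit.
Unset Printing Implicit Defensive.

Import Order.TTheory GRing.Theory Num.Theory.
Import numFieldNormedType.Exports.

Local Open Scope classical_set_scope.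
Local Open Scope ring_scope.
Local Open Scope quotient_scope.

(** * Coverings given by transition functions, and their monodromy *)

Section Interval.
Context {R : realType}.
Local Notation I := (unitI R).

(** Connectedness of the interval in the form of an induction principle; it stands in for every
    subdivision of a path into small pieces. *)
Lemma clopen_unitI (A : set I) (s0 : I) : A s0 ->
  (forall s, \forall u \near s, A s <-> A u) -> forall s, A s.
Proof.
move=> As0 Aloc.
have oA : open A.
  rewrite openE => s As; apply: filterS (Aloc s) => u; tauto.
have cA : closed A.
  rewrite -[A]setCK; apply: open_closedC.
  rewrite openE => s nAs; apply: filterS (Aloc s) => u /= AE Au; apply: nAs; tauto.
have cI : connected [set: I].
  have -> : [set: I] = clamp @` `[(0:R), 1]%classic.
    apply/esym/seteqP; split=> // s _; exists (uval s); last exact: clampK.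
    by rewrite /= in_itv /= uvalP.
  apply: connected_continuous_connected; first exact: segment_connected.
  exact/continuous_subspaceT/clamp_continuous.
have AT : A = [set: I].
  apply: cI; [by exists s0| by exists A => //; rewrite setTI| by exists A => //; rewrite setTI].
by move=> s; rewrite AT.
Qed.

Lemma near_unitI (s : I) (P : set I) : (\forall u \near s, P u) ->
  exists2 e : R, 0 < e & forall u, `|uval u - uval s| < e -> P u.
Proof.
move=> Ps.
have : \forall r \near uval s, P (clamp r).
  by apply: clamp_continuous; rewrite clampK.
move=> /nbhs_ballP[e e0 He]; exists e => // u us.
by rewrite -(clampK u); apply: He; rewrite /ball /= distrC.
Qed.

Lemma unitI_near (s : I) (e : R) : 0 < e ->
  \forall u \near s, `|uval u - uval s| < e.
Proof.
move=> e0; have /(_ [set r | `|r - uval s| < e]) := @uval_continuous R s.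
apply; apply/nbhs_ballP; exists e => // r; by rewrite /ball /= distrC.
Qed.

Definition seg (a b s : I) : I := clamp ((uval b - uval a) * uval s + uval a).

Lemma uval_seg a b s : uval (seg a b s) = (uval b - uval a) * uval s + uval a.
Proof.
rewrite clamp_id //; have /andP[? ?] := uvalP a; have /andP[? ?] := uvalP b.
have /andP[? ?] := uvalP s; apply/andP; split; nra.
Qed.

Lemma seg_cts a b : continuous (seg a b).
Proof.
apply: (comp_cts _ clamp_continuous); apply: shift_cts; apply: scale_cts.
exact: uval_continuous.
Qed.

Lemma seg0 a b : seg a b zero = a.
Proof. by apply: uval_inj; rewrite uval_seg unitI_zero; ring. Qed.

Lemma seg1 a b : seg a b one = b.
Proof. by apply: uval_inj; rewrite uval_seg unitI_one; ring. Qed.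

Lemma seg_near (a b c s : I) (e : R) : `|uval a - uval c| < e ->
  `|uval b - uval c| < e -> `|uval (seg a b s) - uval c| < e.
Proof.
rewrite uval_seg !ltr_norml => ? ?; have /andP[s0 s1] := uvalP s.
case: (leP (uval a) (uval b)) => ab.
  have ? : (uval b - uval a) * uval s <= uval b - uval a by nra.
  have ? : 0 <= (uval b - uval a) * uval s by nra.
  by lra.
have ? : uval b - uval a <= (uval b - uval a) * uval s by nra.
have ? : (uval b - uval a) * uval s <= 0 by nra.
by lra.
Qed.

End Interval.

(** * Paths as plain functions *)

Section FreePaths.
Context {R : realType} {X : topologicalType}.
Local Notation I := (unitI R).
Implicit Types p q r : I -> X.

Definition pcat p q (s : I) : X :=
  if uval s <= 2^-1 then p (half1 s) else q (half2 s).

Definition revp p (s : I) : X := p (clamp (1 - uval s)).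

Definition htpy p q : Prop :=
  exists H : I * I -> X, [/\ continuous H,
    forall s, H (s, zero) = p s, forall s, H (s, one) = q s,
    forall t, H (zero, t) = p zero & forall t, H (one, t) = p one].

(* A path is a function; its bundled version is only needed to use the groupoid
   laws of [homotopic]. *)
Lemma htpyP p q x y (cp : continuous p) (cq : continuous q)
    (px : p zero = x) (py : p one = y) (qx : q zero = x) (qy : q one = y) :
  htpy p q <-> homotopic (mk_path cp px py) (mk_path cq qx qy).
Proof.
by split=> -[H [cH H0 H1 Hx Hy]]; exists H; split=> // t;
  rewrite ?Hx ?Hy ?px ?py.
Qed.

Lemma pcat_cts p q : continuous p -> continuous q -> p one = q zero ->
  continuous (pcat p q).
Proof.
move=> cp cq pq.
exact: (@path_cat_cts R X _ _ _ (mk_path cp erefl erefl) (mk_path cq (esym pq) erefl)).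
Qed.

Lemma pcat0 p q : pcat p q zero = p zero.
Proof. by rewrite /pcat half_zero half1_zero. Qed.

Lemma pcat1 p q : pcat p q one = q one.
Proof. by rewrite /pcat half_one half2_one. Qed.

Lemma revp_cts p : continuous p -> continuous (revp p).
Proof. by move=> cp; exact: (comp_cts opp_cts cp). Qed.

Lemma revp0 p : revp p zero = p one.
Proof. by rewrite /revp clamp_opp_zero. Qed.

End FreePaths.

(** * Lifts of paths to a covering and their holonomy *)

Section LocalSystem.
Context {R : realType} {X : topologicalType} {G : groupType} {A : Type}.
Context (U : A -> set X) (phi : A -> X -> G).
Local Notation I := (unitI R).
Hypothesis openU : forall a, open (U a).
Hypothesis coverU : forall x, exists a, U a x.
(** The transition functions are given as quotients of the functions [phi a], so the cocycle
    condition is automatic. The [phi a] themselves may jump: only their quotients are locally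
    constant. The sheet of a lift [f] in the chart [a] is [f / phi a]. *)
Hypothesis phi_compat : forall a b x, U a x -> U b x ->
  \forall y \near x, (phi b y / phi a y = phi b x / phi a x)%g.

(* The charts [U] and the transition functions given by [phi] describe a
   [G]-covering of [X]; [f] encodes a lift of [P] to it. *)
Definition lifts (T : topologicalType) (P : T -> X) (f : T -> G) :=
  forall t a, U a (P t) ->
  \forall u \near t, (f u / phi a (P u) = f t / phi a (P t))%g.

(** One chart per point suffices: by [phi_compat] the change to another chart is locally constant
    along [P]. *)
Lemma lifts_chart (T : topologicalType) (P : T -> X) (f : T -> G) :
  continuous P -> (forall t, exists2 a, U a (P t) &
    \forall u \near t, (f u / phi a (P u) = f t / phi a (P t))%g) -> lifts P f.
Proof.
move=> cP H t b Ub; have [a Ua Ha] := H t.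
have Hb := cP t _ (phi_compat Ua Ub).
near=> u; have Hu : (f u / phi a (P u) = f t / phi a (P t))%g by near: u.
have Hu' : (phi b (P u) / phi a (P u) = phi b (P t) / phi a (P t))%g by near: u.
have E x : (f x / phi b (P x) = f x / phi a (P x) * (phi b (P x) / phi a (P x))^-1)%g.
  by rewrite invgM invgK mulgA mulgVK.
by rewrite !E Hu Hu'.
Unshelve. all: by end_near. Qed.

Lemma lifts_comp (T T' : topologicalType) (P : T -> X) (f : T -> G)
    (h : T' -> T) : continuous h -> lifts P f -> lifts (P \o h) (f \o h).
Proof. by move=> ch Pf t a Ua; exact: (ch t _ (Pf (h t) a Ua)). Qed.

Lemma lifts_unique (P : I -> X) (f f' : I -> G) s :
  lifts P f -> lifts P f' -> f s = f' s -> f =1 f'.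
Proof.
move=> Pf Pf' fs; apply: (@clopen_unitI R [set t | f t = f' t] s) => // t.
have [a Ua] := coverU (P t); near=> u.
have Hu : (f u / phi a (P u) = f t / phi a (P t))%g by near: u; exact: Pf.
have Hu' : (f' u / phi a (P u) = f' t / phi a (P t))%g by near: u; exact: Pf'.
split=> /= E; first by apply: (mulIg (phi a (P u))^-1%g); rewrite Hu Hu' E.
by apply: (mulIg (phi a (P t))^-1%g); rewrite -Hu -Hu' E.
Unshelve. all: by end_near. Qed.

Lemma lifts_in_chart (P : I -> X) (f : I -> G) a :
  lifts P f -> (forall s, U a (P s)) ->
  forall s t, (f s / phi a (P s) = f t / phi a (P t))%g.
Proof.
move=> Pf Ua s t.
apply: (@clopen_unitI R
  [set s | (f s / phi a (P s) = f t / phi a (P t))%g] t) => // {}s.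
near=> u.
have -> // : [set s | (f s / phi a (P s) = f t / phi a (P t))%g] u =
          [set s | (f s / phi a (P s) = f t / phi a (P t))%g] s.
rewrite /=; have -> // : (f u / phi a (P u) = f s / phi a (P s))%g.
by near: u; exact: Pf.
Unshelve. all: by end_near. Qed.

Lemma lifts_in_chart_seg (P : I -> X) (f : I -> G) a s t :
  lifts P f -> (forall u, U a (P (seg s t u))) ->
  (f s / phi a (P s) = f t / phi a (P t))%g.
Proof.
move=> Pf Ua; have := lifts_in_chart (lifts_comp (@seg_cts R s t) Pf) Ua zero one.
by rewrite /= seg0 seg1.
Qed.

Lemma lifts_cst (T : topologicalType) (x : X) (g : G) :
  lifts (fun _ : T => x) (fun=> g).
Proof. by move=> t a _; near=> u. Unshelve. all: by end_near. Qed.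

Definition imin (s u : I) : I := clamp (Num.min (uval s) (uval u)).

Lemma uval_imin s u : uval (imin s u) = Num.min (uval s) (uval u).
Proof.
rewrite clamp_id //; have /andP[? ?] := uvalP s; have /andP[? ?] := uvalP u.
by rewrite le_min ge_min; apply/andP; split; [apply/andP|apply/orP; left].
Qed.

Lemma imin_cts s : continuous (imin s).
Proof.
apply: (comp_cts _ clamp_continuous); apply: min_cts; last exact: uval_continuous.
by move=> ?; exact: cst_continuous.
Qed.

(* The set of the [s] such that the path stopped at time [s] has a lift is
   clopen. *)
Lemma lift_exists (P : I -> X) (g : G) : continuous P ->
  exists2 f, lifts P f & f zero = g.
Proof.
move=> cP.
pose B := [set s | exists2 f, lifts (P \o imin s) f & f zero = g].
suff /(_ one) : forall s, B s.
  move=> [f Pf f0]; exists f => //.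
  suff <- : P \o imin one = P by [].
  apply/funext => u /=; congr P; apply: uval_inj; rewrite uval_imin unitI_one.
  by have /andP[_ ?] := uvalP u; apply/min_idPr.
apply: (@clopen_unitI R B zero).
  exists (fun=> g) => //.
  have -> : P \o imin zero = fun=> P zero; last exact: lifts_cst.
  apply/funext => u /=; congr P; apply: uval_inj; rewrite uval_imin unitI_zero.
  by have /andP[? _] := uvalP u; apply/min_idPl.
move=> s; have [a Ua] := coverU (P s).
have /near_unitI[e e0 He] : \forall u \near s, U a (P u).
  by apply: cP; apply: open_nbhs_nbhs.
have main r t : `|uval r - uval s| < e -> `|uval t - uval s| < e -> B r -> B t.
  move=> rs ts [f Pf f0].
  (* The factor replaces [phi a] at the point of one stopped path by [phi a] at the point of the
     other, so that the sheet in the chart [a] is unchanged. Before the smaller of the two times the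
     paths agree and the factor is trivial. *)
  exists (fun u => f u / phi a (P (imin r u)) * phi a (P (imin t u)))%g.
    apply: lifts_chart; first exact: (comp_cts (@imin_cts t) cP).
    move=> u; case: (ltP (uval u) (Num.min (uval r) (uval t))) => [ult|leu].
      have [b Ub] := coverU (P u).
      have irt v : uval v < Num.min (uval r) (uval t) -> imin r v = v /\ imin t v = v.
        rewrite lt_min => /andP[vr vt].
        by split; apply: uval_inj; rewrite uval_imin; apply/min_idPr/ltW.
      have [iru itu] := irt u ult.
      exists b; first by rewrite /= itu.
      near=> v.
      have /irt[irv itv] : uval v < Num.min (uval r) (uval t).
        near: v; apply: (@uval_continuous R u [set y | y < Num.min (uval r) (uval t)]).
        by apply: open_nbhs_nbhs; split=> //; exact: open_lt.
      rewrite /= irv itv iru itu !mulgVK.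
      have : (f v / phi b ((P \o imin r) v) = f u / phi b ((P \o imin r) u))%g.
        by near: v; apply: Pf; rewrite /= iru.
      by rewrite /= irv iru.
    have Ur : U a (P (imin r u)).
      apply: He; rewrite uval_imin; move: leu rs ts.
      by rewrite !ltr_norml; case: (leP (uval r) (uval t)); case: (leP (uval r) (uval u)); lra.
    have Ut : U a (P (imin t u)).
      apply: He; rewrite uval_imin; move: leu rs ts.
      by rewrite !ltr_norml; case: (leP (uval r) (uval t)); case: (leP (uval t) (uval u)); lra.
    exists a => //; near=> v; rewrite !mulgK /=; near: v; exact: Pf.
  have i0 v : imin v zero = zero.
    apply: uval_inj; rewrite uval_imin unitI_zero; apply/min_idPr.
    by have /andP[] := uvalP v.
  by rewrite !i0 mulgVK.
near=> u; have us : `|uval u - uval s| < e by near: u; exact: unitI_near.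
by split; apply: main; rewrite // subrr normr0.
Unshelve. all: by end_near. Qed.

(** At a fixed [t], the times at which the horizontal lifting property holds near [t] form a clopen
    set: on a small box inside one chart the vertical lifts keep their sheet, which carries the
    property from one time to another. *)
Lemma lifts_homotopy (P : I * I -> X) (F : I * I -> G) : continuous P ->
  (forall t, lifts (fun s => P (t, s)) (fun s => F (t, s))) ->
  lifts (fun t => P (t, zero)) (fun t => F (t, zero)) ->
  lifts (fun t => P (t, one)) (fun t => F (t, one)).
Proof.
move=> cP PF P0 t.
have cPs s : continuous (fun t => P (t, s)).
  apply: (comp_cts _ cP); apply: (@pair_cts I I I id (fun=> s)) => [|t'].
    by move=> t'.
  exact: cst_continuous.
pose B := [set s | forall a, U a (P (t, s)) -> \forall u \near t,
   (F (u, s) / phi a (P (u, s)) = F (t, s) / phi a (P (t, s)))%g].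
suff : B one by [].
apply: (@clopen_unitI R B zero) => [|s]; first exact: P0.
have [a Ua] := coverU (P (t, s)).
have : \forall z \near (t, s), U a (P z).
  by apply: cP; exact: open_nbhs_nbhs.
move=> [[V W] /= [/near_unitI[e e0 He] /near_unitI[e' e'0 He']] VW].
have Ua' u r : `|uval u - uval t| < e -> `|uval r - uval s| < e' -> U a (P (u, r)).
  by move=> ut rs; apply: (VW (u, r)); split; [exact: He|exact: He'].
have main r r' : `|uval r - uval s| < e' -> `|uval r' - uval s| < e' -> B r -> B r'.
  move=> rs rs' Br.
  have tt : `|uval t - uval t| < e by rewrite subrr normr0.
  have step u : `|uval u - uval t| < e ->
    (F (u, r) / phi a (P (u, r)) = F (u, r') / phi a (P (u, r')))%g.
    move=> ut; apply: (lifts_in_chart_seg (PF u)) => v.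
    by apply: Ua' => //; exact: seg_near.
  have Hr := Br a (Ua' t r tt rs).
  suff : \forall u \near t, (F (u, r') / phi a (P (u, r')) = F (t, r') / phi a (P (t, r')))%g.
    move=> Hr' b Ub; have Hb := cPs r' t _ (phi_compat (Ua' t r' tt rs') Ub).
    near=> u; have Hu : (F (u, r') / phi a (P (u, r')) = F (t, r') / phi a (P (t, r')))%g.
      by near: u.
    have Hu' : (phi b (P (u, r')) / phi a (P (u, r')) = phi b (P (t, r')) / phi a (P (t, r')))%g.
      by near: u.
    have E x : (F x / phi b (P x) = F x / phi a (P x) * (phi b (P x) / phi a (P x))^-1)%g.
      by rewrite invgM invgK mulgA mulgVK.
    by rewrite !E Hu Hu'.
  near=> u; rewrite -!step //; last by near: u; exact: unitI_near.
  by near: u.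
near=> u; have us : `|uval u - uval s| < e' by near: u; exact: unitI_near.
by split; apply: main; rewrite // subrr normr0.
Unshelve. all: by end_near. Qed.


Lemma lifts_mull (T : topologicalType) (P : T -> X) (f : T -> G) g :
  lifts P f -> lifts P (fun t => g * f t)%g.
Proof.
move=> Pf t a Ua; near=> u; rewrite -!mulgA; congr (_ * _)%g; near: u; exact: Pf.
Unshelve. all: by end_near. Qed.

(** The end point of the lift that starts at 1; 1 is also the default value for a discontinuous
    function. *)
Definition hol (p : I -> X) : G :=
  if pselect (continuous p) is left cp then projT1 (cid2 (lift_exists 1%g cp)) one
  else 1%g.

Lemma holE p f : continuous p -> lifts p f -> hol p = ((f zero)^-1 * f one)%g.
Proof.
move=> cp pf; rewrite /hol; case: pselect => // cp'.
case: cid2 => f' /= pf' f'0.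
apply: (lifts_unique (s := zero) pf' (lifts_mull (f zero)^-1%g pf)).
by rewrite f'0 mulVg.
Qed.

(** The lift of [p] is extended along the homotopy in the time direction; over the two end points
    the homotopy is constant, so the lift does not change there. *)
Lemma hol_htpy p q : continuous p -> continuous q -> htpy p q -> hol p = hol q.
Proof.
move=> cp cq [H [cH H0 H1 Hx Hy]].
have cHt t : continuous (fun s => H (t, s)).
  apply: (comp_cts _ cH); apply: (@pair_cts I I I (fun=> t) id) => [t'|t' //].
  exact: cst_continuous.
have [f pf _] := lift_exists 1%g cp.
have /choice[F HF] : forall t, exists F, lifts (fun s => H (t, s)) F /\ F zero = f t.
  by move=> t; have [F ? ?] := lift_exists (f t) (cHt t); exists F.
have lF := @lifts_homotopy H (fun z => F z.1 z.2) cH (fun t => (HF t).1).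
have {}lF : lifts q (fun t => F t one).
  have -> : q = fun t => H (t, one) by apply/funext => t; rewrite H1.
  apply: lF => /=; rewrite (_ : (fun t => F t zero) = f).
    by rewrite (_ : (fun t => H (t, zero)) = p) //; apply/funext => t; rewrite H0.
  by apply/funext => t; rewrite (HF t).2.
rewrite (holE cp pf) (holE cq lF).
have cF t : (forall s, H (t, s) = H (t, zero)) -> F t one = f t.
  move=> Ht; rewrite -(HF t).2.
  have lF1 := (HF t).1.
  apply: (lifts_unique (s := zero) lF1 (f' := fun=> F t zero)) => //.
  have -> : (fun s => H (t, s)) = fun=> H (t, zero) by apply/funext.
  exact: lifts_cst.
by rewrite !cF // => s; rewrite ?Hx ?Hy.
Qed.

Lemma hol_cat p q : continuous p -> continuous q -> p one = q zero ->
  hol (pcat p q) = (hol p * hol q)%g.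
Proof.
move=> cp cq pq; have cpq := pcat_cts cp cq pq.
have [f lf f0] := lift_exists 1%g cpq.
pose m : I := clamp 2^-1.
have mE : uval m = 2^-1 by rewrite clamp_id //; lra.
have pE : pcat p q \o seg zero m = p.
  apply/funext => s; have /andP[? ?] := uvalP s.
  rewrite /= /pcat ifT; last by rewrite uval_seg mE unitI_zero; lra.
  by congr p; rewrite /half1 -[RHS]clampK uval_seg mE unitI_zero; congr clamp; lra.
have qE : pcat p q \o seg m one = q.
  apply/funext => s; have /andP[? ?] := uvalP s.
  rewrite /= /pcat; case: ifP => [|_].
    rewrite uval_seg mE unitI_one => sm.
    have -> : s = zero by apply: uval_inj; rewrite unitI_zero; lra.
    by rewrite seg0 half1_mid.
  by congr q; rewrite /half2 -[RHS]clampK uval_seg mE unitI_one; congr clamp; lra.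
have lp := lifts_comp (@seg_cts R zero m) lf.
have lq := lifts_comp (@seg_cts R m one) lf.
rewrite pE in lp; rewrite qE in lq.
rewrite (holE cpq lf) (holE cp lp) (holE cq lq) /= !seg0 !seg1.
by rewrite mulgA mulgK.
Qed.

Lemma hol_rev p : continuous p -> hol (revp p) = (hol p)^-1%g.
Proof.
move=> cp; have [f lf f0] := lift_exists 1%g cp.
have lr := lifts_comp (@opp_cts R) lf.
rewrite (holE cp lf) (holE (revp_cts cp) lr) /= clamp_opp_zero clamp_opp_one.
by rewrite invgM invgK.
Qed.

Definition monodromy (x : X) (u : pi1 R x) : G := hol (repr u).

Lemma monodromy_loop_class x (p : {path I from x to x}) :
  monodromy (loop_class p) = hol p.
Proof.
have [H [cH H0 H1 Hx Hy]] := repr_loop_class p.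
apply: hol_htpy; [exact: path_cts|exact: path_cts|].
by exists H; split=> // t; rewrite ?Hx ?Hy ?path_zero ?path_one.
Qed.

Lemma monodromyM x : {morph @monodromy x : u v / (u * v)%g}.
Proof.
move=> u v; rewrite /monodromy -hol_cat ?path_zero ?path_one //; try exact: path_cts.
exact: monodromy_loop_class.
Qed.

End LocalSystem.

(** * Paths as elements of the fundamental group *)

Section Kappa.
Context {R : realType} {X : topologicalType} (x0 : X).
Local Notation I := (unitI R).
Context (lam : forall y, {path I from x0 to y}).
Hypothesis lam0 : lam x0 =1 cst x0.

(* Paths are closed up into loops at [x0] along the chosen paths [lam]. *)
Definition kap y z (p : {path I from y to z}) : pi1 R x0 :=
  loop_class (path_cat (path_cat (lam y) p) (path_rev (lam z))).

Lemma kap_homotopic y z (p q : {path I from y to z}) :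
  homotopic p q -> kap p = kap q.
Proof.
move=> pq; apply/loop_classP; apply: homotopic_cat; last exact: homotopic_refl.
apply: homotopic_cat => //; exact: homotopic_refl.
Qed.

Lemma kap_cat y z w (p : {path I from y to z}) (q : {path I from z to w}) :
  kap (path_cat p q) = (kap p * kap q)%g.
Proof.
rewrite [RHS]pi1_mulE; apply/loop_classP.
set A := path_cat (lam y) p; set B := path_rev (lam z).
set C := path_cat (lam z) q; set D := path_rev (lam w).
have BCD : homotopic (path_cat q D) (path_cat B (path_cat C D)).
  apply: (@homotopic_trans _ _ _ _ _ (path_cat B (path_cat (lam z) (path_cat q D)))).
    apply: (@homotopic_trans _ _ _ _ _ (path_cat (path_cat B (lam z)) (path_cat q D))).
      apply: (@homotopic_trans _ _ _ _ _ (path_cat (path_cst z) (path_cat q D))).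
        exact/homotopic_sym/homotopic_cat1p.
      apply: homotopic_cat; last exact: homotopic_refl.
      exact/homotopic_sym/homotopic_catVp.
    exact/homotopic_sym/homotopic_catA.
  apply: homotopic_cat; first exact: homotopic_refl.
  exact: homotopic_catA.
apply: (@homotopic_trans _ _ _ _ _ (path_cat (path_cat A q) D)).
  apply: homotopic_cat; last exact: homotopic_refl.
  exact: homotopic_catA.
apply: (@homotopic_trans _ _ _ _ _ (path_cat A (path_cat q D))).
  exact/homotopic_sym/homotopic_catA.
apply: (@homotopic_trans _ _ _ _ _ (path_cat A (path_cat B (path_cat C D)))).
  apply: homotopic_cat => //; exact: homotopic_refl.
exact: homotopic_catA.
Qed.

Lemma kap_loop (p : {path I from x0 to x0}) : kap p = loop_class p.
Proof.
have l0 : lam x0 = path_cst x0 by apply/path_eqP.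
have l0' : path_rev (path_cst x0) = path_cst x0 :> {path I from x0 to x0} by apply/path_eqP.
rewrite /kap l0 l0'; apply/loop_classP.
apply: homotopic_trans (homotopic_catp1 _) _; exact: homotopic_cat1p.
Qed.

Definition kappa (p : I -> X) : pi1 R x0 :=
  if pselect (continuous p) is left cp then kap (mk_path cp erefl erefl) else 1%g.

Lemma kappaE (p : I -> X) y z (cp : continuous p) (p0 : p zero = y) (p1 : p one = z) :
  kappa p = kap (mk_path cp p0 p1).
Proof.
rewrite /kappa; case: pselect => // cp'; move: p0 p1; case: y /; case: z /.
by rewrite (Prop_irrelevance cp' cp).
Qed.

Lemma kappa_path y z (p : {path I from y to z}) : kappa p = kap p.
Proof.
have p0 : p zero = y by exact: path_zero.
have p1 : p one = z by exact: path_one.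
by rewrite (kappaE (@path_cts _ _ _ _ p) p0 p1); congr kap; apply/path_eqP.
Qed.

Lemma kappa_loop (p : {path I from x0 to x0}) : kappa p = loop_class p.
Proof. by rewrite kappa_path kap_loop. Qed.

Lemma kappa_htpy p q : continuous p -> continuous q -> htpy p q -> kappa p = kappa q.
Proof.
move=> cp cq pq.
have [q0 q1] : q zero = p zero /\ q one = p one.
  by move: pq => [H [_ _ H1 Hx Hy]]; rewrite -!H1 Hx Hy.
rewrite (kappaE cp erefl erefl) (kappaE cq q0 q1).
by apply: kap_homotopic; apply/htpyP.
Qed.

Lemma kappa_cat p q : continuous p -> continuous q -> p one = q zero ->
  kappa (pcat p q) = (kappa p * kappa q)%g.
Proof.
move=> cp cq pq; rewrite (kappaE cp erefl pq) (kappaE cq erefl erefl) -kap_cat.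
by rewrite -kappa_path; congr kappa.
Qed.

Lemma kappa_cst y : kappa (fun=> y) = 1%g.
Proof.
have cc : continuous (fun _ : I => y) by move=> ?; exact: cst_continuous.
apply: (mulgI (kappa (fun=> y))); rewrite -kappa_cat // mulg1; congr kappa.
by apply/funext => s; rewrite /pcat if_same.
Qed.

Lemma convex_htpy (Q : I * I -> X) (a b : I -> I * I) : continuous Q ->
  continuous a -> continuous b -> a zero = b zero -> a one = b one ->
  htpy (Q \o a) (Q \o b).
Proof.
move=> cQ ca cb ab0 ab1.
have segc (f g : I -> I) : continuous f -> continuous g ->
    continuous (fun z : I * I => seg (f z.1) (g z.1) z.2).
  move=> cf cg; apply: (comp_cts _ clamp_continuous) => z.
  have cuf : continuous (fun z : I * I => uval (f z.1)).
    by apply: (comp_cts (comp_cts (@fst_cts _ _) cf) uval_continuous).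
  have cug : continuous (fun z : I * I => uval (g z.1)).
    by apply: (comp_cts (comp_cts (@fst_cts _ _) cg) uval_continuous).
  have cu : continuous (fun z : I * I => uval z.2).
    exact: (comp_cts (@snd_cts _ _) uval_continuous).
  apply: cvgD; last exact: cuf.
  by apply: cvgM; [apply: cvgB; [exact: cug | exact: cuf] | exact: cu].
exists (fun z => Q (seg (a z.1).1 (b z.1).1 z.2, seg (a z.1).2 (b z.1).2 z.2)).
split=> [|s|s|t|t] /=.
- apply: (comp_cts _ cQ); apply: pair_cts.
    by apply: (segc (fst \o a) (fst \o b)); apply: comp_cts; rewrite //; exact: fst_cts.
  by apply: (segc (snd \o a) (snd \o b)); apply: comp_cts; rewrite //; exact: snd_cts.
- by rewrite !seg0 -surjective_pairing.
- by rewrite !seg1 -surjective_pairing.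
- rewrite -ab0 [RHS]/= [a zero]surjective_pairing /=; congr (Q (_, _)); apply: uval_inj;
    by rewrite uval_seg; ring.
- rewrite -ab1 [RHS]/= [a one]surjective_pairing /=; congr (Q (_, _)); apply: uval_inj;
    by rewrite uval_seg; ring.
Qed.

Lemma comp_pcat (T : topologicalType) (Q : T -> X) (a b : I -> T) :
  Q \o pcat a b = pcat (Q \o a) (Q \o b).
Proof. by apply/funext => s; rewrite /pcat /=; case: ifP. Qed.

(** The square is convex, so the two boundary paths between opposite corners are homotopic in it.
    Applied to a contraction, this compares a path with its contracted image. *)
Lemma kappa_square (Q : I * I -> X) : continuous Q ->
  (kappa (fun s => Q (zero, s)) * kappa (fun s => Q (s, one)) =
   kappa (fun s => Q (s, zero)) * kappa (fun s => Q (one, s)))%g.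
Proof.
move=> cQ.
have cl (t : I) : continuous (fun s : I => (t, s)).
  by apply: (@pair_cts I I I (fun=> t) id) => [t'|t' //]; exact: cst_continuous.
have cr (t : I) : continuous (fun s : I => (s, t)).
  by apply: (@pair_cts I I I id (fun=> t)) => [t' //|t']; exact: cst_continuous.
rewrite -(@kappa_cat (Q \o (fun s => (zero, s))) (Q \o (fun s => (s, one)))) //; try exact: comp_cts.
rewrite -(@kappa_cat (Q \o (fun s => (s, zero))) (Q \o (fun s => (one, s)))) //; try exact: comp_cts.
rewrite -!comp_pcat; apply: kappa_htpy.
- by apply: (comp_cts _ cQ); exact: pcat_cts.
- by apply: (comp_cts _ cQ); exact: pcat_cts.
- by apply: convex_htpy; rewrite ?pcat0 ?pcat1 //; exact: pcat_cts.
Qed.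

End Kappa.

(** * Sectors of the plane *)

Section Sectors.
Context {R : realType} (G : R).
Hypothesis G1 : 1 <= G.
Implicit Types (x y c : R) (p q : R * R).

(** The unit of angle is half a side: with [G] the genus, the full turn is [8 * G], side [k] is the
    interval from [2 * k] to [2 * k + 2], the corners are the even integers and the midpoints of the
    sides the odd ones. *)
Definition ang x : R := x * (pi / (4 * G)).
Definition circ x : R * R := (cos (ang x), sin (ang x)).
Definition cross p q : R := p.1 * q.2 - p.2 * q.1.
Definition sqn p : R := p.1 ^+ 2 + p.2 ^+ 2.

Local Notation n := (8 * G : R).

Let pi0 : 0 < pi :> R := pi_gt0 R.

Ltac glra := have := G1; lra.

Let gn : G != 0. Proof. by apply: lt0r_neq0; glra. Qed.

Lemma sqn_E x : sqn (circ x) = 1.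
Proof. exact: cos2Dsin2. Qed.

Lemma angB x y : ang (x - y) = ang x - ang y.
Proof. by rewrite /ang mulrBl. Qed.

Lemma angD x y : ang (x + y) = ang x + ang y.
Proof. by rewrite /ang mulrDl. Qed.

Lemma ang_lt x y : (ang x < ang y) = (x < y).
Proof. by rewrite /ang ltr_pM2r // divr_gt0 //; glra. Qed.

Lemma ang_le x y : (ang x <= ang y) = (x <= y).
Proof. by rewrite /ang ler_pM2r // divr_gt0 //; glra. Qed.

Lemma ang0 : ang 0 = 0. Proof. by rewrite /ang mul0r. Qed.

Lemma ang_pi : ang (4 * G) = pi.
Proof. by rewrite /ang; field; rewrite ?gn. Qed.

Lemma ang_2pi : ang n = pi *+ 2.
Proof. by rewrite /ang mulr2n; field; rewrite ?gn. Qed.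

Lemma E_period x : circ (x + n) = circ x.
Proof. by rewrite /circ angD ang_2pi cosD2pi sinD2pi. Qed.

Lemma cross_E x y : cross (circ x) (circ y) = sin (ang (y - x)).
Proof. by rewrite /cross /circ angB sinB /=; ring. Qed.

Lemma sin_ang_gt0 x : 0 < x < 4 * G -> 0 < sin (ang x).
Proof. by move=> x0; rewrite sin_gt0_pi // -ang_pi -[0]ang0 !ang_lt. Qed.

Lemma sin_ang_ge0 x : 0 <= x <= 4 * G -> 0 <= sin (ang x).
Proof. by move=> x0; rewrite sin_ge0_pi // -ang_pi -[0]ang0 !ang_le. Qed.

Lemma sin_ang_le0 x : 4 * G <= x <= n -> sin (ang x) <= 0.
Proof.
move=> x0; have -> : x = (x - 4 * G) + 4 * G by ring.
rewrite angD ang_pi sinDpi oppr_le0; apply: sin_ang_ge0; glra.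
Qed.

Lemma sin_angN x : sin (ang (- x)) = - sin (ang x).
Proof. by rewrite /ang mulNr sinN. Qed.

(** After a rotation by [ang c], [acos] gives the angle up to a sign, which is read off from the
    other coordinate. *)
Lemma polar p c : sqn p = 1 -> exists2 y, `|y - c| <= 4 * G & p = circ y.
Proof.
case: p => a b; rewrite /sqn /= => p1.
have := cos2Dsin2 (ang c); set C := cos _; set S := sin _ => CS.
set u := a * C + b * S; set v := b * C - a * S.
have uv : u ^+ 2 + v ^+ 2 = 1.
  by rewrite -[1]mulr1 -{1}p1 -CS /u /v; ring.
have u1 : -1 <= u <= 1 by apply/andP; split; nra.
have cu : cos (acos u) = u by rewrite acosK // in_itv.
have su : sin (acos u) = `|v|.
  by rewrite sin_acos // -uv addrAC subrr add0r sqrtr_sqr.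
have [a0 api] := (acos_ge0 u1, acos_lepi u1).
pose w := acos u / (pi / (4 * G)).
have wE : ang w = acos u by rewrite /w /ang mulfVK //; apply/lt0r_neq0/divr_gt0 => //; glra.
have w0 : 0 <= w <= 4 * G.
  by rewrite -(ang_le 0) -(ang_le w) wE ang0 ang_pi a0.
have fin : (a, b) = (u * C - v * S, v * C + u * S).
  congr pair; rewrite /u /v.
    by rewrite -[LHS]mulr1 -CS; ring.
  by rewrite -[LHS]mulr1 -CS; ring.
case: (lerP 0 v) => v0.
  exists (c + w); first by rewrite (addrC c) addrK ger0_norm; glra.
  rewrite fin /circ angD wE cosD sinD cu su ger0_norm // -/C -/S; congr pair; ring.
exists (c - w); first by rewrite addrAC subrr add0r normrN ger0_norm; glra.
rewrite fin /circ angB wE cosB sinB cu su ltr0_norm // -/C -/S; congr pair; ring.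
Qed.

(** The open cone of half-width 1 around the direction [c]. Cross products avoid the choice of an
    angle; they describe this cone because [G1] keeps its opening below a half turn. *)
Definition sector c p : Prop := 0 < cross (circ (c - 1)) p /\ 0 < cross p (circ (c + 1)).

Lemma sector_E c y : `|y - c| < 1 -> sector c (circ y).
Proof.
by rewrite ltr_norml => yc; split; rewrite cross_E; apply: sin_ang_gt0; glra.
Qed.

(** The parameter of a point is determined only up to a full turn, hence the second alternative,
    where [y] is close to [c] plus or minus [8 * G]. *)
Lemma sector_near c y : `|y - c| <= n -> sector c (circ y) ->
  `|y - c| < 1 \/ n - 1 < `|y - c|.
Proof.
rewrite /sector !cross_E => yn [].
have -> : y - (c - 1) = (y - c) + 1 by ring.
have -> : c + 1 - y = - ((y - c) - 1) by ring.
move: yn; set z := y - c; rewrite ler_norml => zn; rewrite sin_angN oppr_gt0 => s1 s2.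
case: (ltP `|z| 1) => [|z1]; first by left.
case: (ltP (n - 1) `|z|) => [|z2]; first by right.
exfalso; case: (ler0P z) z1 z2 => z0 z1 z2.
  have s1' : sin (ang (- z + 1)) > 0.
    by rewrite (_ : - z + 1 = - (z - 1)) ?sin_angN ?oppr_gt0 //; ring.
  have s2' : sin (ang (- z - 1)) < 0.
    by rewrite (_ : - z - 1 = - (z + 1)) ?sin_angN ?oppr_lt0 //; ring.
  case: (leP (- z - 1) (4 * G)) => z3.
    have : 0 <= sin (ang (- z - 1)) by apply: sin_ang_ge0; glra.
    glra.
  have : sin (ang (- z + 1)) <= 0 by apply: sin_ang_le0; glra.
  glra.
case: (leP (z - 1) (4 * G)) => z3.
  have : 0 <= sin (ang (z - 1)) by apply: sin_ang_ge0; glra.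
  glra.
have : sin (ang (z + 1)) <= 0 by apply: sin_ang_le0; glra.
glra.
Qed.

Lemma closed_sector c p : sqn p = 1 -> 0 <= cross (circ (c - 1)) p ->
  0 <= cross p (circ (c + 1)) -> exists2 y, `|y - c| <= 1 & p = circ y.
Proof.
move=> p1; have [y yc ->] := polar c p1; rewrite !cross_E => s1 s2.
exists y => //; move: yc; rewrite !ler_norml => yc; apply/andP; split.
  rewrite leNgt; apply/negP => lt1.
  have : sin (ang (- (y - (c - 1)))) > 0 by apply: sin_ang_gt0; glra.
  rewrite sin_angN; glra.
rewrite leNgt; apply/negP => lt1.
have : sin (ang (- (c + 1 - y))) > 0 by apply: sin_ang_gt0; glra.
rewrite sin_angN; glra.
Qed.

Lemma sector_cover p : sqn p = 1 -> exists y, [/\ 0 <= y < n & p = circ y].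
Proof.
move=> p1; have [y yc ->] := polar 0 p1; move: yc; rewrite subr0 ler_norml => yn.
case: (lerP 0 y) => y0; first by exists y; split=> //; glra.
by exists (y + n); rewrite E_period; split=> //; glra.
Qed.

(** The reflection that exchanges the parameters [y] and [m - y]. Every gluing of two sides is the
    restriction of such a reflection, which transports constructions of the plane across it. *)
Definition refl m p : R * R :=
  (p.1 * cos (ang m) + p.2 * sin (ang m), p.1 * sin (ang m) - p.2 * cos (ang m)).

Lemma refl_E m y : refl m (circ y) = circ (m - y).
Proof. by rewrite /refl /circ angB cosB sinB /=; congr pair; ring. Qed.

Lemma sqn_refl m p : sqn (refl m p) = sqn p.
Proof.
rewrite /sqn /= -[RHS]mulr1 -(cos2Dsin2 (ang m)); ring.
Qed.

Lemma sector_dot c p : sector c p -> 0 < p.1 * (circ c).1 + p.2 * (circ c).2.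
Proof.
move=> [s1 s2]; have s : 0 < sin (ang 1) by apply: sin_ang_gt0; glra.
have : cross (circ (c - 1)) p + cross p (circ (c + 1)) =
  2 * sin (ang 1) * (p.1 * (circ c).1 + p.2 * (circ c).2).
  by rewrite /cross /circ angB angD cosB cosD sinB sinD /=; ring.
nra.
Qed.

End Sectors.

Lemma side_E {R : realType} (g k : nat) (t : R) : (0 < g)%N ->
  side g k t = circ g%:R (2 * (k%:R + t)).
Proof.
move=> g0; have gn : g%:R != 0 :> R by rewrite pnatr_eq0 -lt0n.
rewrite /side /circ /ang natrM; have -> // : 2 * pi * (k%:R + t) / (4%:R * g%:R) =
  2 * (k%:R + t) * (pi / (4 * g%:R)).
by field; rewrite ?gn.
Qed.

(** * The disc *)

Section Disc.
Context {R : realType}.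
Local Notation D := (disc R).
Local Notation I := (unitI R).
Implicit Types (p : R * R) (d : D).

Definition nrm p : R := Num.sqrt (sqn p).

Lemma sqn_ge0 p : 0 <= sqn p.
Proof. by rewrite addr_ge0 // sqr_ge0. Qed.

Lemma nrm_ge0 p : 0 <= nrm p. Proof. exact: sqrtr_ge0. Qed.

Lemma nrm_sq p : nrm p ^+ 2 = sqn p.
Proof. by rewrite sqr_sqrtr // sqn_ge0. Qed.

Definition dot (p p' : R * R) : R := p.1 * p'.1 + p.2 * p'.2.

Lemma dot_nrm p p' : dot p p' > 0 -> 0 < nrm p.
Proof.
move=> h; rewrite lt_neqAle nrm_ge0 andbT eq_sym.
apply/eqP => n0; have : sqn p = 0 by rewrite -nrm_sq n0 expr0n.
rewrite /sqn => /eqP; rewrite paddr_eq0 ?sqr_ge0 // !sqrf_eq0 => /andP[/eqP d1 /eqP d2].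
by move: h; rewrite /dot d1 d2 !mul0r addr0 ltxx.
Qed.

Lemma discP d : sqn (disc_val d) <= 1.
Proof. exact: (set_valP d). Qed.

Lemma disc_val_inj : injective (@disc_val R).
Proof. exact: val_inj. Qed.

Lemma disc_val_cts : continuous (@disc_val R).
Proof. exact: initial_continuous. Qed.

Definition scal (k : R) p : R * R := (k * p.1, k * p.2).

Lemma sqn_scal k p : sqn (scal k p) = k ^+ 2 * sqn p.
Proof. by rewrite /sqn /=; ring. Qed.

Lemma retractD_subproof p :
  scal (Num.max 1 (nrm p))^-1 p \in [set p : R * R | p.1 ^+ 2 + p.2 ^+ 2 <= 1].
Proof.
rewrite inE /=; set k := _^-1; rewrite -[X in X <= 1]/(sqn (scal k p)).
rewrite sqn_scal -nrm_sq -exprMn mulrC /k.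
have m0 : 0 < Num.max 1 (nrm p) by rewrite lt_max ltr01.
rewrite expr_le1 //; last by rewrite divr_ge0 ?nrm_ge0 // ltW.
by rewrite ler_pdivrMr // mul1r le_max lexx orbT.
Qed.

(** Like [clamp] for the interval, this retraction lets points of the disc be given by arbitrary
    expressions in the plane. *)
Definition retractD p : D := exist (fun p => p \in [set p : R * R | p.1 ^+ 2 + p.2 ^+ 2 <= 1]) _ (retractD_subproof p).

Lemma retractD_id p : sqn p <= 1 -> disc_val (retractD p) = p.
Proof.
move=> p1; rewrite /disc_val /= (max_idPl _).
  by rewrite invr1 /scal !mul1r -surjective_pairing.
by rewrite -sqrtr1 ler_wsqrtr.
Qed.

Lemma retractDK d : retractD (disc_val d) = d.
Proof. by apply: disc_val_inj; rewrite retractD_id ?discP. Qed.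

Lemma pair_cts_at (S T U : topologicalType) (f : S -> T) (h : S -> U) s :
  {for s, continuous f} -> {for s, continuous h} ->
  {for s, continuous (fun s => (f s, h s))}.
Proof. by move=> cf ch; apply: cvg_pair. Qed.

Lemma sqn_cts_at (T : topologicalType) (f : T -> R * R) t :
  {for t, continuous f} -> {for t, continuous (sqn \o f)}.
Proof.
move=> cf.
have c1 : {for t, continuous (fun t => (f t).1)} by apply: (cvg_comp _ _ cf); exact: cvg_fst.
have c2 : {for t, continuous (fun t => (f t).2)} by apply: (cvg_comp _ _ cf); exact: cvg_snd.
by apply: cvgD; rewrite /= ?expr2; apply: cvgM.
Qed.

Lemma nrm_cts_at (T : topologicalType) (f : T -> R * R) t :
  {for t, continuous f} -> {for t, continuous (nrm \o f)}.
Proof.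
move=> cf; have := sqn_cts_at cf => /(@continuous_comp _ _ _ _ Num.sqrt); apply.
exact: sqrt_continuous.
Qed.

Lemma scal_cts_at (T : topologicalType) (k : T -> R) (f : T -> R * R) t :
  {for t, continuous k} -> {for t, continuous f} ->
  {for t, continuous (fun t => scal (k t) (f t))}.
Proof.
move=> ck cf.
have c1 : {for t, continuous (fun t => (f t).1)} by apply: (cvg_comp _ _ cf); exact: cvg_fst.
have c2 : {for t, continuous (fun t => (f t).2)} by apply: (cvg_comp _ _ cf); exact: cvg_snd.
by apply: pair_cts_at; apply: cvgM.
Qed.

Lemma retractD_cts : continuous retractD.
Proof.
apply: continuous_comp_initial => p.
apply: (@scal_cts_at _ (fun p => (Num.max 1 (nrm p))^-1) id) => //.
apply: cvgV; first by apply/lt0r_neq0; rewrite lt_max ltr01.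
apply: (@continuous_max _ _ (fun=> 1) nrm); first exact: cst_continuous.
exact: (@nrm_cts_at _ id).
Qed.

Definition mix (t : R) p p' : R * R := (t * p.1 + (1 - t) * p'.1, t * p.2 + (1 - t) * p'.2).

Lemma mix_cts_at (T : topologicalType) (k : T -> R) (f h : T -> R * R) t :
  {for t, continuous k} -> {for t, continuous f} -> {for t, continuous h} ->
  {for t, continuous (fun t => mix (k t) (f t) (h t))}.
Proof.
move=> ck cf ch.
have f1 : {for t, continuous (fun t => (f t).1)} by apply: (cvg_comp _ _ cf); exact: cvg_fst.
have f2 : {for t, continuous (fun t => (f t).2)} by apply: (cvg_comp _ _ cf); exact: cvg_snd.
have h1 : {for t, continuous (fun t => (h t).1)} by apply: (cvg_comp _ _ ch); exact: cvg_fst.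
have h2 : {for t, continuous (fun t => (h t).2)} by apply: (cvg_comp _ _ ch); exact: cvg_snd.
have ck' : {for t, continuous (fun t => 1 - k t)} by apply: cvgB; [exact: cvg_cst|].
by apply: pair_cts_at; apply: cvgD; apply: cvgM.
Qed.

Definition segD (d d' : D) (s : I) : D := retractD (mix (uval s) (disc_val d') (disc_val d)).

Lemma segD0 d d' : segD d d' zero = d.
Proof.
rewrite /segD unitI_zero /mix !mul0r !add0r subr0 !mul1r -surjective_pairing; exact: retractDK.
Qed.

Lemma segD1 d d' : segD d d' one = d'.
Proof.
rewrite /segD unitI_one /mix subrr !mul0r !addr0 !mul1r -surjective_pairing; exact: retractDK.
Qed.

Lemma segD_cts (T : topologicalType) (f h : T -> D) (k : T -> I) :
  continuous f -> continuous h -> continuous k ->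
  continuous (fun t => segD (f t) (h t) (k t)).
Proof.
move=> cf ch ck; apply: (comp_cts _ retractD_cts) => t.
apply: (@mix_cts_at T (uval \o k) (@disc_val R \o h) (@disc_val R \o f) t).
- exact: (comp_cts ck uval_continuous).
- exact: (comp_cts ch disc_val_cts).
- exact: (comp_cts cf disc_val_cts).
Qed.

Lemma segDxx d s : segD d d s = d.
Proof.
rewrite /segD /mix -!mulrDl [_ + (1 - _)]addrC subrK !mul1r -surjective_pairing.
exact: retractDK.
Qed.

End Disc.

(** * The gluing of the sides *)

Section Gluing.
Context {R : realType} (g : nat).
Hypothesis g0 : (0 < g)%N.
Local Notation D := (disc R).
Local Notation X := (surface R g).
Local Notation EG := (circ (g%:R : R)).
Local Notation n := (8 * g)%N.
Implicit Types (d : D) (y : R).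

Lemma gR1 : 1 <= g%:R :> R. Proof. by rewrite ler1n. Qed.

Definition quo (d : D) : X := \pi_X d.

Lemma quoP d d' : quo d = quo d' <-> clos_refl_sym_trans D (side_pairing g) d d'.
Proof.
split=> [/(@eqmodP _ (glued_equiv R g))|dd']; first by move/asboolP.
by apply/(@eqmodP _ (glued_equiv R g)); exact/asboolP.
Qed.

Lemma quo_repr (x : X) : quo (repr x) = x.
Proof. exact: reprK. Qed.

Lemma quo_cts : continuous quo.
Proof. exact: pi_continuous. Qed.

Lemma open_quo (A : set X) : open (quo @^-1` A) -> open A.
Proof. by []. Qed.

(* The sides that carry a label without inverse *)
Definition positive_side (k : nat) : bool := (k < 4 * g)%N && (k %% 4 < 2)%N.

(** Side [k] is glued to side [k + 2] with the orientation reversed: the interval from [2 * k] to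
    [2 * k + 2] goes to that from [2 * k + 4] to [2 * k + 6] by a reflection, and glued parameters
    add up to [4 * k + 6]. *)
Lemma side_pairingP d d' : side_pairing g d d' <-> exists k y,
  [/\ positive_side k, (2 * k)%:R <= y <= (2 * k + 2)%:R,
      disc_val d = EG y & disc_val d' = EG ((4 * k + 6)%:R - y)].
Proof.
split=> [[i t ig t01 dE d'E|i t ig t01 dE d'E]|[k [y [/andP[k4 k2] yk dE d'E]]]].
- exists (4 * i)%N, (2 * ((4 * i)%:R + t)); split.
  + by apply/andP; split; lia.
  + by rewrite ?(natrD, natrM); lra.
  + by rewrite dE side_E.
  + rewrite d'E side_E //; congr (circ _ _); rewrite ?(natrD, natrM); lra.
- exists (4 * i + 1)%N, (2 * ((4 * i + 1)%:R + t)); split.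
  + by apply/andP; split; lia.
  + by rewrite ?(natrD, natrM); lra.
  + by rewrite dE side_E.
  + rewrite d'E side_E //; congr (circ _ _); rewrite ?(natrD, natrM); lra.
- pose i := (k %/ 4)%N; pose t := y / 2 - k%:R.
  have t01 : 0 <= t <= 1 by move: yk; rewrite /t ?(natrD, natrM); lra.
  have ig : (i < g)%N by rewrite /i; lia.
  have [kE|kE] : k = (4 * i)%N \/ k = (4 * i + 1)%N by rewrite /i; lia.
  + apply: (@Pair_a _ _ _ _ i t) => //.
      rewrite dE side_E //; congr (circ _ _); rewrite /t -kE; lra.
    rewrite d'E side_E //; congr (circ _ _); rewrite /t ?(natrD, natrM) kE ?(natrD, natrM); lra.
  + apply: (@Pair_b _ _ _ _ i t) => //.
      rewrite dE side_E //; congr (circ _ _); rewrite /t -kE; lra.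
    rewrite d'E side_E //; congr (circ _ _); rewrite /t ?(natrD, natrM) kE ?(natrD, natrM); lra.
Qed.

Definition vtx y : D := retractD (EG y).

Lemma vtxE y : disc_val (vtx y) = EG y.
Proof. by rewrite retractD_id // sqn_E. Qed.

Lemma vtx_eq d y : disc_val d = EG y -> d = vtx y.
Proof. by move=> dE; apply: disc_val_inj; rewrite vtxE. Qed.

Lemma vtx_pairing k y : positive_side k -> (2 * k)%:R <= y <= (2 * k + 2)%:R ->
  side_pairing g (vtx y) (vtx ((4 * k + 6)%:R - y)).
Proof. by move=> kp yk; apply/side_pairingP; exists k, y; rewrite !vtxE. Qed.

Lemma quo_pairing d d' : side_pairing g d d' -> quo d = quo d'.
Proof. by move=> dd'; apply/quoP; exact: rst_step. Qed.

Lemma quo_vtx k y : positive_side k -> (2 * k)%:R <= y <= (2 * k + 2)%:R ->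
  quo (vtx y) = quo (vtx ((4 * k + 6)%:R - y)).
Proof. by move=> kp yk; apply: quo_pairing; exact: vtx_pairing. Qed.

Lemma vtx_mod (i : nat) : (i <= n)%N -> vtx (i %% n)%:R = vtx i%:R.
Proof.
rewrite leq_eqVlt => /orP[/eqP ->|?]; last by rewrite modn_small.
by rewrite modnn /vtx -(@E_period _ (g%:R : R) gR1 0) add0r natrM.
Qed.

Definition sec (i : nat) d : Prop := sector (g%:R : R) i%:R (disc_val d).

Lemma sec_mod (i : nat) d : (i <= n)%N -> sec (i %% n) d <-> sec i d.
Proof.
rewrite leq_eqVlt => /orP[/eqP ->|?]; last by rewrite modn_small.
rewrite modnn /sec /sector -(@E_period _ (g%:R : R) gR1 (0 - 1)).
rewrite -(@E_period _ (g%:R : R) gR1 (0 + 1)) natrM.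
have -> : 0 - 1 + 8%:R * g%:R = 8%:R * g%:R - 1 :> R by ring.
by have -> : 0 + 1 + 8%:R * g%:R = 8%:R * g%:R + 1 :> R by ring.
Qed.

Lemma sec_vtx (i : nat) y : `|y - i%:R| < 1 -> sec i (vtx y).
Proof. by move=> yi; rewrite /sec vtxE; apply: sector_E => //; exact: gR1. Qed.

(** The index [i0] is left unreduced because a reflection [4 * k + 6 - i0] is to be applied to it.
    It differs from [i] only at the full turn, where [i0 = n] and [i = 0]. *)
Lemma sec_index (m i : nat) y : (m + 2 <= n)%N -> m%:R <= y <= (m + 2)%:R ->
  (i < n)%N -> sec i (vtx y) ->
  exists i0, [/\ (m <= i0 <= m + 2)%N, `|y - i0%:R| < 1 & i = (i0 %% n)%N].
Proof.
move=> mn ym ltin; rewrite /sec vtxE => si.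
have nR : (8 * g%:R : R) = n%:R by rewrite natrM.
have ? : (m + 2)%:R <= n%:R :> R by rewrite ler_nat.
have ? : i%:R + 1 <= n%:R :> R by rewrite natr1 ler_nat.
have [i0 m0] : 0 <= i%:R :> R /\ 0 <= m%:R :> R by rewrite !ler0n.
have yin : `|y - i%:R| <= 8 * g%:R by rewrite nR ler_norml; apply/andP; split; lra.
case: (sector_near gR1 yin si) => [yi|]; last rewrite nR.
  exists i; split=> //; last by rewrite modn_small.
  move: yi ym; rewrite ltr_norml natrD => yi ym; apply/andP; split; rewrite -ltnS -(ltr_nat R);
    rewrite -?natr1 ?natrD; lra.
rewrite ltr_normr => /orP[|] lt1; last by exfalso; lra.
have i0' : i = 0%N.
  by apply/eqP; rewrite -leqn0 -ltnS -(ltr_nat R); lra.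
have mE : (m + 2)%N = n.
  by apply/eqP; rewrite eqn_leq mn -ltnS -(ltr_nat R) -natr1; lra.
exists n; split; [lia| |by rewrite modnn].
rewrite i0' in lt1; rewrite ltr_norml; apply/andP; split; lra.
Qed.

Lemma sec_unit d : sqn (disc_val d) = 1 -> exists2 i, (i < n)%N & sec i d.
Proof.
move=> d1; have [y [y0 dE]] := sector_cover gR1 d1.
have [y0' yn] := andP y0.
have /andP[t1 t2] := truncn_itv y0'.
exists (Num.trunc y).
  by rewrite -(ltr_nat R) natrM; exact: le_lt_trans yn.
rewrite (vtx_eq dE); apply: sec_vtx; rewrite ger0_norm; last lra.
by move: t2; rewrite -natr1; lra.
Qed.

Lemma sec_nrm d i : sec i d -> 0 < nrm (disc_val d).
Proof. by move=> /(sector_dot gR1) /dot_nrm. Qed.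

Lemma cross_scal (k : R) p p' : cross p (scal k p') = k * cross p p'.
Proof. by rewrite /cross /=; ring. Qed.

Lemma cross_scall (k : R) p p' : cross (scal k p) p' = k * cross p p'.
Proof. by rewrite /cross /=; ring. Qed.

(** Distinct centres of the same parity are at least 2 apart, also around the circle since [n] is
    even, and the sectors have half-width 1. This is why each star keeps to one parity. *)
Lemma sec_uniq i j d : (i < n)%N -> (j < n)%N -> odd i = odd j ->
  sec i d -> sec j d -> i = j.
Proof.
move=> ltin ltjn oij si sj.
(* Sectors are cones, so the point may be pushed to the unit circle, where it has a parameter. *)
pose r := nrm (disc_val d); have r0 : 0 < r := sec_nrm si.
pose p := scal r^-1 (disc_val d).
have p1 : sqn p = 1.
  by rewrite sqn_scal -nrm_sq -/r exprVn mulVf // expf_neq0 // gt_eqF.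
have sp k : sec k d -> sector (g%:R : R) k%:R p.
  by move=> [s1 s2]; split; rewrite /p ?cross_scal ?cross_scall mulr_gt0 ?invr_gt0.
have [y [/andP[y0 yn] pE]] := sector_cover gR1 p1.
have nR : (8 * g%:R : R) = n%:R by rewrite natrM.
have near k : (k < n)%N -> sec k d -> `|y - k%:R| < 1 \/ (k = 0%N /\ n%:R - 1 < y).
  move=> kn /sp; rewrite pE => sk.
  have ? : k%:R + 1 <= n%:R :> R by rewrite natr1 ler_nat.
  have k0 : 0 <= k%:R :> R by rewrite ler0n.
  have ykn : `|y - k%:R| <= 8 * g%:R by rewrite nR ler_norml; apply/andP; split; lra.
  case: (sector_near gR1 ykn sk); first by left.
  rewrite nR ltr_normr => /orP[|] lt1; last by exfalso; lra.
  right; split; last lra.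
  by apply/eqP; rewrite -leqn0 -ltnS -(ltr_nat R); lra.
have close k l : (k < n)%N -> (l < n)%N -> odd k = odd l -> `|y - k%:R| < 1 ->
    `|y - l%:R| < 1 -> (k <= l)%N.
  move=> kn ln okl; rewrite !ltr_norml => yk yl.
  have : (k < l + 2)%N by rewrite -(ltr_nat R) natrD; lra.
  by lia.
have far k l : (k < n)%N -> (l < n)%N -> odd k = odd l -> `|y - k%:R| < 1 ->
    l = 0%N -> n%:R - 1 < y -> k = l.
  move=> kn ln okl; rewrite ltr_norml => yk l0 ny; exfalso.
  have : (n < k + 2)%N by rewrite -(ltr_nat R) natrD; lra.
  by rewrite l0 in okl; lia.
case: (near _ ltin si) => [yi|[i0 ny]]; case: (near _ ltjn sj) => [yj|[j0 ny']].
- by apply/anti_leq/andP; split; apply: close.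
- exact: far.
- by apply/esym/far.
- by rewrite i0 j0.
Qed.

Lemma sec_open i d : sec i d -> \forall d' \near d, sec i d'.
Proof.
move=> [s1 s2].
have c1 : continuous (fun d : D => (disc_val d).1).
  exact: (comp_cts (@disc_val_cts R) (@fst_cts _ _)).
have c2 : continuous (fun d : D => (disc_val d).2).
  exact: (comp_cts (@disc_val_cts R) (@snd_cts _ _)).
have cc (a : R * R) : continuous (fun d => cross a (disc_val d)).
  by rewrite /cross => d'; exact: (cvgB (@scale_cts R D _ a.1 c2 d') (@scale_cts R D _ a.2 c1 d')).
have cc' (a : R * R) : continuous (fun d => cross (disc_val d) a).
  have -> : (fun d => cross (disc_val d) a) =
      (fun d => a.2 * (disc_val d).1 - a.1 * (disc_val d).2).
    by apply/funext => d'; rewrite /cross mulrC [X in _ - X]mulrC.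
  by move=> d'; exact: (cvgB (@scale_cts R D _ a.2 c1 d') (@scale_cts R D _ a.1 c2 d')).
apply: filterI.
  by apply: (cc _ d [set r | 0 < r]); apply: open_nbhs_nbhs; split=> //; exact: open_gt.
by apply: (cc' _ d [set r | 0 < r]); apply: open_nbhs_nbhs; split=> //; exact: open_gt.
Qed.

End Gluing.

(** * Charts of the surface and coverings *)

Lemma natrR (R : realType) k (i0 : nat) : (2 * k <= i0 <= 2 * k + 2)%N ->
  (4 * k + 6 - i0)%:R = (4 * k + 6)%:R - i0%:R :> R.
Proof. by move=> ?; rewrite natrB //; lia. Qed.

Lemma positive_sideP (g k : nat) : positive_side g k -> (2 * k + 6 <= 8 * g)%N.
Proof. by case/andP; lia. Qed.

Lemma odd_mod_n (g i : nat) : odd (i %% (8 * g)) = odd i.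
Proof. by rewrite [in RHS](divn_eq i (8 * g)) oddD oddM oddM /= andbF. Qed.

Lemma subBB (R : realType) (K y z : R) : K - y - (K - z) = - (y - z).
Proof. ring. Qed.

Section Charts.
Context {R : realType} (g : nat).
Hypothesis g0 : (0 < g)%N.
Local Notation D := (disc R).
Local Notation X := (surface R g).
Local Notation I := (unitI R).
Local Notation EG := (circ (g%:R : R)).
Local Notation n := (8 * g)%N.
Local Notation vtx := (vtx g).
Local Notation sec := (sec g).
Local Notation quo := (@quo R g).
Implicit Types (d : D) (y : R) (a b : option nat).

Let G1 : 1 <= g%:R :> R := gR1 g0.

(* [None] is the open disc; [Some j] is the star of the point [vtx j] of the
   circle, that is the union of the sectors whose centres are glued to it. *)
Definition chart a : set D := match a with
  | None => [set d | sqn (disc_val d) < 1]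
  | Some j => [set d | exists i, [/\ (i < n)%N, odd i = odd j,
                 quo (vtx i%:R) = quo (vtx j%:R) & sec i d]]
  end.

Lemma sec_pairl k y i : positive_side g k -> (2 * k)%:R <= y <= (2 * k + 2)%:R ->
  (i < n)%N -> sec i (vtx y) ->
  exists i0, [/\ (2 * k <= i0 <= 2 * k + 2)%N, `|y - i0%:R| < 1 & i = (i0 %% n)%N].
Proof. by move=> /positive_sideP kp yk ltin si; apply: sec_index => //; lia. Qed.

Lemma sec_pairr k y i : positive_side g k -> (2 * k)%:R <= y <= (2 * k + 2)%:R ->
  (i < n)%N -> sec i (vtx ((4 * k + 6)%:R - y)) ->
  exists i0, [/\ (2 * k <= i0 <= 2 * k + 2)%N, `|y - i0%:R| < 1 &
    i = ((4 * k + 6 - i0) %% n)%N].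
Proof.
move=> /positive_sideP kp yk ltin si.
have [||i0 [i0k yi0 ->]] := @sec_index R g g0 (2 * k + 4) i _ _ _ ltin si.
- by lia.
- by move: yk; rewrite ?(natrD, natrM); lra.
have i0E : i0 = (4 * k + 6 - (4 * k + 6 - i0))%N by lia.
exists (4 * k + 6 - i0)%N; split; [lia| |by rewrite -i0E].
move: yi0; rewrite {1}i0E natrR; last lia.
by rewrite subBB normrN.
Qed.

Lemma sec_refl k y i0 : (2 * k <= i0 <= 2 * k + 2)%N -> `|y - i0%:R| < 1 ->
  sec (4 * k + 6 - i0) (vtx ((4 * k + 6)%:R - y)).
Proof.
move=> i0k yi; apply: sec_vtx => //; rewrite natrR //.
by rewrite subBB normrN.
Qed.

Lemma quo_vtx_nat k i0 : positive_side g k -> (2 * k <= i0 <= 2 * k + 2)%N ->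
  quo (vtx (i0 %% n)%:R) = quo (vtx ((4 * k + 6 - i0) %% n)%:R).
Proof.
move=> kp i0k; have := positive_sideP kp => kn.
rewrite !vtx_mod //; try lia; rewrite natrR //; apply: quo_vtx => //.
by rewrite !ler_nat.
Qed.

(** On the boundary, gluing along side [k] carries the sector of [i0] to that of [4 * k + 6 - i0],
    whose centre has the same parity and is glued to the first centre. *)
Lemma chart_pairing a d d' : side_pairing g d d' -> chart a d <-> chart a d'.
Proof.
move=> /(side_pairingP g0)[k [y [kp yk dE d'E]]].
case: a => [j|] /=; last by rewrite dE d'E !sqn_E.
rewrite (vtx_eq dE) (vtx_eq d'E); have kn := positive_sideP kp.
have n0 : (0 < n)%N by rewrite muln_gt0.
split=> -[i [ltin oi qi si]].
  have [i0 [i0k yi iE]] := sec_pairl kp yk ltin si.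
  exists ((4 * k + 6 - i0) %% n)%N; split; first by rewrite ltn_mod.
  - by rewrite odd_mod_n -oi iE odd_mod_n; lia.
  - by rewrite -quo_vtx_nat // -iE.
  - by apply/(sec_mod g0); [lia|exact: sec_refl].
have [i0 [i0k yi iE]] := sec_pairr kp yk ltin si.
exists (i0 %% n)%N; split; first by rewrite ltn_mod.
- by rewrite odd_mod_n -oi iE odd_mod_n; lia.
- by rewrite (quo_vtx_nat kp i0k) -iE.
- by apply/(sec_mod g0); [lia|exact: sec_vtx].
Qed.

Lemma chart_quo a d d' : quo d = quo d' -> chart a d <-> chart a d'.
Proof.
move=> /quoP; elim=> {d d'} [d d'|d|d d' _|d1 d2 d3 _ + _]; [exact: chart_pairing|..]; tauto.
Qed.

Lemma chart_cover d : exists a, chart a d.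
Proof.
have := discP d; rewrite le_eqVlt => /orP[/eqP d1|d1]; last by exists None.
have [i ltin si] := sec_unit g0 d1.
by exists (Some i); exists i.
Qed.

(** By [sec_uniq] at most one sector qualifies; the value is [n] if none does. *)
Definition sidx (o : bool) d : nat :=
  find (fun i => `[< sec i d >] && (odd i == o)) (iota 0 n).

Lemma sidxE i d : (i < n)%N -> sec i d -> sidx (odd i) d = i.
Proof.
move=> ltin si; rewrite /sidx; set P := fun _ => _.
have hP : has P (iota 0 n).
  by apply/hasP; exists i; rewrite ?mem_iota //; apply/andP; split=> //; apply/asboolP.
have := nth_find 0%N hP; have := hP; rewrite has_find size_iota => fn.
rewrite nth_iota // add0n => /andP[/asboolP sf /eqP of'].
exact: (sec_uniq g0 fn ltin of' sf si).
Qed.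

Lemma chart_near a d : chart a d -> \forall d' \near d, chart a d'.
Proof.
case: a => [j|] /=.
  move=> [i [ltin oi qi si]]; near=> d'; exists i; split=> //.
  by near: d'; exact: sec_open.
move=> d1.
have cs : continuous (fun d => sqn (disc_val d)).
  by move=> d'; apply: sqn_cts_at; exact: disc_val_cts.
apply: (cs d [set r | r < 1]); apply: open_nbhs_nbhs; split=> //; exact: open_lt.
Unshelve. all: by end_near. Qed.

Section Transition.
Context {G : groupType} (N : nat -> G) (c : nat -> G).
Hypothesis N0 : N n = N 0%N.
(** [N i] is the label of sector [i]. Crossing side [k] must have the same effect at its two corners
    ([i] even) and at its midpoint ([i] odd). *)
Hypothesis Nc : forall k i, positive_side g k -> (2 * k <= i <= 2 * k + 2)%N ->
  ((N i)^-1 * N (4 * k + 6 - i)%N)%g = c k.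

Definition Phi a d : G := if a is Some j then N (sidx (odd j) d) else 1%g.

Lemma N_mod i : (i <= n)%N -> N (i %% n) = N i.
Proof.
rewrite leq_eqVlt => /orP[/eqP ->|?]; last by rewrite modn_small.
by rewrite modnn N0.
Qed.

Lemma Phi_pairing a k y : positive_side g k ->
  (2 * k)%:R <= y <= (2 * k + 2)%:R -> chart a (vtx y) ->
  Phi a (vtx ((4 * k + 6)%:R - y)) = (Phi a (vtx y) * c k)%g.
Proof.
move=> kp yk; case: a => [j|] /=; last by rewrite vtxE sqn_E ltxx.
move=> [i [ltin oi qi si]]; have kn := positive_sideP kp.
have n0 : (0 < n)%N by rewrite muln_gt0.
have [i0 [i0k yi iE]] := sec_pairl kp yk ltin si.
have si' : sec ((4 * k + 6 - i0) %% n) (vtx ((4 * k + 6)%:R - y)).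
  by apply/(sec_mod g0); [lia|exact: sec_refl].
have oi' : odd ((4 * k + 6 - i0) %% n) = odd j.
  by rewrite odd_mod_n -oi iE odd_mod_n; lia.
rewrite -{1}oi' (sidxE _ si') ?ltn_mod // -oi (sidxE _ si) // iE.
by rewrite !N_mod; [rewrite -(Nc kp i0k) mulVKg|lia..].
Qed.

(** Crossing a side multiplies both values on the right by the same [c k], which cancels in the
    quotient. *)
Lemma Phi_quo a b d d' : quo d = quo d' -> chart a d -> chart b d ->
  (Phi b d / Phi a d = Phi b d' / Phi a d')%g.
Proof.
move=> /quoP; elim=> {d d'}
    [d d' dd'|d //|d d' /quoP dd' IH|d1 d2 d3 /quoP d12 IH12 _ IH23] ca cb.
- have [k [y [kp yk dE d'E]]] := (side_pairingP g0 _ _).1 dd'.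
  rewrite {dd'} (vtx_eq d'E); move/vtx_eq: dE ca cb => -> ca cb.
  rewrite (Phi_pairing kp yk ca) (Phi_pairing kp yk cb).
  by rewrite invgM !mulgA mulgK.
- by rewrite IH //; exact/(chart_quo _ dd').
- by rewrite IH12 // IH23 //; exact/(chart_quo _ d12).
Qed.

Lemma Phi_near a d : chart a d -> \forall d' \near d, Phi a d' = Phi a d.
Proof.
case: a => [j|] /=; last by move=> _; near=> d'.
move=> [i [ltin oi qi si]]; near=> d'.
by rewrite -oi !(sidxE ltin) //; near: d'; exact: sec_open.
Unshelve. all: by end_near. Qed.

Definition charted a (x : X) : Prop := chart a (repr x).
Definition phi a (x : X) : G := Phi a (repr x).

Lemma chart_repr a d : chart a (repr (quo d)) <-> chart a d.
Proof. by apply: chart_quo; rewrite quo_repr. Qed.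

Lemma charted_open a : open (charted a).
Proof.
apply: open_quo.
have -> : quo @^-1` charted a = chart a.
  by apply/seteqP; split=> d /= /chart_repr.
rewrite openE => d; exact: chart_near.
Qed.

Lemma charted_cover (x : X) : exists a, charted a x.
Proof. exact: chart_cover. Qed.

(** The choice of [repr] may make [phi] jump, but by [Phi_quo] the quotient can be computed at any
    preimage in the disc, where both functions are locally constant. *)
Lemma phi_near a b x : charted a x -> charted b x ->
  \forall y \near x, (phi b y / phi a y = phi b x / phi a x)%g.
Proof.
move=> ca cb.
pose A := [set y : X | [/\ charted a y, charted b y &
  (phi b y / phi a y = phi b x / phi a x)%g]].
suff oA : open A.
  by have : nbhs x A; [exact: open_nbhs_nbhs|apply: filterS => y []].
apply: open_quo; rewrite openE => d [/chart_repr ca' /chart_repr cb' cd].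
have rd d' : chart a d' -> chart b d' ->
    (phi b (quo d') / phi a (quo d') = Phi b d' / Phi a d')%g.
  by move=> ca'' cb''; apply: esym; apply: Phi_quo => //; rewrite quo_repr.
near=> d'.
have ca'' : chart a d' by near: d'; exact: chart_near.
have cb'' : chart b d' by near: d'; exact: chart_near.
split; [exact/chart_repr|exact/chart_repr|].
rewrite -cd !rd //; congr (_ / _)%g.
  by near: d'; exact: Phi_near.
by near: d'; exact: Phi_near.
Unshelve. all: by end_near. Qed.

(** The correction of [Phi] for the choice of [repr]: divided by [phi a (quo d)] it gives the
    inverse of [Phi a d], which is locally constant. Hence [transport] along a path of the disc is a
    lift of its image. *)
Definition transport d : G :=
  let a := projT1 (cid (chart_cover d)) in ((Phi a d)^-1 * Phi a (repr (quo d)))%g.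

Lemma transportE a d : chart a d ->
  transport d = ((Phi a d)^-1 * Phi a (repr (quo d)))%g.
Proof.
move=> ca; rewrite /transport; case: cid => b /= cb.
have := Phi_quo (esym (quo_repr (quo d))) ca cb.
move=> /(congr1 (fun x => (Phi b d)^-1 * x * Phi a (repr (quo d)))%g).
by rewrite !mulgA mulVg mul1g mulgVK.
Qed.

Lemma transport_repr (x : X) : transport (repr x) = 1%g.
Proof.
by have [a ca] := chart_cover (repr x); rewrite (transportE ca) quo_repr mulVg.
Qed.

Lemma transport_pairing k y : positive_side g k ->
  (2 * k)%:R <= y <= (2 * k + 2)%:R ->
  (transport (vtx y) / transport (vtx ((4 * k + 6)%:R - y)) = c k)%g.
Proof.
move=> kp yk; have [a ca] := chart_cover (vtx y).
have qE := quo_vtx g0 kp yk.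
have ca' : chart a (vtx ((4 * k + 6)%:R - y)) by exact/(chart_quo _ qE).
rewrite (transportE ca) (transportE ca') -qE (Phi_pairing kp yk ca).
by rewrite !invgM !invgK -!mulgA mulVKg mulKg.
Qed.

Lemma lifts_quo (p : I -> D) : continuous p ->
  lifts charted phi (quo \o p) (transport \o p).
Proof.
move=> cp t a /chart_repr ca.
have H d : chart a d -> (transport d / phi a (quo d) = (Phi a d)^-1)%g.
  by move=> /transportE ->; rewrite /phi mulgK.
near=> u.
have cu : chart a (p u) by near: u; apply: cp; exact: chart_near.
have cPhi : Phi a (p u) = Phi a (p t) by near: u; exact: (cp t _ (Phi_near ca)).
by rewrite /= !H // cPhi.
Unshelve. all: by end_near. Qed.

Lemma hol_quo (p : I -> D) : continuous p ->
  hol charted_open charted_cover phi_near (quo \o p) =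
  ((transport (p zero))^-1 * transport (p one))%g.
Proof.
by move=> cp; rewrite (holE _ _ _ _ (lifts_quo cp)) //; exact: (comp_cts cp (@quo_cts R g)).
Qed.

End Transition.
End Charts.

(** * Contraction of the charts *)

Section Contraction.
Context {R : realType} (g : nat).
Hypothesis g0 : (0 < g)%N.
Local Notation D := (disc R).
Local Notation X := (surface R g).
Local Notation I := (unitI R).
Local Notation EG := (circ (g%:R : R)).
Local Notation n := (8 * g)%N.
Local Notation vtx := (vtx g).
Local Notation sec := (sec g).
Local Notation quo := (@quo R g).
Implicit Types (d : D) (y : R) (a b : option nat).

(* Radial rescaling of the segment from [d] to the point [circ g c] of the
   circle, so that the boundary of the disc is preserved *)
Definition rad (c : R) (z : D * I) : D :=
  let v := mix (uval z.2) (disc_val z.1) (EG c) in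
  retractD (scal ((1 - uval z.2 + uval z.2 * nrm (disc_val z.1)) / nrm v) v).

Lemma dot_EE c : dot (EG c) (EG c) = 1.
Proof. by have := sqn_E (g%:R : R) c; rewrite /sqn !expr2. Qed.

(** The inner product with the centre of the sector is positive at both ends of the segment, which
    therefore avoids the origin, where the rescaling in [rad] breaks down. *)
Lemma nrm_mix c d (t : I) : sector (g%:R : R) c (disc_val d) ->
  0 < nrm (mix (uval t) (disc_val d) (EG c)).
Proof.
move=> /(sector_dot (gR1 g0)) h; apply: (@dot_nrm R _ (EG c)).
have -> : dot (mix (uval t) (disc_val d) (EG c)) (EG c) =
  uval t * dot (disc_val d) (EG c) + (1 - uval t) * dot (EG c) (EG c).
  by rewrite /dot /=; ring.
rewrite dot_EE mulr1; move: h; rewrite -/(dot _ _); move: (dot _ _) => x x0.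
have /andP[t0 t1] := uvalP t.
case: (ltP (uval t) 1) => t1'; last by have -> : uval t = 1 by [lra|]; lra.
have : 0 <= uval t * x by rewrite mulr_ge0 // ltW.
lra.
Qed.

Lemma rad_one c d : sector (g%:R : R) c (disc_val d) -> rad c (d, one) = d.
Proof.
move=> /(nrm_mix one); rewrite /rad /= unitI_one.
have -> : mix 1 (disc_val d) (EG c) = disc_val d.
  by rewrite /mix subrr !mul0r !addr0 !mul1r -surjective_pairing.
move=> r0; rewrite subrr add0r mul1r divff ?gt_eqF //.
by rewrite /scal !mul1r -surjective_pairing retractDK.
Qed.

Lemma rad_zero c d : rad c (d, zero) = vtx c.
Proof.
rewrite /rad /= unitI_zero.
have -> : mix 0 (disc_val d) (EG c) = EG c.
  by rewrite /mix subr0 !mul0r !add0r !mul1r -surjective_pairing.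
rewrite mul0r addr0 subr0 /nrm sqn_E sqrtr1 divr1.
by rewrite /scal !mul1r -surjective_pairing.
Qed.

Lemma rad_cts c d (t : I) : sector (g%:R : R) c (disc_val d) ->
  {for (d, t), continuous (rad c)}.
Proof.
move=> sd.
have ct : {for (d, t), continuous (fun z : D * I => uval z.2)}.
  exact: (comp_cts (@snd_cts _ _) (@uval_continuous R)).
have cd : {for (d, t), continuous (fun z : D * I => disc_val z.1)}.
  exact: (comp_cts (@fst_cts _ _) (@disc_val_cts R)).
have cn : {for (d, t), continuous (fun z : D * I => nrm (disc_val z.1))}.
  exact: (nrm_cts_at cd).
have cE : {for (d, t), continuous (fun z : D * I => EG c)} by exact: cvg_cst.
have cv := mix_cts_at ct cd cE.
have cnv := nrm_cts_at cv.
apply: continuous_comp; last exact: retractD_cts.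
apply: scal_cts_at => //.
have c1 : {for (d, t), continuous (fun z : D * I => 1 - uval z.2)}.
  by apply: cvgB; [exact: cvg_cst | exact: ct].
apply: cvgM; last by apply: cvgV => //; rewrite gt_eqF //; exact: nrm_mix.
by apply: cvgD => //; apply: cvgM.
Qed.

Lemma mix_refl m (t : R) p p' : mix t (refl (g%:R : R) m p) (refl (g%:R : R) m p') =
  refl (g%:R : R) m (mix t p p').
Proof. by rewrite /mix /refl /=; congr pair; ring. Qed.

Lemma scal_refl m (t : R) p : scal t (refl (g%:R : R) m p) = refl (g%:R : R) m (scal t p).
Proof. by rewrite /scal /refl /=; congr pair; ring. Qed.

(** Reflections commute with [mix] and [scal], so the contraction on the glued side is the mirror
    image of that on side [k]. It keeps the point on the circle and within side [k], hence glued to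
    its mirror image. *)
Lemma rad_pairing k i0 y (t : I) : positive_side g k ->
  (2 * k)%:R <= y <= (2 * k + 2)%:R ->
  (2 * k <= i0 <= 2 * k + 2)%N -> `|y - i0%:R| < 1 ->
  quo (rad i0%:R (vtx y, t)) =
  quo (rad (4 * k + 6 - i0)%:R (vtx ((4 * k + 6)%:R - y), t)).
Proof.
move=> kp yk i0k yi; set m := (4 * k + 6)%:R.
have G1 := gR1 g0 : 1 <= g%:R :> R.
have si : sector (g%:R : R) i0%:R (disc_val (vtx y)) by apply: sec_vtx.
have := nrm_mix t si; rewrite /rad /= !vtxE natrR // -/m.
set v := mix (uval t) (EG y) (EG i0%:R).
have -> : mix (uval t) (EG (m - y)) (EG (m - i0%:R)) = refl (g%:R : R) m v.
  by rewrite -!refl_E mix_refl.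
have nE z : nrm (EG z) = 1 by rewrite /nrm sqn_E sqrtr1.
have -> : nrm (refl (g%:R : R) m v) = nrm v by rewrite /nrm sqn_refl.
rewrite !nE mulr1 subrK scal_refl; set u := scal _ v => v0.
have u1 : sqn u = 1.
  by rewrite sqn_scal -nrm_sq -exprMn mul1r mulVf ?gt_eqF // expr1n.
have cu p : cross p u = (nrm v)^-1 * (uval t * cross p (EG y) + (1 - uval t) * cross p (EG i0%:R)).
  by rewrite /cross /u /v /= mul1r; ring.
have cu' p : cross u p = (nrm v)^-1 * (uval t * cross (EG y) p + (1 - uval t) * cross (EG i0%:R) p).
  by rewrite /cross /u /v /= mul1r; ring.
have /andP[t0 t1] := uvalP t.
have i0kR : (2 * k)%:R <= (i0%:R : R) <= (2 * k + 2)%:R by rewrite !ler_nat.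
have kE : (2 * k + 2)%:R = (2 * k + 1)%:R + 1 :> R by rewrite natr1 addn1 addn2.
have kE' : (2 * k)%:R = (2 * k + 1)%:R - 1 :> R by rewrite natrD addrK.
rewrite kE kE' in yk i0kR.
(* The closed cone around the midpoint [2 * k + 1] is convex and contains the points of parameters
   [y] and [i0], hence also [u]. *)
have [|| y' y'k uE] := @closed_sector R (g%:R : R) G1 (2 * k + 1)%:R u u1.
- rewrite cu !cross_E mulr_ge0 ?invr_ge0 ?nrm_ge0 // addr_ge0 // mulr_ge0 ?subr_ge0 //;
    by apply: (sin_ang_ge0 G1); lra.
- rewrite cu' !cross_E mulr_ge0 ?invr_ge0 ?nrm_ge0 // addr_ge0 // mulr_ge0 ?subr_ge0 //;
    by apply: (sin_ang_ge0 G1); lra.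
rewrite uE refl_E; apply: quo_vtx => //; move: y'k; rewrite kE kE' ler_norml; lra.
Qed.

Definition ctr a (z : D * I) : D := match a with
  | None => retractD (scal (uval z.2) (disc_val z.1))
  | Some j => rad (sidx g (odd j) z.1)%:R z
  end.

Lemma ctr_one a d : chart g a d -> ctr a (d, one) = d.
Proof.
case: a => [j|] /=; last by move=> _; rewrite unitI_one /scal !mul1r -surjective_pairing retractDK.
by move=> [i [ltin <- _ si]]; rewrite sidxE // rad_one.
Qed.

(** At time zero a star is reduced to the centres of its sectors, all glued to one point, and the
    open disc to the origin. *)
Lemma ctr_zero a d d' : chart g a d -> chart g a d' ->
  quo (ctr a (d, zero)) = quo (ctr a (d', zero)).
Proof.
case: a => [j|] /=.
  move=> [i [ltin oi qi si]] [i' [ltin' oi' qi' si']].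
  by rewrite !rad_zero -{1}oi sidxE // -oi' sidxE // qi qi'.
by move=> _ _; rewrite unitI_zero /scal !mul0r.
Qed.

Lemma ctr_cts a d (t : I) : chart g a d -> {for (d, t), continuous (ctr a)}.
Proof.
case: a => [j|] /=.
  move=> [i [ltin oi _ si]].
  have cr := @rad_cts i%:R d t si.
  have near_i : \forall z \near (d, t), rad i%:R z = ctr (Some j) z.
    near=> z; rewrite /= -oi sidxE //; near: z.
    by apply: (@fst_cts D I (d, t)); exact: sec_open.
  move=> A; rewrite /= -oi sidxE // => /cr.
  by apply: filterS2 near_i => z /= ->.
move=> _; apply: continuous_comp; last exact: retractD_cts.
apply: scal_cts_at.
  exact: (comp_cts (@snd_cts _ _) (@uval_continuous R)).
exact: (comp_cts (@fst_cts _ _) (@disc_val_cts R)).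
Unshelve. all: by end_near. Qed.

Lemma ctr_pairing a d d' (t : I) : side_pairing g d d' -> chart g a d ->
  quo (ctr a (d, t)) = quo (ctr a (d', t)).
Proof.
move=> dd' ca; have ca' := (chart_pairing g0 a dd').1 ca.
have [k [y [kp yk dE d'E]]] := (side_pairingP g0 _ _).1 dd'.
move: ca ca'; rewrite (vtx_eq dE) (vtx_eq d'E) => ca ca'.
case: a ca ca' => [j|] /=; last by rewrite vtxE sqn_E ltxx.
move=> [i [ltin oi qi si]] _; have kn := positive_sideP kp.
have n0 : (0 < n)%N by rewrite muln_gt0.
have [i0 [i0k yi iE]] := sec_pairl g0 kp yk ltin si.
have si' : sec ((4 * k + 6 - i0) %% n) (vtx ((4 * k + 6)%:R - y)).
  by apply/(sec_mod g0); [lia|exact: sec_refl].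
have oi' : odd ((4 * k + 6 - i0) %% n) = odd j.
  by rewrite odd_mod_n -oi iE odd_mod_n; lia.
rewrite -{2}oi' (sidxE g0 _ si') ?ltn_mod // -oi (sidxE g0 _ si) // iE.
have rad_mod l z : (l <= n)%N -> rad (l %% n)%:R z = rad l%:R z.
  move=> ln; rewrite /rad; have -> // : EG (l %% n)%:R = EG l%:R.
  by rewrite -!vtxE vtx_mod.
by rewrite !rad_mod; [exact: rad_pairing|lia..].
Qed.

Lemma ctr_quo a d d' (t : I) : quo d = quo d' -> chart g a d ->
  quo (ctr a (d, t)) = quo (ctr a (d', t)).
Proof.
move=> /quoP; elim=> {d d'}
    [d d' dd'|d //|d d' /quoP dd' IH|d1 d2 d3 /quoP d12 IH12 _ IH23] ca.
- exact: ctr_pairing.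
- by rewrite IH //; exact/(chart_quo g0 _ dd').
- by rewrite IH12 // IH23 //; exact/(chart_quo g0 _ d12).
Qed.

Definition ctrX a (z : X * I) : X := quo (ctr a (repr z.1, z.2)).

(* The quotient map times the identity of [I] is a quotient map because [I] is
   locally compact. *)
Lemma ctrX_cts a (x : X) (t : I) : charted a x -> {for (x, t), continuous (ctrX a)}.
Proof.
move=> ca W; rewrite nbhsE => -[W0 [oW0 W0x] W0W].
have cq z : chart g a z.1 -> {for z, continuous (quo \o ctr a)}.
  by case: z => d s cd; apply: continuous_comp; [exact: ctr_cts|exact: quo_cts].
pose P (d : D) (s : I) := W0 (quo (ctr a (d, s))).
have Pnear d s : chart g a d -> P d s -> \forall z \near (d, s), P z.1 z.2.
  move=> cd Pds; have := cq (d, s) cd W0; rewrite /= => H.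
  have : \forall z \near (d, s), W0 ((quo \o ctr a) z).
    by apply: H; exact: open_nbhs_nbhs.
  by apply: filterS => -[].
have [e e0 He] : exists2 e : R, 0 < e & forall u : I,
    `|uval u - uval t| <= e -> P (repr x) u.
  have [[A B] /= [Ax /near_unitI[e e0 He]] AB] := Pnear _ _ ca W0x.
  exists (e / 2); first by rewrite divr_gt0.
  move=> u ut; apply: (AB (repr x, u)); split=> /=; first exact: nbhs_singleton.
  by apply: He; apply: le_lt_trans ut _; rewrite gtr_pMr //; lra.
(* Tube lemma: [O] consists of the points of the chart whose contraction stays in [W0] during the
   whole interval [K] of times. It is open by compactness of [K], and saturated, so it descends to
   the surface. *)
pose K := `[uval t - e, uval t + e]%classic.
pose O := [set d | chart g a d /\ forall r, K r -> P d (clamp r)].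
have Osat d d' : quo d = quo d' -> O d -> O d'.
  move=> dd' [cd Kd]; split; first exact/(chart_quo g0 _ dd').
  by move=> r Kr; rewrite /P -(ctr_quo _ dd') //; exact: Kd.
have oO : open O.
  rewrite openE => d [cd Kd].
  have cK := (compact_near_coveringP _).1 (@segment_compact R (uval t - e) (uval t + e)).
  have KP : \forall d' \near d, K `<=` (fun r => P d' (clamp r)).
    apply: (cK D (nbhs d) (fun d' r => P d' (clamp r))) => r Kr.
    have [[A B] /= [Ad Br] AB] := Pnear _ _ cd (Kd r Kr).
    exists (clamp @^-1` B, A) => /=; first by split=> //; exact: clamp_continuous.
    by move=> [r' d'] /= [Br' Ad']; exact: (AB (d', clamp r')).
  near=> d'; split; first by near: d'; exact: chart_near.
  by near: d'.
have oO' : open [set y : X | O (repr y)].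
  apply: open_quo; have -> : quo @^-1` [set y : X | O (repr y)] = O => //.
  by apply/seteqP; split=> d /=; apply: Osat; rewrite quo_repr.
have Ox : O (repr x).
  split=> // r; rewrite /K /= in_itv /= => Kr; apply: He.
  have /andP[t0 t1] := uvalP t.
  rewrite uval_clamp; case: (leP 1 r) => r1; case: (leP 0 _) => r0; rewrite ler_norml; lra.
exists ([set y | O (repr y)], [set u : I | `|uval u - uval t| < e]).
  by split; [apply: open_nbhs_nbhs; split | exact: unitI_near].
move=> [y u] /= [[cy Ky]]; rewrite ltr_norml => ue; apply: W0W.
rewrite /ctrX /= -(clampK u); apply: Ky; rewrite /K /= in_itv /=; lra.
Unshelve. all: by end_near. Qed.

Lemma ctrX_one a (x : X) : charted a x -> ctrX a (x, one) = x.
Proof. by move=> ca; rewrite /ctrX /= ctr_one // quo_repr. Qed.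

End Contraction.

(** * Generation of the fundamental group by the crossings of sides *)

Section Generation.
Context {R : realType} (g : nat).
Hypothesis g0 : (0 < g)%N.
Local Notation D := (disc R).
Local Notation X := (surface R g).
Local Notation I := (unitI R).
Local Notation n := (8 * g)%N.
Local Notation vtx := (vtx g).
Local Notation quo := (@quo R g).
Context (x0 : X).
Implicit Types (d : D) (y : R) (a b : option nat).

Definition ray d : I -> X := quo \o segD (repr x0) d.

Lemma segDc d d' : continuous (segD d d').
Proof.
by apply: (@segD_cts R I (fun=> d) (fun=> d') id) => // s; [exact: cst_continuous..|].
Qed.

Lemma ray_cts d : continuous (ray d).
Proof. by apply: comp_cts; [exact: segDc|exact: quo_cts]. Qed.

Lemma ray0 d : ray d zero = x0.
Proof. by rewrite /ray /= segD0 quo_repr. Qed.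

Lemma ray1 d : ray d one = quo d.
Proof. by rewrite /ray /= segD1. Qed.

Definition lam (x : X) : {path I from x0 to x} :=
  mk_path (@ray_cts (repr x)) (ray0 _) (etrans (ray1 _) (quo_repr x)).

Lemma lam_base : lam x0 =1 cst x0.
Proof. by move=> s; rewrite -[LHS]/(ray (repr x0) s) /ray /= segDxx quo_repr. Qed.

Local Notation kappa := (kappa lam).

(** The loop that goes straight to [d] and comes back from the representative of its class. It
    records the jump between the two, as [transport] does in a covering. *)
Definition ray_class d : pi1 R x0 := kappa (ray d).

(** The disc is convex: the ray to the start of [p] followed by [p] is homotopic to the ray to its
    end. *)
Lemma kappa_quo (p : I -> D) : continuous p ->
  kappa (quo \o p) = ((ray_class (p zero))^-1 * ray_class (p one))%g.
Proof.
move=> cp; apply: (mulgI (ray_class (p zero))); rewrite mulVKg.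
rewrite -(kappa_cat lam (@ray_cts _) (comp_cts cp (@quo_cts R g))) ?ray1 //.
have -> : pcat (ray (p zero)) (quo \o p) = quo \o pcat (segD (repr x0) (p zero)) p.
  by rewrite comp_pcat.
set r := pcat _ _.
have cr : continuous r by apply: pcat_cts => //; [exact: segDc|rewrite segD1].
have r0 : r zero = repr x0 by rewrite /r pcat0 segD0.
have r1 : r one = p one by rewrite /r pcat1.
apply: (kappa_htpy lam (comp_cts cr (@quo_cts R g)) (@ray_cts _)).
exists (fun z => quo (segD (r z.1) (segD (repr x0) (p one) z.1) z.2)); split=> [|s|s|s|s] /=.
- apply: (comp_cts _ (@quo_cts R g)); apply: segD_cts.
  + exact: (comp_cts (@fst_cts _ _) cr).
  + exact: (comp_cts (@fst_cts _ _) (@segDc _ _)).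
  + exact: snd_cts.
- by rewrite segD0.
- by rewrite segD1.
- by rewrite r0 segD0 segDxx.
- by rewrite r1 segD1 segDxx.
Qed.

Lemma ray_class_repr (x : X) : ray_class (repr x) = 1%g.
Proof.
have E0 : kappa (lam x0) = 1%g.
  by rewrite (_ : (lam x0 : I -> X) = fun=> x0) ?kappa_cst //; apply/funext; exact: lam_base.
rewrite /ray_class -[RHS]E0 [LHS](kappa_path lam (lam x)).
rewrite [RHS](kappa_path lam (lam x0)) /kap; apply/loop_classP.
have l0 : lam x0 = path_cst x0 by apply/path_eqP => s; exact: lam_base.
have l0' : path_rev (path_cst x0) = path_cst x0 :> {path I from x0 to x0} by apply/path_eqP.
rewrite l0 l0'.
apply: (@homotopic_trans _ _ _ _ _ (path_cst x0)).
  apply: (@homotopic_trans _ _ _ _ _ (path_cat (lam x) (path_rev (lam x)))).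
    apply: homotopic_cat; last exact: homotopic_refl.
    exact: homotopic_cat1p.
  exact: homotopic_catpV.
apply/homotopic_sym; apply: homotopic_trans (homotopic_catp1 _) _.
exact: homotopic_catp1.
Qed.

(** When [y] moves along the side, its two copies in the disc have the same image in the surface,
    and [kappa_quo] evaluates this image in two ways. So a single element is attached to each pair
    of sides. *)
Lemma ray_class_pairing k y y' : positive_side g k ->
  (2 * k)%:R <= y <= (2 * k + 2)%:R -> (2 * k)%:R <= y' <= (2 * k + 2)%:R ->
  (ray_class (vtx y) / ray_class (vtx ((4 * k + 6)%:R - y)) =
   ray_class (vtx y') / ray_class (vtx ((4 * k + 6)%:R - y')))%g.
Proof.
move=> kp yk y'k; set m := (4 * k + 6)%:R.
have cvtx (f : I -> R) : continuous f -> continuous (fun s => vtx (f s)).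
  move=> cf; apply: (comp_cts _ retractD_cts).
  have ca : continuous (fun s => ang (g%:R : R) (f s)).
    have -> : (fun s => ang (g%:R : R) (f s)) = (fun s => pi / (4 * g%:R) * f s).
      by apply/funext => s; rewrite /ang mulrC.
    exact: scale_cts.
  by apply: pair_cts; apply: (comp_cts ca); [exact: continuous_cos|exact: continuous_sin].
pose f (s : I) := (y' - y) * uval s + y.
have cf : continuous f.
  by apply: shift_cts; apply: scale_cts; exact: uval_continuous.
have f0 : f zero = y by rewrite /f unitI_zero mulr0 add0r.
have f1 : f one = y' by rewrite /f unitI_one mulr1 subrK.
have cf' : continuous (fun s => m - f s) by exact: sub_cts.
have E : quo \o (fun s => vtx (f s)) = quo \o (fun s => vtx (m - f s)).
  apply/funext => s; apply: quo_vtx => //; rewrite /f.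
  have /andP[s0 s1] := uvalP s.
  case: (leP y y') => yy'.
    have ? : 0 <= (y' - y) * uval s by rewrite mulr_ge0 // subr_ge0.
    have ? : (y' - y) * uval s <= y' - y by rewrite ler_piMr // subr_ge0.
    lra.
  have ? : 0 <= (y - y') * uval s by rewrite mulr_ge0 // subr_ge0 ltW.
  have ? : (y - y') * uval s <= y - y' by rewrite ler_piMr // subr_ge0 ltW.
  lra.
have := congr1 kappa E.
rewrite (kappa_quo (cvtx _ cf)) (kappa_quo (cvtx _ cf')) f0 f1 => eq.
apply: (mulgI (ray_class (vtx y))^-1%g); rewrite mulKg mulgA eq.
by rewrite mulgK.
Qed.

Section Subgroup.
Context (S : set (pi1 R x0)).
Hypotheses (S1 : S 1%g) (SM : forall u v, S u -> S v -> S (u * v)%g)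
  (SV : forall u, S u -> S (u^-1)%g).
Hypothesis Spair : forall d d', side_pairing g d d' -> S (ray_class d / ray_class d')%g.

(** Pairings are chained from [d] to the representative of its class, whose ray class is trivial. *)
Lemma S_ray d : S (ray_class d).
Proof.
suff H d1 d2 : quo d1 = quo d2 -> S (ray_class d1 / ray_class d2)%g.
  have := H d (repr (quo d)); rewrite quo_repr ray_class_repr divg1; exact.
move=> /quoP; elim=> {d1 d2}
    [d1 d2|d1|d1 d2 _ IH|d1 d2 d3 _ IH12 _ IH23].
- exact: Spair.
- by rewrite mulgV.
- by have := SV IH; rewrite invgM invgK.
- by have := SM IH12 IH23; rewrite mulgA mulgVK.
Qed.

Lemma S_quo (p : I -> D) : continuous p -> S (kappa (quo \o p)).
Proof. by move=> cp; rewrite kappa_quo //; apply: SM; [apply: SV|]; exact: S_ray. Qed.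

(* In a chart every path is homotopic to the path that goes to the centre of
   the contraction and back. *)
Lemma S_chart a (p : I -> X) : continuous p -> (forall s, charted a (p s)) ->
  S (kappa p).
Proof.
move=> cp ca; pose Q (z : I * I) := ctrX a (p z.1, z.2).
have cQ : continuous Q.
  move=> [s t]; apply: continuous_comp; last exact: ctrX_cts.
  exact: (pair_cts (comp_cts (@fst_cts _ _) cp) (@snd_cts _ _)).
have Qone : (fun s => Q (s, one)) = p by apply/funext => s; rewrite /Q ctrX_one.
have Qzero : (fun s => Q (s, zero)) = fun=> Q (zero, zero).
  by apply/funext => s; exact: (ctr_zero g0 (ca s) (ca zero)).
have SQ s : S (kappa (fun t => Q (s, t))).
  rewrite (_ : (fun t => Q (s, t)) = quo \o (fun t => ctr g a (repr (p s), t))) //.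
  apply: S_quo.
  move=> t; apply: (@continuous_comp _ _ _ (fun t => (repr (p s), t))); last exact: (@ctr_cts _ _ g0 _ _ _ (ca s)).
  by apply: (@pair_cts I D I (fun=> repr (p s)) id) => [t'|t' //]; exact: cst_continuous.
have := kappa_square lam cQ; rewrite Qone Qzero kappa_cst mul1g => eq.
by rewrite -(mulKg (kappa (fun t => Q (zero, t))) (kappa p)) eq; apply: SM; [exact: SV|].
Qed.

Lemma S_path (p : I -> X) : continuous p -> S (kappa p).
Proof.
move=> cp; pose A := [set t : I | S (kappa (p \o seg zero t))].
suff : A one.
  rewrite /A /=; have -> // : p \o seg zero one = p.
  apply/funext => s /=; congr p; apply: uval_inj.
  by rewrite uval_seg unitI_zero unitI_one; ring.
have cps s t : continuous (p \o seg s t) by apply: comp_cts => //; exact: seg_cts.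
apply: (@clopen_unitI R A zero) => [|t].
  rewrite /A /=; have -> : p \o seg zero zero = fun=> p zero.
    by apply/funext => s /=; congr p; apply: uval_inj; rewrite uval_seg unitI_zero; ring.
  by rewrite kappa_cst.
have [a ca] := charted_cover g0 (p t).
have /near_unitI[e e0 He] : \forall u \near t, charted a (p u).
  by apply: cp; apply: open_nbhs_nbhs; split=> //; exact: charted_open.
have main r u : `|uval r - uval t| < e -> `|uval u - uval t| < e -> A r -> A u.
  move=> rt ut Ar; rewrite /A /=.
  have chk : S (kappa (p \o seg r u)).
    by apply: (S_chart (a := a)) => // s; apply: He; exact: seg_near.
  have -> : kappa (p \o seg zero u) = (kappa (p \o seg zero r) * kappa (p \o seg r u))%g.
    rewrite -kappa_cat //=; last by rewrite seg0 seg1.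
    rewrite -comp_pcat.
    have cI (h : I -> I) : continuous h -> continuous (fun s => (h s, zero : I)).
      by move=> ch; apply: (@pair_cts I I I h (fun=> zero)) => [//|s]; exact: cst_continuous.
    have cpc : continuous (pcat (seg zero r) (seg r u)).
      by apply: pcat_cts; rewrite ?seg0 ?seg1 //; exact: seg_cts.
    have := @convex_htpy R X (p \o fst) _ _ (comp_cts (@fst_cts _ _) cp)
      (cI _ (@seg_cts R zero u)) (cI _ cpc).
    rewrite /= pcat0 pcat1 !seg0 !seg1 => /(_ erefl erefl); apply: kappa_htpy => //.
    - exact: (comp_cts (@seg_cts R zero u) cp).
    - exact: (comp_cts cpc cp).
  exact: SM.
near=> u; have ut : `|uval u - uval t| < e by near: u; exact: unitI_near.
by split; apply: main; rewrite // subrr normr0.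
Unshelve. all: by end_near. Qed.

Lemma S_all (u : pi1 R x0) : S u.
Proof.
rewrite -(loop_class_repr u) -(kappa_loop lam_base); apply: S_path.
exact: path_cts.
Qed.

End Subgroup.

End Generation.

(** * The surface relation and its universal property *)

Section Presentation.

(** The factors are the commutators of [a j] with the inverse of [b j]: this is the order in which
    the sides are crossed around the vertex. *)
Fixpoint crel {G : groupType} (a b : nat -> G) (i : nat) : G :=
  if i is j.+1 then (crel a b j * (a j * (b j)^-1 * (a j)^-1 * b j))%g else 1%g.

Context {R : realType} (g : nat).
Hypothesis g0 : (0 < g)%N.
Local Notation D := (disc R).
Local Notation X := (surface R g).
Local Notation I := (unitI R).
Local Notation n := (8 * g)%N.
Local Notation vtx := (vtx g).
Local Notation quo := (@quo R g).
Context (x0 : X).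

Local Notation T m := (ray_class x0 (vtx m%:R)).

(** The crossings of the sides [4 * i] and [4 * i + 1], read at their first corner; [gen_aE] and
    [gen_bE] read them at the last one. *)
Definition gen_a (i : nat) : pi1 R x0 := (T (8 * i)%N / T (8 * i + 6)%N)%g.
Definition gen_b (i : nat) : pi1 R x0 := (T (8 * i + 2)%N / T (8 * i + 8)%N)%g.

Lemma ray_class_side k (i : nat) y : positive_side g k ->
  (2 * k <= i <= 2 * k + 2)%N -> (2 * k)%:R <= y <= (2 * k + 2)%:R ->
  (ray_class x0 (vtx y) / ray_class x0 (vtx ((4 * k + 6)%:R - y)) =
   T i / T (4 * k + 6 - i)%N)%g.
Proof.
move=> kp ik yk; rewrite natrR //; apply: ray_class_pairing => //.
by rewrite !ler_nat.
Qed.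

Lemma T_side k i i' : positive_side g k ->
  (2 * k <= i <= 2 * k + 2)%N -> (2 * k <= i' <= 2 * k + 2)%N ->
  (T i / T (4 * k + 6 - i)%N = T i' / T (4 * k + 6 - i')%N)%g.
Proof.
move=> kp ik i'k; rewrite -(@ray_class_side k i' i%:R) //.
  by rewrite natrR.
by rewrite !ler_nat.
Qed.

Lemma positive_side_a i : (i < g)%N -> positive_side g (4 * i).
Proof. by move=> ?; apply/andP; split; lia. Qed.

Lemma positive_side_b i : (i < g)%N -> positive_side g (4 * i + 1).
Proof. by move=> ?; apply/andP; split; lia. Qed.

Lemma gen_aE i : (i < g)%N -> gen_a i = (T (8 * i + 2)%N / T (8 * i + 4)%N)%g.
Proof.
move=> ig; have := @T_side (4 * i) (8 * i) (8 * i + 2) (positive_side_a ig).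
have -> : (4 * (4 * i) + 6 - 8 * i = 8 * i + 6)%N by lia.
have -> : (4 * (4 * i) + 6 - (8 * i + 2) = 8 * i + 4)%N by lia.
by apply; lia.
Qed.

Lemma gen_bE i : (i < g)%N -> gen_b i = (T (8 * i + 4)%N / T (8 * i + 6)%N)%g.
Proof.
move=> ig; have := @T_side (4 * i + 1) (8 * i + 2) (8 * i + 4) (positive_side_b ig).
have -> : (4 * (4 * i + 1) + 6 - (8 * i + 2) = 8 * i + 8)%N by lia.
have -> : (4 * (4 * i + 1) + 6 - (8 * i + 4) = 8 * i + 6)%N by lia.
by apply; lia.
Qed.

(* The relation telescopes along the sides that one crosses when turning around
   the vertex. *)
Lemma gen_rel : crel gen_a gen_b g = 1%g.
Proof.
suff H i : (i <= g)%N -> crel gen_a gen_b i = (T 0%N / T (8 * i)%N)%g.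
  by rewrite H // -(vtx_mod g0 (leqnn n)) modnn mulgV.
elim: i => [|i IH] ig /=; first by rewrite muln0 mulgV.
have -> : (gen_a i * (gen_b i)^-1 * (gen_a i)^-1 * gen_b i =
    T (8 * i)%N / T (8 * i + 6)%N * (T (8 * i + 4)%N / T (8 * i + 6)%N)^-1 *
    (T (8 * i + 2)%N / T (8 * i + 4)%N)^-1 * (T (8 * i + 2)%N / T (8 * i + 8)%N))%g.
  by rewrite -(gen_aE ig) -(gen_bE ig).
rewrite IH ?(ltnW ig) //.
have -> : (8 * i.+1 = 8 * i + 8)%N by lia.
by rewrite !invgM !invgK !mulgA !mulgVK.
Qed.

Lemma gen_generate (S : set (pi1 R x0)) : S 1%g ->
  (forall u v, S u -> S v -> S (u * v)%g) -> (forall u, S u -> S (u^-1)%g) ->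
  (forall i, (i < g)%N -> S (gen_a i) /\ S (gen_b i)) -> forall u, S u.
Proof.
move=> S1 SM SV Sab; apply: (S_all g0 S1 SM SV) => d d'.
move=> /(side_pairingP g0)[k [y [kp yk /vtx_eq -> /vtx_eq ->]]].
rewrite (@ray_class_side k (2 * k)%N y) //; last lia.
have /andP[kg k4] := kp; pose i := (k %/ 4)%N.
have ig : (i < g)%N by rewrite /i; lia.
have [Sa Sb] := Sab i ig.
have [kE|kE] : k = (4 * i)%N \/ k = (4 * i + 1)%N by rewrite /i; lia.
  move: Sa; rewrite /gen_a.
  have -> : (2 * k = 8 * i)%N by lia.
  by have -> : (4 * k + 6 - 8 * i = 8 * i + 6)%N by lia.
move: Sb; rewrite /gen_b.
have -> : (2 * k = 8 * i + 2)%N by lia.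
by have -> : (4 * k + 6 - (8 * i + 2) = 8 * i + 8)%N by lia.
Qed.

(** * Morphisms defined by monodromy *)

Section Universal.
Context {G : groupType} (a b : nat -> G).
Hypothesis ab : crel a b g = 1%g.

(* The values, on the sectors, of a section of the [G]-covering whose
   monodromy is sought *)
Definition label (m : nat) : G := let i := (m %/ 8)%N in
  match (m %% 8)%N with
  | 0 => crel a b i
  | 2 => crel a b i * a i * (b i)^-1 * (a i)^-1
  | 4 => crel a b i * a i * (b i)^-1
  | 5 => a i
  | 6 => crel a b i * a i
  | 7 => b i
  | _ => 1
  end%g.

Definition side_label (k : nat) : G := if (k %% 4 == 0)%N then a (k %/ 4) else b (k %/ 4).

Lemma label_period : label n = label 0.
Proof. by rewrite /label modnMr mulKn // ab. Qed.

Lemma labelE i r : (r < 8)%N -> label (8 * i + r) = let: m := r in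
  match m with
  | 0 => crel a b i
  | 2 => crel a b i * a i * (b i)^-1 * (a i)^-1
  | 4 => crel a b i * a i * (b i)^-1
  | 5 => a i
  | 6 => crel a b i * a i
  | 7 => b i
  | _ => 1
  end%g.
Proof.
move=> r8; rewrite /label.
have -> : ((8 * i + r) %/ 8 = i)%N by lia.
by have -> : ((8 * i + r) %% 8 = r)%N by lia.
Qed.

(** Around the vertex the corners [8 * l], [8 * l + 6], [8 * l + 4], [8 * l + 2], [8 * l + 8] follow
    each other; the label is multiplied in turn by [a l], the inverses of [b l] and of [a l], and
    [b l], which leads from one [crel] to the next. Each midpoint is glued to a single other one, so
    its label can start from 1. *)
Lemma label_side k i : positive_side g k -> (2 * k <= i <= 2 * k + 2)%N ->
  ((label i)^-1 * label (4 * k + 6 - i)%N)%g = side_label k.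
Proof.
move=> /andP[kg k4] ik; pose l := (k %/ 4)%N.
have l0 : label (8 * l.+1) = crel a b l.+1.
  by rewrite -[(8 * l.+1)%N]addn0 labelE.
have [kE|kE] : k = (4 * l)%N \/ k = (4 * l + 1)%N by rewrite /l; lia.
  have -> : side_label k = a l by rewrite /side_label kE modnMr mulKn.
  have [iE|[iE|iE]] : i = (8 * l + 0)%N \/ i = (8 * l + 1)%N \/ i = (8 * l + 2)%N by lia.
  - have -> : (4 * k + 6 - i = 8 * l + 6)%N by lia.
    by rewrite iE !labelE // mulKg.
  - have -> : (4 * k + 6 - i = 8 * l + 5)%N by lia.
    by rewrite iE !labelE // invg1 mul1g.
  - have -> : (4 * k + 6 - i = 8 * l + 4)%N by lia.
    by rewrite iE !labelE // [((_ / a l)^-1)%g]invgM invgK mulgVK.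
have -> : side_label k = b l.
  have km : (k %% 4 = 1)%N by lia.
  by rewrite /side_label km.
have [iE|[iE|iE]] : i = (8 * l + 2)%N \/ i = (8 * l + 3)%N \/ i = (8 * l + 4)%N by lia.
- have -> : (4 * k + 6 - i = 8 * l.+1)%N by lia.
  have -> : label (8 * l.+1) = (label (8 * l + 2) * b l)%g by rewrite l0 labelE //= !mulgA.
  by rewrite iE mulKg.
- have -> : (4 * k + 6 - i = 8 * l + 7)%N by lia.
  by rewrite iE !labelE // invg1 mul1g.
- have -> : (4 * k + 6 - i = 8 * l + 6)%N by lia.
  by rewrite iE !labelE // [((_ / b l)^-1)%g]invgM invgK mulgVK.
Qed.

Let phi_near' := phi_near (R := R) g0 label_period label_side.

Definition universal (u : pi1 R x0) : G :=
  monodromy (charted_open g0) (charted_cover g0) phi_near' u.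

Lemma universalM : {morph universal : u v / (u * v)%g}.
Proof. exact: monodromyM. Qed.

(** The ray and the paths [lam] are images of segments of the disc, so [hol_quo] gives their
    holonomy. *)
Lemma universal_ray d : universal (ray_class x0 d) = transport g0 label d.
Proof.
rewrite /ray_class (kappaE (lam x0) (@ray_cts _ _ x0 d) (ray0 x0 d) (ray1 x0 d)).
rewrite /universal /kap monodromy_loop_class.
have HL x : hol (charted_open g0) (charted_cover g0) phi_near' (lam x0 x) = transport g0 label (repr x).
  rewrite -[LHS]/(hol _ _ _ (quo \o segD (repr x0) (repr x))).
  rewrite (hol_quo g0 label_period label_side (@segDc _ _ _)) segD0 segD1.
  by rewrite !(transport_repr g0 label_period label_side) invg1 mul1g.
rewrite -[LHS]/(hol _ _ _ (pcat (pcat (lam x0 x0) (ray x0 d)) (revp (lam x0 (quo d))))).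
have c0 x : continuous (lam x0 x) by exact: path_cts.
have c1 : continuous (pcat (lam x0 x0) (ray x0 d)).
  by apply: pcat_cts => //; [exact: ray_cts|rewrite ray0 path_one].
rewrite hol_cat //; [|exact: revp_cts|by rewrite revp0 pcat1 ray1 path_one].
rewrite hol_cat //; [|exact: ray_cts|by rewrite ray0 path_one].
have tr := @transport_repr R g g0 G label side_label label_period label_side.
rewrite (hol_rev _ _ _ (c0 (quo d))) (HL x0) (HL (quo d)) (tr x0) (tr (quo d)).
rewrite invg1 mul1g mulg1 (hol_quo g0 label_period label_side (@segDc _ _ _)).
by rewrite segD0 segD1 (tr x0) invg1 mul1g.
Qed.

Lemma universalV : {morph universal : u / (u^-1)%g}.
Proof.
have u1 : universal 1%g = 1%g.
  by apply: (mulgI (universal 1%g)); rewrite -universalM !mulg1.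
by move=> u; apply: (mulIg (universal u)); rewrite -universalM !mulVg.
Qed.

Lemma universal_side k : positive_side g k ->
  (universal (T (2 * k)%N / T (4 * k + 6 - 2 * k)%N) = side_label k)%g.
Proof.
move=> kp; have ik : (2 * k <= 2 * k <= 2 * k + 2)%N by lia.
rewrite universalM universalV !universal_ray natrR //.
by rewrite (transport_pairing g0 label_period label_side kp) // !ler_nat.
Qed.

Lemma universal_a i : (i < g)%N -> universal (gen_a i) = a i.
Proof.
move=> ig; have := universal_side (positive_side_a ig).
have -> : (2 * (4 * i) = 8 * i)%N by lia.
have -> : (4 * (4 * i) + 6 - 8 * i = 8 * i + 6)%N by lia.
by rewrite /side_label modnMr mulKn.
Qed.

Lemma universal_b i : (i < g)%N -> universal (gen_b i) = b i.
Proof.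
move=> ig; have := universal_side (positive_side_b ig).
have -> : (2 * (4 * i + 1) = 8 * i + 2)%N by lia.
have -> : (4 * (4 * i + 1) + 6 - (8 * i + 2) = 8 * i + 8)%N by lia.
rewrite /side_label.
have -> : ((4 * i + 1) %% 4 = 1)%N by lia.
by have -> : ((4 * i + 1) %/ 4 = i)%N by lia.
Qed.

End Universal.
End Presentation.

(** * The discrete Heisenberg group *)

Definition heis : Type := (int * int * int)%type.

Section Heisenberg.
Implicit Types u v w : heis.

(** The product of unitriangular 3 by 3 matrices: the first two coordinates stand next to the
    diagonal and the third one in the corner. *)
Definition heis_mul u v : heis :=
  (u.1.1 + v.1.1, u.1.2 + v.1.2, u.2 + v.2 + u.1.1 * v.1.2).
Definition heis_one : heis := (0, 0, 0).
Definition heis_inv u : heis := (- u.1.1, - u.1.2, u.1.1 * u.1.2 - u.2).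

Lemma heis_mulA : associative heis_mul.
Proof. by move=> u v w; rewrite /heis_mul /=; congr (_, _, _); ring. Qed.

Lemma heis_mul1u : left_id heis_one heis_mul.
Proof. by move=> [[x y] z]; rewrite /heis_mul /=; congr (_, _, _); ring. Qed.

Lemma heis_mulu1 : right_id heis_one heis_mul.
Proof. by move=> [[x y] z]; rewrite /heis_mul /=; congr (_, _, _); ring. Qed.

Lemma heis_mulVu : left_inverse heis_one heis_inv heis_mul.
Proof. by move=> [[x y] z]; rewrite /heis_mul /heis_one /=; congr (_, _, _); ring. Qed.

Lemma heis_muluV : right_inverse heis_one heis_inv heis_mul.
Proof. by move=> [[x y] z]; rewrite /heis_mul /heis_one /=; congr (_, _, _); ring. Qed.

HB.instance Definition _ := Choice.copy heis (int * int * int)%type.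
HB.instance Definition _ :=
  isGroup.Build heis heis_mulA heis_mul1u heis_mulu1 heis_mulVu heis_muluV.

Definition heis_x : heis := (1, 0, 0).
Definition heis_y : heis := (0, 1, 0).

Lemma heis_mulE u v : (u * v)%g = heis_mul u v. Proof. by []. Qed.
Lemma heis_expx k : (heis_x ^+ k)%g = (k%:Z, 0, 0).
Proof.
elim: k => [//|k IH]; rewrite expgS IH heis_mulE /heis_mul /=.
by congr (_, _, _); lia.
Qed.

Lemma heis_expy k : (heis_y ^+ k)%g = (0, k%:Z, 0).
Proof.
elim: k => [//|k IH]; rewrite expgS IH heis_mulE /heis_mul /=.
by congr (_, _, _); lia.
Qed.

Lemma heis_xy k m u : (heis_x ^+ k * (heis_y ^+ m * u))%g =
  (k%:Z + u.1.1, m%:Z + u.1.2, u.2 + k%:Z * (m%:Z + u.1.2)).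
Proof.
by rewrite heis_expx heis_expy !heis_mulE /heis_mul /=; congr (_, _, _); ring.
Qed.

Lemma heis_x_inj k l u : (heis_x ^+ k * u = heis_x ^+ l * u)%g -> k = l.
Proof.
move=> /mulIg; rewrite !heis_expx => -[]; exact.
Qed.

(** The second coordinates alone exclude equality, since that of [u] is shifted by [m]. *)
Lemma heis_spread u v m k l :
  (`|v.1.2| + `|u.1.2| + `|u.2| + `|v.2| < m)%N ->
  (heis_x ^+ k * (heis_y ^+ m * u))%g <> (heis_x ^+ l * v)%g.
Proof.
have := heis_xy l 0 v; rewrite expg0 mul1g => -> + /[!heis_xy] [[_ + _]].
rewrite add0r; lia.
Qed.

(** The second coordinates of [u] and [v] agree, and comparing the central ones makes [k - l] times
    [m + u.1.2] equal to [v.2 - u.2], which is smaller than [m + u.1.2] in absolute value. *)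
Lemma heis_spread2 u v m k l :
  (`|v.1.2| + `|u.1.2| + `|u.2| + `|v.2| < m)%N ->
  (heis_x ^+ k * (heis_y ^+ m * u) = heis_x ^+ l * (heis_y ^+ m * v))%g -> k = l.
Proof.
rewrite !heis_xy => mM [E1 E2 E3].
have uv : u.1.2 = v.1.2 by lia.
have {E3} : (k%:Z - l%:Z) * (m%:Z + u.1.2) = v.2 - u.2.
  by move: E3; rewrite -uv; set r := m%:Z + _ => ?; lra.
have [-> //|kl] := eqVneq k l; nia.
Qed.

End Heisenberg.

(** * Generic actions of an HNN extension *)

Lemma eventually_all (T : eqType) (s : seq T) (P : T -> nat -> Prop) :
  (forall x, x \in s -> exists M, forall m, (M < m)%N -> P x m) ->
  exists M, forall m, (M < m)%N -> forall x, x \in s -> P x m.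
Proof.
elim: s => [|x s IH] Hs; first by exists 0%N.
have [M HM] := Hs x (mem_head _ _).
have [M' HM'] : exists M, forall m, (M < m)%N -> forall x, x \in s -> P x m.
  by apply: IH => y ys; apply: Hs; rewrite inE ys orbT.
exists (maxn M M') => m; rewrite gtn_max => /andP[mM mM'] y.
by rewrite inE => /orP[/eqP ->|ys]; [exact: HM | exact: HM'].
Qed.

Lemma map_uniq_inj (T T' : eqType) (f : T -> T') (s : seq T) :
  uniq (map f s) -> {in s &, injective f}.
Proof.
elim: s => [//|z s IH] /= /andP[zs us] x y; rewrite !inE.
move=> /predU1P[->|xs] /predU1P[->|ys] // E; last exact: IH.
- by rewrite E map_f in zs.
- by rewrite -E map_f in zs.
Qed.

Lemma eqb_or_neg (e e' : bool) : e' = e \/ e' = ~~ e.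
Proof. by case: e; case: e'; [left|right|right|left]. Qed.

Section HNN.
Context (K : groupType) (H : set K) (a c d t : K).
Hypotheses (H1 : H 1%g) (HM : forall u v, H u -> H v -> H (u * v)%g)
  (HV : forall u, H u -> H (u^-1)%g).
Hypotheses (Ha : H a) (Hc : H c) (Hd : H d) (ta : (t * a = c * t)%g).

Implicit Types (e : bool) (x y : K * nat) (p q : (K * nat) * (K * nat)) (L : seq ((K * nat) * (K * nat))).

(* The stable letter [t] carries the lines of [a] ([e = true]) to those of
   [c = t a t^-1] ([e = false]). *)
Definition el e : K := if e then a else c.

Hypothesis el_inj : forall e k l, (el e ^+ k = el e ^+ l)%g -> k = l.
Hypothesis spread : forall e u v, exists M, forall m, (M < m)%N ->
  forall k l, (el e ^+ k * (d ^+ m * u))%g <> (el e ^+ l * v)%g.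
Hypothesis spread2 : forall e u v, exists M, forall m, (M < m)%N ->
  forall k l, (el e ^+ k * (d ^+ m * u) = el e ^+ l * (d ^+ m * v))%g -> u = v.

Definition act (h : K) x : K * nat := ((h * x.1)%g, x.2).

Lemma actM h h' x : act (h * h')%g x = act h (act h' x).
Proof. by rewrite /act /= mulgA. Qed.

Lemma act1 x : act 1%g x = x.
Proof. by case: x => u i; rewrite /act mul1g. Qed.

Lemma act_inj h : injective (act h).
Proof. by move=> [u i] [v j] [/mulgI -> ->]. Qed.

(** An integer power is written with two natural exponents, one on each side. *)
Definition line e x y : Prop := exists k l, act (el e ^+ k)%g x = act (el e ^+ l)%g y.

Lemma line_refl e x : line e x x.
Proof. by exists 0%N, 0%N. Qed.

Lemma line_sym e x y : line e x y -> line e y x.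
Proof. by move=> [k [l E]]; exists l, k. Qed.

Lemma line_trans e x y z : line e x y -> line e y z -> line e x z.
Proof.
move=> [k [l E]] [k' [l' E']]; exists (k' + k)%N, (l + l')%N.
by rewrite !expgnDr !actM E -E' -!actM -!expgnDr addnC.
Qed.

Lemma line_idx e x y : line e x y -> x.2 = y.2.
Proof. by move=> [k [l []]]. Qed.

(** The flag selects the source ([true]) or the target ([false]) of a pair, so that each statement
    covers the bijection and its inverse at once. *)
Definition coord e p : K * nat := if e then p.1 else p.2.
Definition mkp e x y : (K * nat) * (K * nat) := if e then (x, y) else (y, x).

Lemma coord_mkp e x y : coord e (mkp e x y) = x.
Proof. by case: e. Qed.

Lemma coord_mkpN e x y : coord (~~ e) (mkp e x y) = y.
Proof. by case: e. Qed.

(* A finite list of pairs encodes a partial bijection that intertwines [a] and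
   [c]: each pair [(x, y)] maps [a ^ k x] to [c ^ k y]. *)
Definition valid L : Prop := forall p q e, p \in L -> q \in L ->
  line e (coord e p) (coord e q) -> p = q.

Definition defined e L x : Prop := exists2 p, p \in L & line e x (coord e p).

Definition maps e L x y : Prop := exists2 p, p \in L & exists k l,
  act (el e ^+ k)%g x = act (el e ^+ l)%g (coord e p) /\
  act (el (~~ e) ^+ k)%g y = act (el (~~ e) ^+ l)%g (coord (~~ e) p).

Lemma maps_sym e L x y : maps e L x y -> maps (~~ e) L y x.
Proof. by move=> [p pL [k [l [E E']]]]; exists p => //; exists k, l; rewrite negbK. Qed.

Lemma maps_sub e L L' x y : {subset L <= L'} -> maps e L x y -> maps e L' x y.
Proof. by move=> LL' [p /LL' pL]; exists p. Qed.

Lemma maps_pair e L x y : mkp e x y \in L -> maps e L x y.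
Proof.
by move=> pL; exists (mkp e x y) => //; exists 0%N, 0%N; rewrite coord_mkp coord_mkpN.
Qed.

(** Validity makes the two witnesses the same pair; since [el e] has infinite order, their exponents
    have the same difference, which determines the image. *)
Lemma maps_fun e L x y y' : valid L -> maps e L x y -> maps e L x y' -> y = y'.
Proof.
move=> vL [p pL [k [l [E F]]]] [q qL [k' [l' [E' F']]]].
have pq : p = q.
  apply: (vL _ _ e) => //; apply: (@line_trans _ _ x).
    by apply: line_sym; exists k, l.
  by exists k', l'.
rewrite -{q qL}pq in E' F'.
have kl : (k' + l = k + l')%N.
  apply: (@el_inj e); move: (congr1 (act (el e ^+ k')%g) E).
  rewrite -!actM -!expgnDr addnC expgnDr actM E' -actM -expgnDr => -[/mulIg <-].
  by rewrite addnC.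
apply: (@act_inj (el (~~ e) ^+ (k' + k))%g).
by rewrite {1}expgnDr actM F -actM -expgnDr kl expgnDr actM -F' -actM -expgnDr addnC.
Qed.

Lemma maps_el e L x y : maps e L x y -> maps e L (act (el e) x) (act (el (~~ e)) y).
Proof.
move=> [p pL [k [l [E F]]]]; exists p => //; exists k, l.+1.
by split; rewrite -actM -expgSr expgS actM ?E ?F -actM -expgS.
Qed.

Lemma maps_defined e L x : defined e L x -> exists y, maps e L x y.
Proof.
move=> [p pL [k [l E]]].
exists (act ((el (~~ e) ^+ k)^-1 * el (~~ e) ^+ l)%g (coord (~~ e) p)).
exists p => //; exists k, l; split => //.
by rewrite -actM mulVKg.
Qed.

Lemma valid_cons e x y L : valid L -> ~ defined e L x -> ~ defined (~~ e) L y ->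
  valid (mkp e x y :: L).
Proof.
move=> vL nx ny.
have N e' p : p \in L -> ~ line e' (coord e' (mkp e x y)) (coord e' p).
  move=> pL pl; have [ee|ee] := eqb_or_neg e e'.
    by apply: nx; exists p => //; move: pl; rewrite ee coord_mkp.
  by apply: ny; exists p => //; move: pl; rewrite ee coord_mkpN.
move=> p q e'; rewrite !inE => /predU1P[->|pL] /predU1P[->|qL] //.
- by move=> /(N _ _ qL).
- by move=> /line_sym /(N _ _ pL).
- exact: vL.
Qed.

Definition idx L : nat := \max_(p <- L) maxn p.1.2 p.2.2.

Lemma idx_coord e L p : p \in L -> ((coord e p).2 <= idx L)%N.
Proof.
move=> pL; apply: (@leq_trans (maxn p.1.2 p.2.2)); last exact: leq_bigmax_seq.
by case: e; rewrite /= leq_max leqnn ?orbT.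
Qed.

Lemma idx_defined e L x : (idx L < x.2)%N -> ~ defined e L x.
Proof. by move=> xi [p /(idx_coord e) pL /line_idx xE]; rewrite xE ltnNge pL in xi. Qed.

Lemma extend_defined e x L : valid L ->
  exists L', [/\ valid L', {subset L <= L'} & defined e L' x].
Proof.
move=> vL; case: (pselect (defined e L x)) => [dx|ndx]; first by exists L; split.
exists (mkp e x (1%g, (idx L).+1) :: L); split.
- apply: valid_cons => //; apply: idx_defined; exact: leqnn.
- by move=> p pL; rewrite inE pL orbT.
- exists (mkp e x (1%g, (idx L).+1)); first exact: mem_head.
  by rewrite coord_mkp; exact: line_refl.
Qed.

Lemma power_H m : H (d ^+ m)%g.
Proof. by elim: m => [|m IH]; rewrite ?expg0 // expgS; exact: HM. Qed.

Lemma spread_lines e L (s : seq (K * nat)) : exists2 h, H h &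
  (forall x, x \in s -> ~ defined e L (act h x)) /\
  (forall x y, x \in s -> y \in s -> line e (act h x) (act h y) -> x = y).
Proof.
have [M HM'] : exists M, forall m, (M < m)%N -> forall x, x \in s ->
    ~ defined e L (act (d ^+ m)%g x).
  apply: eventually_all => x xs.
  have [M1 HM1] : exists M, forall m, (M < m)%N -> forall p, p \in L ->
      ~ line e (act (d ^+ m)%g x) (coord e p).
    apply: eventually_all => p pL; have [M HM'] := spread e x.1 (coord e p).1.
    exists M => m /HM' Hm [k [l [E _]]]; exact: (Hm k l).
  by exists M1 => m /HM1 Hm [p /Hm].
have [M2 HM2] : exists M, forall m, (M < m)%N -> forall z, z \in [seq (x, y) | x <- s, y <- s] ->
    line e (act (d ^+ m)%g z.1) (act (d ^+ m)%g z.2) -> z.1 = z.2.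
  apply: eventually_all => -[[u i] [v j]] _ /=; have [M3 HM3] := spread2 e u v.
  by exists M3 => m /HM3 Hm [k [l [/Hm -> ->]]].
pose m := (maxn M M2).+1.
exists (d ^+ m)%g; first exact: power_H.
split; first by apply: HM'; rewrite /m ltnS leq_maxl.
move=> x y xs ys; apply: (HM2 m _ (x, y)); first by rewrite /m ltnS leq_maxr.
exact: allpairs_f.
Qed.

(** Once [t] acts by the bijection, [h'^-1 * t * h] sends every [p.1] to [p.2]; density comes from
    this. *)
Lemma extend_transitive (s : seq ((K * nat) * (K * nat))) L : valid L ->
  uniq (map fst s) -> uniq (map snd s) ->
  exists L' h h', [/\ valid L', {subset L <= L'}, H h, H h' &
    forall p, p \in s -> maps true L' (act h p.1) (act h' p.2)].
Proof.
move=> vL u1 u2.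
have [h Hh [hL hs]] := spread_lines true L (map fst s).
have [h' Hh' [hL' hs']] := spread_lines false L (map snd s).
pose f p := (act h p.1, act h' p.2).
exists (map f s ++ L), h, h'; split=> //.
- have new e p q : p \in s -> q \in L -> ~ line e (coord e (f p)) (coord e q).
    case: e => /= ps qL pq; [apply: (hL p.1)|apply: (hL' p.2)];
      by [exact: map_f | exists q].
  move=> p q e; rewrite !mem_cat => /orP[/mapP[p' ps ->]|pL] /orP[/mapP[q' qs ->]|qL].
  + case: e => /= pq; congr f.
      by apply: (@map_uniq_inj _ _ fst s) => //; apply: hs => //; exact: map_f.
    by apply: (@map_uniq_inj _ _ snd s) => //; apply: hs' => //; exact: map_f.
  + by move=> /(new _ _ _ ps qL).
  + by move=> /line_sym /(new _ _ _ qs pL).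
  + exact: vL.
- by move=> p pL; rewrite mem_cat pL orbT.
- move=> p ps; apply: (@maps_pair true); rewrite mem_cat; apply/orP; left.
  exact: (map_f f).
Qed.

(* Words [h_n t^e_n ... h_1 t^e_1], written from the left *)
Implicit Type s : seq (bool * K).

(** The element [h] is an integer power of [el (~~ e)], the case where [te (~~ e) * h * te e]
    collapses to a power of [el e]. *)
Definition pinch e (h : K) : Prop := exists k l, (el (~~ e) ^+ k * h = el (~~ e) ^+ l)%g.

Fixpoint reduced s : Prop := if s is (e, h) :: s' then
  [/\ H h, reduced s' & if s' is (e', h') :: _ then e = ~~ e' -> ~ pinch e' h' else True]
  else True.

Definition te e : K := if e then t else (t^-1)%g.

Fixpoint word_eval s (h0 : K) : K := if s is (e, h) :: s' then (h * (te e * word_eval s' h0))%g else h0.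

Fixpoint traj L s x y : Prop := if s is (e, h) :: s' then
  exists z w, [/\ traj L s' x z, maps e L z w & y = act h w] else y = x.

Lemma traj_sub L L' s x y : {subset L <= L'} -> traj L s x y -> traj L' s x y.
Proof.
move=> LL'; elim: s y => [//|[e h] s IH] y /= [z [w [/IH xz zw ->]]].
by exists z, w; split=> //; exact: maps_sub zw.
Qed.

(* The trajectory of a reduced word through unused indices never meets a line
   that is already defined: this is Britton's lemma. *)
Lemma extend_reduced e h s L : valid L -> reduced ((e, h) :: s) ->
  exists L' i j, [/\ valid L', {subset L <= L'},
    traj L' ((e, h) :: s) (1%g, i) (h, j) /\ i <> j,
    forall x, x.2 = j -> ~ defined e L' x &
    forall x, x.2 = j -> defined (~~ e) L' x -> line (~~ e) x (1%g, j)].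
Proof.
elim: s e h L => [|[e' h'] s IH] e h L vL.
  move=> _; pose i := (idx L).+1; pose j := i.+1.
  have vL' : valid (mkp e (1%g, i) (1%g, j) :: L).
    apply: valid_cons => //; apply: idx_defined; rewrite /= /j ?ltnS //.
  exists (mkp e (1%g, i) (1%g, j) :: L), i, j; split=> //.
  - by move=> p pL; rewrite inE pL orbT.
  - split; last by rewrite /j; lia.
    exists (1%g, i), (1%g, j); split=> //; last by rewrite /act mulg1.
    by apply: maps_pair; exact: mem_head.
  - move=> x xj [p]; rewrite inE => /predU1P[->|pL] /line_idx.
      by rewrite coord_mkp xj /= /j; lia.
    by have := idx_coord e pL; rewrite xj /j /i; lia.
  - move=> x xj [p]; rewrite inE => /predU1P[->|pL]; first by rewrite coord_mkpN.
    by move=> /line_idx; have := idx_coord (~~ e) pL; rewrite xj /j /i; lia.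
move=> [Hh rs np]; have [L1 [i [j1 [vL1 LL1 [tr ij1] nd dl]]]] := IH e' h' L vL rs.
pose j := (maxn (idx L1) (maxn i j1)).+1.
(* In the copy [j1] nothing is defined in the direction [e'], and in the other direction only the
   line of 1. That [h'] lies on this line means a pinch, which the reduced word excludes. *)
have ndx : ~ defined e L1 (h', j1).
  have [ee|ee] := eqb_or_neg e' e.
    by rewrite ee; apply: nd.
  rewrite ee => /(dl (h', j1) erefl) [k [l [E]]]; apply: (np ee).
  by exists k, l; rewrite mulg1 in E.
have vL' : valid (mkp e (h', j1) (1%g, j) :: L1).
  by apply: valid_cons => //; apply: idx_defined; rewrite /= /j ltnS leq_maxl.
have sub : {subset L1 <= mkp e (h', j1) (1%g, j) :: L1}.
  by move=> p pL; rewrite inE pL orbT.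
exists (mkp e (h', j1) (1%g, j) :: L1), i, j; split=> //.
- by move=> p /LL1 /sub.
- split; last by rewrite /j; lia.
  exists (h', j1), (1%g, j); split; last by rewrite /act mulg1.
    exact: traj_sub tr.
  by apply: maps_pair; exact: mem_head.
- move=> x xj [p]; rewrite inE => /predU1P[->|pL] /line_idx.
    by rewrite coord_mkp xj /= /j; lia.
  by have := idx_coord e pL; rewrite xj /j; lia.
- move=> x xj [p]; rewrite inE => /predU1P[->|pL]; first by rewrite coord_mkpN.
  by move=> /line_idx; have := idx_coord (~~ e) pL; rewrite xj /j; lia.
Qed.

Definition has_form (u : K) : Prop := exists s h0, [/\ reduced s, H h0 & u = word_eval s h0].

Lemma has_form_H h u : H h -> has_form u -> has_form (h * u)%g.
Proof.
move=> Hh [[|[e h'] s] [h0 [rs Hh0 ->]]].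
  by exists [::], (h * h0)%g; split=> //; exact: HM.
exists ((e, (h * h')%g) :: s), h0; split=> //=; last by rewrite mulgA.
by case: rs => Hh' rs np; split=> //; exact: HM.
Qed.

Lemma te_el e k : (te e * el e ^+ k = el (~~ e) ^+ k * te e)%g.
Proof.
elim: k => [|k IH]; first by rewrite !expg0 mulg1 mul1g.
rewrite expgSr mulgA IH -mulgA [X in (_ * X = _)%g](_ : _ = el (~~ e) * te e)%g; last first.
  case: (e); rewrite /te /el //=.
  by apply: (mulgI t); rewrite !mulgA ta mulgV mul1g mulgK.
by rewrite mulgA -expgSr.
Qed.

Lemma el_H e k : H (el e ^+ k)%g.
Proof.
elim: k => [|k IH]; rewrite ?expg0 // expgS; apply: HM => //; by case: (e).
Qed.

Lemma teN e : (te (~~ e) = (te e)^-1)%g.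
Proof. by case: e; rewrite /te //= invgK. Qed.

(** If the new letter creates a pinch, [te_el] removes it and the word gets shorter; otherwise the
    letter is put in front. *)
Lemma has_form_te e u : has_form u -> has_form (te e * u)%g.
Proof.
move=> [[|[e' h'] s] [h0 [rs Hh0 ->]]].
  by exists [:: (e, 1%g)], h0; split=> //=; rewrite mul1g.
case: (pselect (e = ~~ e' /\ pinch e' h')) => [[-> [k [l E]]]|np]; last first.
  exists ((e, 1%g) :: (e', h') :: s), h0; split=> //=; last by rewrite mul1g.
  by split=> // ee p; apply: np.
have [Hh' rs' _] := rs.
have -> : (te (~~ e') * word_eval ((e', h') :: s) h0 =
    ((el e' ^+ k)^-1 * el e' ^+ l) * word_eval s h0)%g.
  rewrite /= !mulgA; congr (_ * _)%g.
  have -> : h' = ((el (~~ e') ^+ k)^-1 * el (~~ e') ^+ l)%g by rewrite -E mulKg.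
  rewrite teN -!mulgA -te_el; apply: (mulgI (el (~~ e') ^+ k * te e')%g).
  by rewrite -{2}te_el -!mulgA !mulVKg.
apply: has_form_H; first by apply: HM; [apply: HV|]; exact: el_H.
by exists s, h0.
Qed.

(** * Back and forth over a countable list of tasks *)

Section BackAndForth.
Context (en : nat -> K).
Hypothesis en_surj : forall u, exists k, en k = u.

Definition pt (z : nat * nat) : K * nat := (en z.1, z.2).

Lemma pt_surj x : exists z, pt z = x.
Proof. by case: x => u i; have [k <-] := en_surj u; exists (k, i). Qed.

(** The requirements, coded through the enumeration [en] so as to form a countable type: define the
    image of a point in either direction, send one tuple to another, make a reduced word move a
    point. *)
Definition task : countType :=
  ((nat * nat * bool) + seq ((nat * nat) * (nat * nat)) + (bool * nat * seq (bool * nat)))%type.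

Definition completed (T : task) L : Prop := match T with
  | inl (inl (z, e)) => defined e L (pt z)
  | inl (inr l) => let s := [seq (pt z.1, pt z.2) | z <- l] in
      uniq (map fst s) -> uniq (map snd s) ->
      exists h h', [/\ H h, H h' & forall p, p \in s -> maps true L (act h p.1) (act h' p.2)]
  | inr (e, k, w) => let s := [seq (z.1, en z.2) | z <- w] in
      reduced ((e, en k) :: s) ->
      exists i j, traj L ((e, en k) :: s) (1%g, i) (en k, j) /\ i <> j
  end.

Lemma extend_task (T : task) L : valid L ->
  exists L', [/\ valid L', {subset L <= L'} & completed T L'].
Proof.
move=> vL; case: T => [[[z e]|l]|[[e k] w]].
- exact: extend_defined.
- case: (pselect (uniq (map fst [seq (pt z.1, pt z.2) | z <- l]) /\
                  uniq (map snd [seq (pt z.1, pt z.2) | z <- l]))) => [[u1 u2]|nu].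
    have [L' [h [h' [vL' LL' Hh Hh' hh]]]] := extend_transitive vL u1 u2.
    by exists L'; split=> // s0 _ _; exists h, h'.
  by exists L; split=> // s0 u1 u2; case: nu.
- case: (pselect (reduced ((e, en k) :: [seq (z.1, en z.2) | z <- w]))) => [rd|nr].
    have [L' [i [j [vL' LL' tr _ _]]]] := extend_reduced vL rd.
    by exists L'; split=> // s0 _; exists i, j.
  by exists L; split=> // s0 /nr.
Qed.

Lemma stages : exists S : nat -> seq ((K * nat) * (K * nat)),
  [/\ forall k, valid (S k), forall k l, (k <= l)%N -> {subset S k <= S l} &
     forall T : task, exists k, completed T (S k)].
Proof.
have /choice[ext Hext] : forall z : task * seq ((K * nat) * (K * nat)), exists L',
    valid z.2 -> [/\ valid L', {subset z.2 <= L'} & completed z.1 L'].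
  move=> [T L] /=; case: (pselect (valid L)) => [vL|]; last by exists L.
  by have [L' ?] := extend_task T vL; exists L'.
(* Stage [l + 1] performs the task of code [l], if there is one; earlier results persist because the
   lists only grow. *)
pose S := fix S k := if k is l.+1 then
  (if unpickle l is Some T then ext (T, S l) else S l) else [::].
have vS k : valid (S k).
  elim: k => [//|k IH] /=; case: (unpickle k) => // T.
  by have [] := Hext (T, S k) IH.
exists S; split=> // [k l|T].
  elim: l => [|l IH]; first by rewrite leqn0 => /eqP ->.
  rewrite leq_eqVlt => /predU1P[->//|kl] p /(IH kl) /=.
  by case: (unpickle l) => // T; have [_ sub _] := Hext (T, S l) (vS l); exact: sub.
exists (pickle T).+1; rewrite /= pickleK.
by have [] := Hext (T, S (pickle T)) (vS _).
Qed.

Definition iterate (f f' : K * nat -> K * nat) :=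
  fix iterate s x := if s is (e, h) :: s' then
    act h ((if e then f else f') (iterate s' x)) else x.

Lemma generic_bijection : exists f f' : K * nat -> K * nat,
  [/\ cancel f f', cancel f' f, forall x, f (act a x) = act c (f x),
    forall l : seq ((K * nat) * (K * nat)), uniq (map fst l) -> uniq (map snd l) ->
      exists h h', [/\ H h, H h' & forall p, p \in l -> f (act h p.1) = act h' p.2] &
    forall e h s, reduced ((e, h) :: s) -> exists i j,
      iterate f f' ((e, h) :: s) (1%g, i) = (h, j) /\ i <> j].
Proof.
have [S [vS subS doneS]] := stages.
have /choice[F HF] : forall z : bool * (K * nat), exists y, exists k, maps z.1 (S k) z.2 y.
  move=> [e x] /=; have [z <-] := pt_surj x.
  by have [k /maps_defined[y xy]] := doneS (inl (inl (z, e))); exists y, k.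
have FE e k x y : maps e (S k) x y -> F (e, x) = y.
  move=> xy; have [l xFx] := HF (e, x).
  apply: (maps_fun (vS (maxn k l)) (e := e) (x := x)).
    by apply: maps_sub xFx; apply: subS; rewrite leq_maxr.
  by apply: maps_sub xy; apply: subS; rewrite leq_maxl.
have FK e x : F (~~ e, F (e, x)) = x.
  by have [k /maps_sym xy] := HF (e, x); exact: FE xy.
exists (fun x => F (true, x)), (fun x => F (false, x)); split.
- by move=> x; exact: (FK true).
- by move=> x; exact: (FK false).
- by move=> x; have [k /maps_el /FE] := HF (true, x).
- move=> l u1 u2.
  have [l' lE] : exists l', l = [seq (pt z.1, pt z.2) | z <- l'].
    elim: l {u1 u2} => [|[x y] l [l' ->]]; first by exists [::].
    by have [z <-] := pt_surj x; have [z' <-] := pt_surj y; exists ((z, z') :: l').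
  rewrite {}lE in u1 u2 *; have [k Hk] := doneS (inl (inr l')).
  have [h [h' [Hh Hh' hh]]] := Hk u1 u2.
  by exists h, h'; split=> // p /hh /FE.
- move=> e h s rd; have [n hE] := en_surj h.
  have [w wE] : exists w, s = [seq (z.1, en z.2) | z <- w].
    elim: s {rd} => [|[e' h'] s [w ->]]; first by exists [::].
    by have [k <-] := en_surj h'; exists ((e', k) :: w).
  rewrite -{}hE {}wE in rd *; have [k Hk] := doneS (inr (e, n, w)).
  have [i [j [tr ij]]] := Hk rd.
  exists i, j; split=> //.
  have trE s' x y : traj (S k) s' x y ->
      iterate (fun x => F (true, x)) (fun x => F (false, x)) s' x = y.
    elim: s' y => [//|[e' h'] s' IH] y /= [z [w' [/IH -> zw ->]]].
    by have := FE _ _ _ _ zw; case: (e') => ->.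
  exact: trE tr.
Qed.

End BackAndForth.
End HNN.

(** * The faithful and highly transitive action *)

Section Morphisms.
Context {G K : groupType} (F : G -> K).
Hypothesis FM : {morph F : u v / (u * v)%g}.

Lemma morph_one : F 1%g = 1%g.
Proof. by apply: (mulgI (F 1%g)); rewrite -FM !mulg1. Qed.

Lemma morph_inv : {morph F : u / (u^-1)%g}.
Proof. by move=> u; apply: (mulIg (F u)); rewrite -FM !mulVg morph_one. Qed.

Lemma morph_exp k : {morph F : u / (u ^+ k)%g}.
Proof. by move=> u; elim: k => [|k IH]; rewrite ?expg0 ?morph_one // !expgS FM IH. Qed.

Lemma morph_crel (a b : nat -> G) i : F (crel a b i) = crel (F \o a) (F \o b) i.
Proof. by elim: i => [|i IH] /=; rewrite ?morph_one // !FM !morph_inv IH. Qed.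

End Morphisms.

(** This isolates the first factor, the one with the stable letter, whereas [crel] adds its factors
    at the end. *)
Lemma crel_recl (G : groupType) (a b : nat -> G) i :
  (crel a b i.+1 = a 0%N * (b 0%N)^-1 * (a 0%N)^-1 * b 0%N *
     crel (fun k => a k.+1) (fun k => b k.+1) i)%g.
Proof.
elim: i => [|i IH]; first by rewrite /= mulg1 mul1g.
rewrite -[LHS]/(crel a b i.+1 * _)%g IH /= !mulgA.
by [].
Qed.

Lemma bijective_nat (T : Type) (cT : countable [set: T]) (f : nat -> T) :
  injective f -> exists h : T -> nat, bijective h.
Proof.
move=> fI; have iT : infinite_set [set: T].
  move=> fin; have := @infinite_nat; apply.
  by rewrite -(preimage_setT f); apply: finite_preimage fin => x y _ _; exact: fI.
have /card_set_bijP[h [_ hI hS]] := eq_card_nat cT iT.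
have /choice[h' hE] : forall y, exists x, h x = y.
  by move=> y; have [x _ <-] := hS y I; exists x.
by exists h, h' => // x; apply: hI; rewrite ?inE //; exact: hE.
Qed.

Lemma Sinf_open (O : set Sinf) (u : Sinf) : open O -> O u ->
  exists m, Sinf_basic (u, m) `<=` O.
Proof.
move=> [D _ <-] [[v m] Dvm uv]; exists m => w wu; exists (v, m) => // k km.
by rewrite wu // uv.
Qed.

(** * The action of a group with the presentation of a surface group *)

Section SurfaceGroup.
Context (K : groupType) (g : nat) (a b : nat -> K).
Hypotheses (hg : (2 <= g)%N) (ab : crel a b g = 1%g).
Hypothesis gen : forall S : set K, S 1%g ->
  (forall u v, S u -> S v -> S (u * v)%g) -> (forall u, S u -> S (u^-1)%g) ->
  (forall i, (i < g)%N -> S (a i) /\ S (b i)) -> forall u, S u.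
Hypothesis univ : forall (G : groupType) (a' b' : nat -> G), crel a' b' g = 1%g ->
  exists2 F : K -> G, {morph F : u v / (u * v)%g} &
    forall i, (i < g)%N -> F (a i) = a' i /\ F (b i) = b' i.

Lemma surface_enum : exists en : nat -> K, forall u, exists k, en k = u.
Proof.
pose lett (z : nat * bool * bool) : K :=
  let x := if z.1.2 then a z.1.1 else b z.1.1 in if z.2 then x else (x^-1)%g.
pose word (s : seq (nat * bool * bool)) := foldr (fun z u => (lett z * u)%g) 1%g s.
have word_cat s s' : word (s ++ s') = (word s * word s')%g.
  by elim: s => [|z s IH] /=; rewrite ?mul1g // IH mulgA.
have word_inv s : exists s', word s' = ((word s)^-1)%g.
  elim: s => [|z s [s' E]]; first by exists [::]; rewrite /= invg1.
  exists (s' ++ [:: (z.1, ~~ z.2)]); rewrite word_cat E /= invgM mulg1.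
  by congr (_ * _)%g; rewrite /lett /=; case: z => -[i x] [] /=; rewrite ?invgK.
exists (fun k => if unpickle k is Some s then word s else 1%g).
suff H : forall u, exists s, word s = u.
  by move=> u; have [s <-] := H u; exists (pickle s); rewrite pickleK.
apply: gen => [|u v [s <-] [s' <-]|u [s <-]|i ig].
- by exists [::].
- by exists (s ++ s'); rewrite word_cat.
- exact: word_inv.
- split; first by exists [:: (i, true, true)]; rewrite /= mulg1.
  by exists [:: (i, false, true)]; rewrite /= mulg1.
Qed.

(* [b 0] is the inverse of the stable letter of the splitting of the surface
   group as an HNN extension of the free group on the other generators. *)
Let t : K := ((b 0%N)^-1)%g.
Let c : K := (t * a 0%N * t^-1)%g.

Definition base : set K := [set u | forall S : set K, S 1%g ->
  (forall u v, S u -> S v -> S (u * v)%g) -> (forall u, S u -> S (u^-1)%g) ->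
  (forall i, (i < g)%N -> S (a i)) -> (forall i, (0 < i < g)%N -> S (b i)) -> S u].

Lemma base1 : base 1%g.
Proof. by move=> S. Qed.

Lemma baseM u v : base u -> base v -> base (u * v)%g.
Proof. by move=> Hu Hv S S1 SM SV Sa Sb; exact: SM (Hu S S1 SM SV Sa Sb) (Hv S S1 SM SV Sa Sb). Qed.

Lemma baseV u : base u -> base (u^-1)%g.
Proof. by move=> Hu S S1 SM SV Sa Sb; exact: SV (Hu S S1 SM SV Sa Sb). Qed.

Lemma base_a i : (i < g)%N -> base (a i).
Proof. by move=> ig S S1 SM SV Sa Sb; exact: Sa. Qed.

Lemma base_b i : (0 < i < g)%N -> base (b i).
Proof. by move=> ig S S1 SM SV Sa Sb; exact: Sb. Qed.

Let rest : K := crel (fun k => a k.+1) (fun k => b k.+1) g.-1.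

(** The first factor of the relation is [a 0] times the inverse of [c], so the relation can be
    solved for [c]. *)
Lemma cE : c = (rest * a 0%N)%g.
Proof.
have gE : g = g.-1.+1 by lia.
have := ab; rewrite gE crel_recl -/rest => /mulg1_eq <-.
by rewrite /c /t !invgM !invgK -!mulgA mulVg mulg1.
Qed.

Lemma base_c : base c.
Proof.
rewrite cE; apply: baseM; last by apply: base_a; lia.
have H i : (i < g)%N -> base (crel (fun k => a k.+1) (fun k => b k.+1) i).
  elim: i => [_|i IH ig] /=; first exact: base1.
  have ai : base (a i.+1) by exact: base_a.
  have bi : base (b i.+1) by exact: base_b.
  apply: baseM; first by apply: IH; exact: ltnW.
  by do ?[exact: baseV | apply: baseM].
by apply: H; lia.
Qed.

Lemma ta : (t * a 0%N = c * t)%g.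
Proof. by rewrite /c mulgVK. Qed.

(** All generators other than [a 0] and [b 1] go to 1. These two belong to different handles, so
    every commutator of the relation becomes trivial, although their images do not commute. *)
Lemma to_heis : exists2 F : K -> heis, {morph F : u v / (u * v)%g} &
  [/\ F (a 0%N) = heis_x, F c = heis_x & F (b 1%N) = heis_y].
Proof.
have [|F FM Fab] := @univ heis (fun i => if i == 0%N then heis_x else 1%g)
    (fun i => if i == 1%N then heis_y else 1%g).
  suff H i : crel (fun i => if i == 0%N then heis_x else 1%g)
      (fun i => if i == 1%N then heis_y else 1%g) i = 1%g by exact: H.
  elim: i => [//|i /= ->]; rewrite mul1g.
  case: eqP => [->|_] /=; first by rewrite invg1 !mulg1 mulgV.
  by case: ifP; rewrite ?invg1 ?mul1g ?mulg1 ?mulVg.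
have Fa0 : F (a 0%N) = heis_x by have [] := Fab 0%N (ltnW hg).
exists F => //; split=> //; last by have [] := Fab 1%N hg.
rewrite /c /t !FM !(morph_inv FM) Fa0; have [_ ->] := Fab 0%N (ltnW hg).
by rewrite /= !invg1 mul1g mulg1.
Qed.

Lemma countable_points : exists th : K * nat -> int, bijective th.
Proof.
have [en en_surj] := surface_enum.
have /choice[code codeE] := en_surj.
have cK : countable [set: K * nat].
  apply/countable_injP; exists (fun x => pickle (code x.1, x.2)) => -[u i] [v j] _ _ /=.
  move=> /(pcan_inj (@pickleK _))[E ->]; congr pair.
  by rewrite -(codeE u) -(codeE v) E.
have cZ : countable [set: int].
  by apply/countable_injP; exists pickle => u v _ _ /(pcan_inj (@pickleK _)).
have [h hb] : exists h : K * nat -> nat, bijective h.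
  by apply: (@bijective_nat _ cK (fun i => (1%g, i))) => i j [].
have [h' [k h'K kh']] : exists h' : int -> nat, bijective h'.
  by apply: (@bijective_nat _ cZ Posz) => i j [].
by exists (k \o h); apply: bij_comp => //; exists h'.
Qed.

Lemma faithful_dense_action : exists F : K -> Sinf,
  [/\ {morph F : u v / (u * v)%g}, injective F & dense (range F)].
Proof.
have [en en_surj] := surface_enum.
have [P PM [Pa Pc Pd]] := to_heis.
have Pel e : P (el (a 0%N) c e) = heis_x by case: e.
have el_inj e k l : (el (a 0%N) c e ^+ k = el (a 0%N) c e ^+ l)%g -> k = l.
  move=> /(congr1 P); rewrite !(morph_exp PM) Pel => E.
  by apply: (@heis_x_inj k l 1%g); rewrite !mulg1.
have spread e u v : exists M, forall m, (M < m)%N -> forall k l,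
    (el (a 0%N) c e ^+ k * (b 1%N ^+ m * u))%g <> (el (a 0%N) c e ^+ l * v)%g.
  exists (absz (P v).1.2 + absz (P u).1.2 + absz (P u).2 + absz (P v).2)%N => m mM k l /(congr1 P); rewrite !PM !(morph_exp PM) Pel Pd.
  exact: heis_spread mM.
have spread2 e u v : exists M, forall m, (M < m)%N -> forall k l,
    (el (a 0%N) c e ^+ k * (b 1%N ^+ m * u) = el (a 0%N) c e ^+ l * (b 1%N ^+ m * v))%g -> u = v.
  exists (absz (P v).1.2 + absz (P u).1.2 + absz (P u).2 + absz (P v).2)%N => m mM k l E; have := congr1 P E; rewrite !PM !(morph_exp PM) Pel Pd.
  by move=> /(heis_spread2 mM) kl; move: E; rewrite kl => /mulgI /mulgI.
have Ha : base (a 0%N) by apply: base_a; exact: ltnW.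
have Hd : base (b 1%N) by apply: base_b.
have [f [f' [fK f'K fa ftr ffa]]] :=
  generic_bijection base1 baseM Hd el_inj spread spread2 en_surj.
have [th [th' thK th'K]] := countable_points.
have bij_conj (h h' : K * nat -> K * nat) : cancel h h' -> cancel h' h ->
    bijective (fun k => th (h (th' k))).
  move=> hK h'K; exists (fun k => th (h' (th' k))) => k.
    by rewrite thK hK th'K.
  by rewrite thK h'K th'K.
have actK (h : K) : cancel (act h) (act h^-1%g).
  by move=> x; rewrite -actM mulVg act1.
have actVK (h : K) : cancel (act h^-1%g) (act h).
  by move=> x; rewrite -actM mulgV act1.
pose L (h : K) : Sinf := MkSinf (bij_conj _ _ (actK h) (actVK h)).
pose tau : Sinf := MkSinf (bij_conj _ _ fK f'K).
have LM : {morph L : u v / (u * v)%g}.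
  by move=> u v; apply: SinfP => k; rewrite /= thK actM.
have tauE : (tau * L (a 0%N) = L c * tau)%g.
  by apply: SinfP => k; rewrite /= !thK fa.
(* The stable letter [t], which is to act as [tau], is the inverse of [b 0]. *)
pose b' i := if i is j.+1 then L (b j.+1) else (tau^-1)%g.
have gE : g = g.-1.+1 by lia.
have ab' : crel (L \o a) b' g = 1%g.
  rewrite gE crel_recl /=.
  have -> : crel (fun k => L (a k.+1)) (fun k => L (b k.+1)) g.-1 = L rest.
    by rewrite /rest (morph_crel LM).
  rewrite invgK.
  have -> : (L (a 0%N) * tau * (L (a 0%N))^-1 * tau^-1 = L (a 0%N) * (L c)^-1)%g.
    rewrite -!mulgA; congr (_ * _)%g.
    by rewrite -invgM tauE invgM mulVKg.
  by rewrite cE LM invgM -!mulgA mulVg mulg1 mulgV.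
have [F FM Fab] := univ ab'.
have FH h : base h -> F h = L h.
  move=> /(_ [set h | F h = L h]); apply=> [|u v /= Fu Fv|u /= Fu|i ig|i /andP[i0 ig]] /=.
  - by rewrite (morph_one FM) (morph_one LM).
  - by rewrite FM LM Fu Fv.
  - by rewrite (morph_inv FM) (morph_inv LM) Fu.
  - by have [] := Fab i ig.
  - by have [_ ->] := Fab i ig; case: (i) i0.
have Ft : F t = tau.
  by rewrite /t (morph_inv FM); have [_ ->] := Fab 0%N (ltnW hg); rewrite /= invgK.
have FHE h x : base h -> F h (th x) = th (act h x).
  by move=> Hh; rewrite FH //= thK.
have FtE x : F t (th x) = th (f x) by rewrite Ft /= thK.
have FM' u v k : F (u * v)%g k = F u (F v k) by rewrite FM.
have FV u k : F (u^-1)%g (F u k) = k.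
  by rewrite -FM' mulVg (morph_one FM).
exists F; split=> //.
- (* a reduced word moves a point whose index is not used yet *)
  suff F1 u : F u = 1%g -> u = 1%g.
    move=> u v E; apply: divg1_eq; apply: F1.
    by rewrite FM (morph_inv FM) E mulgV.
  have form u' : has_form base (a 0%N) c t u'.
    (* Left multiplication by [u] and by its inverse both preserve the words in normal form; such
       [u] form a subgroup. *)
    pose S u := forall w, has_form base (a 0%N) c t w ->
      has_form base (a 0%N) c t (u * w)%g /\ has_form base (a 0%N) c t (u^-1 * w)%g.
    suff /(_ u' 1%g) : forall u, S u.
      rewrite mulg1 => h; apply: (h _).1; exists [::], 1%g; split=> //; exact: base1.
    have SH h : base h -> S h.
      move=> Hh w Hw; split; apply: has_form_H => //; try exact: baseM.
      exact: baseV.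
    have Ste e w : has_form base (a 0%N) c t w -> has_form base (a 0%N) c t (te t e * w)%g.
      by apply: has_form_te; [exact: base1|exact: baseM|exact: baseV|exact: Ha|exact: base_c|exact: ta].
    apply: gen => [|v w Sv Sw x Hx|v Sv x Hx|i ig].
    + exact: (SH _ base1).
    + rewrite invgM -!mulgA; split; first exact: (Sv _ (Sw _ Hx).1).1.
      exact: (Sw _ (Sv _ Hx).2).2.
    + by rewrite invgK; have [] := Sv x Hx.
    + split; first exact: (SH _ (base_a ig)).
      case: i ig => [|i] ig; last exact: (SH _ (@base_b i.+1 ig)).
      move=> x Hx; split; first by have := Ste false x Hx; rewrite /te /t invgK.
      exact: (Ste true x Hx).
  move=> Fu; have [s [h0 [rs Hh0 uE]]] := form u.
  (* The starting point is moved by the inverse of [h0], which cancels the rightmost factor of the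
     word. *)
  have Fev s' x : reduced base (a 0%N) c s' ->
      F (word_eval t s' h0) (th (act h0^-1%g x)) = th (iterate f f' s' x).
    elim: s' => [|[e h] s' IH] /=; first by rewrite FHE // actVK.
    move=> [Hh rs' _]; rewrite !FM' (IH rs').
    have -> : F (te t e) (th (iterate f f' s' x)) =
              th ((if e then f else f') (iterate f f' s' x)).
      case: e => /=; first exact: FtE.
      by rewrite -{1}(f'K (iterate f f' s' x)) -FtE FV.
    exact: FHE.
  case: s rs uE => [|[e h] s] rs uE.
    have := FHE h0 (1%g, 0%N) Hh0; rewrite -[h0]uE Fu /= => /(can_inj thK)[E].
    by rewrite mulg1 in E.
  exfalso; have [i [j [it ij]]] := ffa e h s rs.
  have := Fev _ (1%g, i) rs; rewrite -uE it Fu /= => /(can_inj thK)[_ E].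
  exact: ij.
- move=> O [u Ou] oO; have [m mO] := Sinf_open oO Ou.
  (* The integers from [-m] to [m], where the basic neighbourhood prescribes the values of [u]. *)
  pose ks : seq int := [seq i%:Z - m%:Z | i <- iota 0 (2 * m + 1)].
  have uks : uniq ks by rewrite map_inj_uniq ?iota_uniq // => i j; lia.
  pose l := [seq (th' k, th' (u k)) | k <- ks].
  have ul1 : uniq (map fst l).
    by rewrite -map_comp map_inj_uniq //; exact: can_inj th'K.
  have ul2 : uniq (map snd l).
    rewrite -map_comp map_inj_uniq // => j k /= /(can_inj th'K).
    exact: bij_inj (Sinf_bij u) _ _.
  have [h [h' [Hh Hh' hh]]] := ftr l ul1 ul2.
  exists (F (h'^-1 * (t * h))%g); split; last by exists (h'^-1 * (t * h))%g.
  apply: mO => k /= km.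
  have kl : (th' k, th' (u k)) \in l.
    apply: (map_f (fun k => (th' k, th' (u k)))).
    apply/mapP; exists (absz (k + m%:Z)); last by lia.
    by rewrite mem_iota; lia.
  rewrite !FM' -{1}(th'K k) FHE // FtE (hh _ kl) /= -FHE // FV.
  exact: th'K.
Qed.

End SurfaceGroup.

Theorem theorem1p2 (R : realType) (g : nat) (hg : (2 <= g)%N)
    (x0 : surface R g) :
  exists H : set Sinf,
    [/\ is_subgroup H, dense H & isomorphic_onto (pi1 R x0) H].
Proof.
have g0 : (0 < g)%N by exact: ltnW.
have [|F [FM FI Fd]] := faithful_dense_action hg (gen_rel g0 x0) (gen_generate g0 (x0 := x0)).
  move=> G a b ab; exists (universal g0 (x0 := x0) ab); first exact: universalM.
  by move=> i ig; split; [exact: universal_a|exact: universal_b].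
exists (range F); split=> //.
  split; first by rewrite inE; exists 1%g; rewrite // morph_one.
  move=> u v; rewrite !inE => -[x _ <-] [y _ <-].
  by exists (x / y)%g; rewrite // FM morph_inv.
pose FMb := isMultiplicative.Build _ _ F FM.
pose Fm : {multiplicative pi1 R x0 -> Sinf} := HB.pack F FMb.
exists Fm; split=> [u _|u v _ _ /FI //|u [v _ <-]]; first by exists u.
by exists v.
Qed.
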